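(* Let $\mathbb{K}$ be a real-quadratic field and let $B=(u,v)$ be a $\mathbb{Z}$-basis of $\mathcal{O}_\mathbb{K}$ with Gram matrix $S=\begin{pmatrix} 2uu' & uv'+u'v \\ uv'+u'v & 2vv'\end{pmatrix}$. Then the mappings \begin{align*} \widetilde{\phi}_B : \Sigma_\mathbb{K}/\{\pm I\} & \to SO_0(S_1;\mathbb{Q})/\{\pm I\}, \; \pm M \mapsto \pm \widetilde{M}, \\ \widetilde{\phi}_B : \Gamma^*_\mathbb{K}/\{\pm I\} & \to SO_0(S_1;\mathbb{Z})/\{\pm I\}, \; \pm M\mapsto \pm \widetilde{M}, \end{align*} are isomorphisms of groups. Moreover the mapping \[ \phi_B: \Gamma_\mathbb{K}/\{\pm I\} \to \mathcal{D}(S_1;\mathbb{Z}),\; \pm M\mapsto \widetilde{M}, \] is an isomorphism of groups.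
   Context: $\mathbb{K}=\mathbb{Q}(\sqrt{m})$, $m>1$ squarefree, with ring of integers $\mathcal{O}_\mathbb{K}=\mathbb{Z}+\mathbb{Z}\omega_\mathbb{K}$, where $\omega_\mathbb{K}=(m+\sqrt m)/2$ if $m\equiv 1 \bmod 4$ and $\omega_\mathbb{K}=m+\sqrt m$ otherwise. The conjugation $a\mapsto a'$ ($\sqrt m\mapsto -\sqrt m$) is extended to $\mathbb{K}(\sqrt\ell)$, $\ell\in\mathbb{N}$, by $\sqrt\ell{}'=\sqrt\ell$. $\Gamma_\mathbb{K}=SL_2(\mathcal{O}_\mathbb{K})$; $\Sigma_\mathbb{K}=\{\frac{1}{\sqrt\ell}L;\ \ell\in\mathbb{N},\ L\in\mathcal{O}_\mathbb{K}^{2\times2}\}\cap SL_2(\mathbb{R})$; $\Gamma^*_\mathbb{K}=\{\frac{1}{\sqrt{\det L}}L;\ L\in\mathcal{O}_\mathbb{K}^{2\times 2},\ \det L\gg0,\ \mathcal{I}(L)^2=\mathcal{O}_\mathbb{K}\det L\}$, where $\mathcal{I}(L)$ is the ideal generated by the entries of $L$ and $\gg0$ means totally positive. For an even symmetric matrix $T$ and $N\in\mathbb{N}$, $T_N=\begin{pmatrix}0&0&N\\0&T&0\\N&0&0\end{pmatrix}$; $SO_0(T;\mathbb{R})$ is the identity component of $\{U\in SL(\mathbb{R});\ U^{tr}TU=T\}$, $SO_0(T;\mathbb{Q})$, $SO_0(T;\mathbb{Z})$ its rational resp. integral matrices, and $\mathcal{D}(T;\mathbb{Z})=\{U\in SO_0(T;\mathbb{Z});\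 U\in I+\mathbb{Z}^{m\times m}T\}$ the discriminant kernel. Let $\varphi_B:\mathbb{K}\to\mathbb{Q}^2$, $xu+yv\mapsto (x,y)^{tr}$. For $M=\begin{pmatrix}\alpha&\beta\\\gamma&\delta\end{pmatrix}\in\Sigma_\mathbb{K}$, $\widetilde M\in SO_0(S_1;\mathbb{R})$ is the matrix $\begin{pmatrix}\widetilde\alpha & a^{tr}S & \widetilde\beta\\ b & K & c\\ \widetilde\gamma & d^{tr}S & \widetilde\delta\end{pmatrix}$ with $\widetilde\alpha=\alpha\alpha'$, $\widetilde\beta=-\beta\beta'$, $\widetilde\gamma=-\gamma\gamma'$, $\widetilde\delta=\delta\delta'$, $a=\varphi_B(-\alpha'\beta)$, $b=\varphi_B(-\alpha\gamma')$, $c=\varphi_B(\beta\delta')$, $d=\varphi_B(\gamma'\delta)$, and $K$ the matrix of the endomorphism $w\mapsto \alpha\delta' w+\beta\gamma' w'$ of $\mathbb{K}$ with respect to $B$. *)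

(* Defs.v *)
From HB Require Import structures.
From mathcomp Require Import all_boot all_order all_algebra.
From mathcomp Require Import all_classical all_reals all_analysis.
Import Order.TTheory GRing.Theory Num.Theory.
Import numFieldNormedType.Exports.

Set Implicit Arguments.
Unset Strict Implicit.
Unset Printing Implicit Defensive.

Local Open Scope classical_set_scope.
Local Open Scope ring_scope.

Definition squarefree (m : nat) : Prop :=
  forall d : nat, (d ^ 2 %| m)%N -> d = 1%N.

(* Groups are subsets of an ambient type, so that infinite matrix groups and
   their quotients are handled uniformly. *)
Definition is_group {T : Type} (op : T -> T -> T) (e : T) (G : set T) : Prop :=
  [/\ G e,
      forall x y, G x -> G y -> G (op x y),
      forall x y z, G x -> G y -> G z -> op x (op y z) = op (op x y) z,
      forall x, G x -> op e x = x /\ op x e = x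
    & forall x, G x -> exists y, [/\ G y, op x y = e & op y x = e]].

Definition group_iso {T U : Type}
    (opT : T -> T -> T) (eT : T) (G : set T)
    (opU : U -> U -> U) (eU : U) (H : set U) (f : T -> U) : Prop :=
  [/\ is_group opT eT G, is_group opU eU H, set_bij G H f
    & forall x y, G x -> G y -> f (opT x y) = opU (f x) (f y)].

(* For a matrix group G containing -I, the quotient G/{I,-I} is the set of
   cosets {M,-M} with M in G, under setwise multiplication. *)
Section ModSign.
Context {R : realType} {n : nat}.

Definition pm (M : 'M[R]_n) : set 'M[R]_n := [set M; - M].

Definition pm_mul (A B : set 'M[R]_n) : set 'M[R]_n :=
  [set M *m N | M in A & N in B].

Definition mod_pm (G : set 'M[R]_n) : set (set 'M[R]_n) := pm @` G.

Definition is_group_with_pm (G : set 'M[R]_n) : Prop :=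
  is_group mulmx 1%:M G /\ G (- 1%:M).

End ModSign.

Section RealQuadratic.
Variables (R : realType) (m : nat).

Definition sqrtm : R := Num.sqrt m%:R.

(* K is the subset Q + Q sqrt m of R.  The coordinates over (1, sqrt m) are
   unique when m is not a square; the value outside K is irrelevant. *)
Definition conjK (x : R) : R :=
  let p := xget ((0, 0) : rat * rat)
             [set p : rat * rat | x = ratr p.1 + ratr p.2 * sqrtm] in
  ratr p.1 - ratr p.2 * sqrtm.

Definition omegaK : R :=
  if (m %% 4 == 1)%N then (m%:R + sqrtm) / 2 else m%:R + sqrtm.

Definition OK : set R :=
  [set x | exists a b : int, x = a%:~R + b%:~R * omegaK].

Definition totally_positive (x : R) : Prop := 0 < x /\ 0 < conjK x.

Definition OK_basis (u v : R) : Prop :=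
  [/\ OK u, OK v
    & forall x, OK x ->
        exists! p : int * int, x = p.1%:~R * u + p.2%:~R * v].

Definition ideal_gen (A : set R) : set R :=
  [set x | exists (n : nat) (c a : 'I_n -> R),
     [/\ forall i, OK (c i), forall i, A (a i) & x = \sum_(i < n) c i * a i]].

Definition ideal_mul (I J : set R) : set R :=
  ideal_gen [set x * y | x in I & y in J].

Definition OK_mx (L : 'M[R]_2) : Prop := forall i j, OK (L i j).

Definition ideal_mx (L : 'M[R]_2) : set R :=
  ideal_gen [set x | exists i j, x = L i j].

Definition GammaK : set 'M[R]_2 := [set M | OK_mx M /\ \det M = 1].

Definition scale_sqrt (d : R) (L : 'M[R]_2) : 'M[R]_2 := (Num.sqrt d)^-1 *: L.

Definition SigmaK : set 'M[R]_2 :=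
  [set M | (exists (l : nat) (L : 'M[R]_2),
              [/\ (0 < l)%N, OK_mx L & M = scale_sqrt l%:R L])
           /\ \det M = 1].

Definition GammaK_star : set 'M[R]_2 :=
  [set M | exists L : 'M[R]_2,
     [/\ OK_mx L, totally_positive (\det L),
         ideal_mul (ideal_mx L) (ideal_mx L) = ideal_gen [set \det L]
       & M = scale_sqrt (\det L) L]].

End RealQuadratic.

Arguments SigmaK R m : clear implicits.
Arguments GammaK_star R m : clear implicits.
Arguments GammaK R m : clear implicits.

Section Orthogonal.
Context {R : realType}.

Definition T_N {n : nat} (T : 'M[R]_n) (N : nat) : 'M[R]_(1 + (n + 1)) :=
  block_mx 0                      (row_mx 0 (N%:R)%:M)
           (col_mx 0 (N%:R)%:M)   (block_mx T 0 0 0).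

Definition SO {n : nat} (T : 'M[R]_n) : set 'M[R]_n :=
  [set U | \det U = 1 /\ U^T *m T *m U = T].

Definition SO0 {n : nat} (T : 'M[R]_n) : set 'M[R]_n :=
  connected_component (SO T) 1%:M.

Definition SO0_rat {n : nat} (T : 'M[R]_n) : set 'M[R]_n :=
  [set U | SO0 T U /\ forall i j, exists q : rat, U i j = ratr q].

Definition SO0_int {n : nat} (T : 'M[R]_n) : set 'M[R]_n :=
  [set U | SO0 T U /\ forall i j, exists z : int, U i j = z%:~R].

Definition disc_kernel {n : nat} (T : 'M[R]_n) : set 'M[R]_n :=
  [set U | SO0_int T U /\
     exists X : 'M[int]_n, U = 1%:M + map_mx intr X *m T].

End Orthogonal.

Section Tilde.
Variables (R : realType) (m : nat) (u v : R).

Definition gram : 'M[R]_2 :=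
  let c := conjK m in
  \matrix_(i, j)
    if (i == 0) && (j == 0) then 2 * (u * c u)
    else if (i == 1) && (j == 1) then 2 * (v * c v)
    else u * c v + c u * v.

Definition phiB (x : R) : 'cV[rat]_2 :=
  xget 0 [set c : 'cV[rat]_2 | x = ratr (c 0 0) * u + ratr (c 1 0) * v].

Definition phiBR (x : R) : 'cV[R]_2 := map_mx ratr (phiB x).

Definition endo_mx (f : R -> R) : 'M[R]_2 := row_mx (phiBR (f u)) (phiBR (f v)).

(* M' stands for the entrywise conjugate of M. *)
Definition tilde_mx (M M' : 'M[R]_2) : 'M[R]_(1 + (2 + 1)) :=
  let al := M 0 0 in let be := M 0 1 in
  let ga := M 1 0 in let de := M 1 1 in
  let al' := M' 0 0 in let be' := M' 0 1 in
  let ga' := M' 1 0 in let de' := M' 1 1 in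
  let a := phiBR (- (al' * be)) in
  let b := phiBR (- (al * ga')) in
  let c := phiBR (be * de') in
  let d := phiBR (ga' * de) in
  let K := endo_mx (fun w => al * de' * w + be * ga' * conjK m w) in
  block_mx
    (al * al')%:M
    (row_mx (a^T *m gram) (- (be * be'))%:M)
    (col_mx b (- (ga * ga'))%:M)
    (block_mx K c (d^T *m gram) (de * de')%:M).

(* Conjugation on K(sqrt l) fixes sqrt l, so the conjugate of L / sqrt l is
   L' / sqrt l.  If sqrt l lies in K but not in Q, this differs from
   conjugation in K by a sign: tilde M is determined by M up to sign only,
   hence a relation ranging over all representations of M. *)
Definition is_tilde (M : 'M[R]_2) (U : 'M[R]_(1 + (2 + 1))) : Prop :=
  exists (l : nat) (L : 'M[R]_2),
    [/\ (0 < l)%N, OK_mx m L, M = scale_sqrt l%:R L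
      & U = tilde_mx M (scale_sqrt l%:R (map_mx (conjK m) L))].

(* For M with entries in K: no sign ambiguity. *)
Definition tildeK (M : 'M[R]_2) : 'M[R]_(1 + (2 + 1)) :=
  tilde_mx M (map_mx (conjK m) M).

(* phi is the well-defined map {M,-M} |-> {tilde M,- tilde M} on G/{I,-I}. *)
Definition induced_by_tilde (G : set 'M[R]_2)
    (phi : set 'M[R]_2 -> set 'M[R]_(1 + (2 + 1))) : Prop :=
  forall M, G M ->
    (exists U, is_tilde M U) /\ forall U, is_tilde M U -> phi (pm M) = pm U.

End Tilde.

(* Main.v *)
Require Import Defs.
From HB Require Import structures.
From mathcomp Require Import all_boot all_order all_algebra.
From mathcomp Require Import all_classical all_reals all_analysis.
From mathcomp Require Import ring lra zify.
Import Order.TTheory GRing.Theory Num.Theory.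
Import numFieldNormedType.Exports.

Set Implicit Arguments.
Unset Strict Implicit.
Unset Printing Implicit Defensive.

Local Open Scope classical_set_scope.
Local Open Scope ring_scope.

(* In the coordinates (x0, w, w', x3) the quadratic form of S_1 is minus twice the
   determinant of X = [[x0, -w], [-w', -x3]], and tilde M is X |-> M X M'^T, i.e. a
   Kronecker product M (x) M' after a base change.  Over R, moving the images of two
   isotropic vectors to a normal form shows that every isometry of determinant 1 is some
   A (x) B with det A det B = 1; the sign of det A is locally constant on SO, and SL_2(R)
   is generated by transvections, so SO_0 is the image of SL_2(R) x SL_2(R), with kernel
   {1, -1}.

   A (x) B is rational iff each A_ij B_kl is in K with conjugate A_kl B_ij; by Hilbert 90
   this forces (A, B) = (L, +- L') / sqrt l.  It is integral iff the A_ij B_kl are in O,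
   equivalently the A_ij A_kl are in O, which is the condition I(L)^2 = O det L; that
   Gamma^* lies in Sigma requires N(det L) to be a square.  Finally A (x) B acts trivially
   on the discriminant group iff A^-1 B = 1 modulo the different, and then the products of
   the numbers (w A_ij - w' B_ij) / (w - w'), w running over 1 and omega, are integers,
   which makes A integral with conjugate B. *)

(** * Conjugate pairs in a real-quadratic field *)

Section RationalNumbers.
Variable R : realType.
Implicit Types x y : R.

(** The arithmetic avoids factorisation of ideals. Integrality is mostly extracted from one fact: a
    rational x with s x^2 integral and s squarefree is an integer. With s = 1 and s = m it shows
    that O is the maximal order; with s the squarefree part of N(det L), or of the square of an
    auxiliary entry, it carries the arguments on Gamma^* and on the discriminant kernel. The
    topology is equally elementary. Connectedness is used only along affine lines U + t N, which
    suffice because transvections are affine in their parameter, and through the intermediate value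
    theorem for one polynomial on SO that has the sign of det A. *)

Definition is_rat x : Prop := exists q : rat, x = ratr q.

Lemma is_rat_int x : x \is a Num.int -> is_rat x.
Proof. by move=> /intrP[z ->]; exists z%:~R; rewrite ratr_int. Qed.

Lemma is_ratD x y : is_rat x -> is_rat y -> is_rat (x + y).
Proof. by move=> [p ->] [q ->]; exists (p + q); rewrite rmorphD. Qed.

Lemma is_ratM x y : is_rat x -> is_rat y -> is_rat (x * y).
Proof. by move=> [p ->] [q ->]; exists (p * q); rewrite rmorphM. Qed.

Lemma is_ratN x : is_rat x -> is_rat (- x).
Proof. by move=> [p ->]; exists (- p); rewrite rmorphN. Qed.

Lemma is_ratV x : is_rat x -> is_rat x^-1.
Proof. by move=> [p ->]; exists p^-1; rewrite fmorphV. Qed.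

Lemma squarefree1 : squarefree 1.
Proof. by move=> d; rewrite dvdn1 => /eqP; case: d => [|[|d]] //; rewrite !expnS; lia. Qed.

(** In lowest terms the square of the denominator divides [s], because it is coprime to the square
    of the numerator. *)
Lemma squarefree_rat_int x (s : nat) :
  squarefree s -> is_rat x -> x ^+ 2 * s%:R \is a Num.int -> x \is a Num.int.
Proof.
move=> sqf [q ->] /intrP[z].
have dn0 : (denq q)%:~R != 0 :> R by rewrite intr_eq0 denq_neq0.
have -> : ratr q = (numq q)%:~R / (denq q)%:~R :> R by [].
move=> /(congr1 (fun t => t * (denq q)%:~R ^+ 2)).
rewrite expr_div_n mulrAC mulfVK ?expf_neq0 // => h.
have {}h : numq q ^+ 2 * s%:Z = z * denq q ^+ 2.
  by apply: (@intr_inj R); rewrite rmorphM [RHS]rmorphM /= !rmorphXn.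
have /eqP d1 : `|denq q|%N = 1%N.
  apply: sqf; have := coprime_num_den q => cop.
  have cop2 : coprime (`|denq q| ^ 2) (`|numq q| ^ 2).
    by rewrite coprimeXl // coprimeXr // coprime_sym.
  rewrite -(Gauss_dvdr _ cop2).
  have := congr1 absz h; rewrite (abszM (_ ^+ 2)) (abszM z) !abszX absz_nat => ->.
  exact: dvdn_mull.
have -> : denq q = 1 by rewrite -[denq q]gez0_abs ?denq_ge0 //; move/eqP: d1 => ->.
by rewrite divr1 intr_int.
Qed.

Lemma rat_sqr_int x : is_rat x -> x ^+ 2 \is a Num.int -> x \is a Num.int.
Proof.
by move=> rx ix; apply: (@squarefree_rat_int x 1 squarefree1) => //; rewrite mulr1.
Qed.

Lemma squarefree_decomposition n : (0 < n)%N ->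
  exists s k : nat, [/\ (0 < s)%N, (0 < k)%N, squarefree s & n = (s * k ^ 2)%N].
Proof.
elim/ltn_ind: n => n IHn n_gt0.
have [sqf|/existsNP[d /not_implyP[dn d1]]] := pselect (squarefree n).
  by exists n, 1%N; split; rewrite ?muln1.
have d_gt1 : (1 < d)%N.
  by case: d dn d1 => [|[|d]] //; rewrite dvd0n => /eqP n0; rewrite n0 in n_gt0.
case/dvdnP: dn => e ne.
have e_gt0 : (0 < e)%N by move: n_gt0; rewrite ne muln_gt0 => /andP[].
have [|s [k [s0 k0 sqf ek]]] := IHn e _ e_gt0.
  by rewrite ne ltn_Pmulr // (ltn_exp2l 0 2).
exists s, (k * d)%N; split => //; first by rewrite muln_gt0 k0 /=; lia.
by rewrite ne ek expnMn mulnA.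
Qed.

End RationalNumbers.

Arguments is_rat {R} x.

Section QuadraticField.
Variables (R : realType) (m : nat).
Hypotheses (m_gt1 : (1 < m)%N) (m_sqfree : squarefree m).
Implicit Types x y z : R.

Local Notation rt := (sqrtm R m).
Local Notation om := (omegaK R m).

Definition omegaK_conj : R :=
  if (m %% 4 == 1)%N then (m%:R - rt) / 2 else m%:R - rt.
Local Notation om' := omegaK_conj.

(* [conj_in_K x y] means that x lies in K and y is its conjugate; conjugation is
   thus handled as the subring {(x, x')} of R * R, without choosing coordinates. *)
Definition conj_in_K x y : Prop :=
  exists p q : rat, x = ratr p + ratr q * rt /\ y = ratr p - ratr q * rt.

Definition conj_in_O x y : Prop :=
  exists a b : int, x = a%:~R + b%:~R * om /\ y = a%:~R + b%:~R * om'.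

Lemma sqr_rt : rt ^+ 2 = m%:R.
Proof. by rewrite sqr_sqrtr ?ler0n. Qed.

Lemma rt_gt0 : 0 < rt.
Proof. by rewrite sqrtr_gt0 ltr0n; lia. Qed.

Lemma rt_irrational : ~ is_rat rt.
Proof.
move=> rr.
have /intrP[z zE] : rt \is a Num.int by apply: rat_sqr_int; rewrite // sqr_rt.
have : `|z|%N = 1%N.
  apply: m_sqfree; suff -> : (`|z| ^ 2)%N = m by [].
  have : (z ^+ 2)%:~R = m%:R :> R by rewrite -sqr_rt zE rmorphXn.
  rewrite -[m%:R]/(m%:Z%:~R) => /intr_inj /(congr1 absz).
  by rewrite abszX absz_nat.
move=> z1; have : rt ^+ 2 = 1.
  have [z1'|z1'] : z = 1 \/ z = -1 by case: z z1 {zE} => k /=; lia.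
    by rewrite zE z1' expr1n.
  by rewrite zE z1' rmorphN sqrrN expr1n.
by rewrite sqr_rt => /eqP; rewrite -[1]/(1%:R) eqr_nat; lia.
Qed.

Lemma coords_inj (p q p' q' : rat) :
  ratr p + ratr q * rt = ratr p' + ratr q' * rt -> p = p' /\ q = q'.
Proof.
move=> e; have [qq|qq] := eqVneq q q'.
  by move: e; rewrite qq => /addIr /(fmorph_inj _).
case: rt_irrational; exists ((p - p') / (q' - q)).
have nz : ratr q' - ratr q != 0 :> R.
  by rewrite subr_eq0 (inj_eq (fmorph_inj _)) eq_sym.
rewrite rmorphM /= fmorphV !rmorphB /=; apply: (mulIf nz).
by rewrite mulfVK //; lra.
Qed.

Lemma conj_in_K_fun x y z : conj_in_K x y -> conj_in_K x z -> y = z.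
Proof. by move=> [p [q [-> ->]]] [p' [q' [/coords_inj[-> ->] ->]]]. Qed.

Lemma conj_in_K_sym x y : conj_in_K x y -> conj_in_K y x.
Proof. by move=> [p [q [-> ->]]]; exists p, (- q); rewrite rmorphN; split; ring. Qed.

Lemma conj_in_K_inj x y z : conj_in_K y x -> conj_in_K z x -> y = z.
Proof. by move=> /conj_in_K_sym + /conj_in_K_sym; apply: conj_in_K_fun. Qed.

Lemma conjKE x y : conj_in_K x y -> conjK m x = y.
Proof.
move=> [p [q [xE yE]]]; rewrite /conjK; case: xgetP => [pq _ /= e|/(_ (p, q))//].
by move: e; rewrite xE => /coords_inj[<- <-].
Qed.

Lemma conj_in_K_rat x : is_rat x -> conj_in_K x x.
Proof. by move=> [q ->]; exists q, 0; rewrite rmorph0; split; ring. Qed.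

Lemma is_rat_conj x : conj_in_K x x -> is_rat x.
Proof.
move=> [p [q [e1 e2]]]; exists p; suff: 2 * x = 2 * ratr p by lra.
by rewrite mulr_natl mulr2n {1}e1 e2; ring.
Qed.

Lemma conj_in_KD x x' y y' :
  conj_in_K x x' -> conj_in_K y y' -> conj_in_K (x + y) (x' + y').
Proof.
move=> [p [q [-> ->]]] [p' [q' [-> ->]]].
by exists (p + p'), (q + q'); rewrite !rmorphD /=; split; ring.
Qed.

Lemma conj_in_KN x x' : conj_in_K x x' -> conj_in_K (- x) (- x').
Proof. by move=> [p [q [-> ->]]]; exists (- p), (- q); rewrite !rmorphN /=; split; ring. Qed.

Lemma conj_in_KB x x' y y' :
  conj_in_K x x' -> conj_in_K y y' -> conj_in_K (x - y) (x' - y').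
Proof. by move=> hx /conj_in_KN hy; apply: conj_in_KD. Qed.

Lemma conj_in_KM x x' y y' :
  conj_in_K x x' -> conj_in_K y y' -> conj_in_K (x * y) (x' * y').
Proof.
move=> [p [q [-> ->]]] [p' [q' [-> ->]]].
exists (p * p' + q * q' * m%:R), (p * q' + q * p').
by rewrite !rmorphD /= !rmorphM /= ratr_nat -sqr_rt; split; ring.
Qed.

Lemma conj_in_K0 : conj_in_K 0 0.
Proof. by apply/conj_in_K_rat/is_rat_int/rpred0. Qed.

Lemma conj_in_K_eq0 x x' : conj_in_K x x' -> (x == 0) = (x' == 0).
Proof.
move=> h; apply/eqP/eqP => e; subst; first by apply: conj_in_K_fun h conj_in_K0.
by apply: conj_in_K_inj h conj_in_K0.
Qed.

Lemma conj_in_K_norm x x' : conj_in_K x x' -> is_rat (x * x').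
Proof.
move=> h; apply: is_rat_conj; have := conj_in_KM h (conj_in_K_sym h).
by rewrite [x' * x]mulrC.
Qed.

Lemma conj_in_K_trace x x' : conj_in_K x x' -> is_rat (x + x').
Proof.
move=> h; apply: is_rat_conj; have := conj_in_KD h (conj_in_K_sym h).
by rewrite [x' + x]addrC.
Qed.

Lemma conj_in_KV x x' : conj_in_K x x' -> conj_in_K x^-1 x'^-1.
Proof.
move=> h; have [x0|x0] := eqVneq x 0.
  have /eqP -> : x' == 0 by rewrite -(conj_in_K_eq0 h) x0.
  by rewrite x0 invr0; apply: conj_in_K0.
have x'0 : x' != 0 by rewrite -(conj_in_K_eq0 h).
have [-> ->] : x^-1 = x' * (x * x')^-1 /\ x'^-1 = x * (x * x')^-1.
  by split; field; rewrite ?x0 ?x'0.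
by apply: conj_in_KM (conj_in_K_rat (is_ratV (conj_in_K_norm h))); apply: conj_in_K_sym.
Qed.

Lemma m_mod4 : (m %% 4 == 1)%N \/ (m %% 4 != 1)%N /\ (m %% 4 != 0)%N.
Proof.
have [|h1] := boolP (m %% 4 == 1)%N; [by left|right; split => //].
by apply/negP => m0; have := m_sqfree (d := 2) m0.
Qed.

Lemma omega_conj : conj_in_K om om'.
Proof.
rewrite /om' /omegaK; case: ifP => _.
  by exists (m%:R / 2), (1 / 2); rewrite !rmorphM /= !fmorphV /= rmorph1 !ratr_nat; split; field.
by exists m%:R, 1; rewrite rmorph1 ratr_nat; split; ring.
Qed.

Lemma conj_in_O_K x y : conj_in_O x y -> conj_in_K x y.
Proof.
move=> [a [b [-> ->]]].
by apply: conj_in_KD; [|apply: conj_in_KM omega_conj];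
  apply/conj_in_K_rat/is_rat_int; rewrite intr_int.
Qed.

Lemma conj_in_O_int x : x \is a Num.int -> conj_in_O x x.
Proof. by move=> /intrP[z ->]; exists z, 0; rewrite !mul0r addr0. Qed.

Lemma conj_in_OD x x' y y' :
  conj_in_O x x' -> conj_in_O y y' -> conj_in_O (x + y) (x' + y').
Proof.
move=> [p [q [-> ->]]] [p' [q' [-> ->]]].
by exists (p + p'), (q + q'); rewrite !rmorphD /=; split; ring.
Qed.

Lemma conj_in_ON x x' : conj_in_O x x' -> conj_in_O (- x) (- x').
Proof. by move=> [p [q [-> ->]]]; exists (- p), (- q); rewrite !rmorphN /=; split; ring. Qed.

Lemma conj_in_OB x x' y y' :
  conj_in_O x x' -> conj_in_O y y' -> conj_in_O (x - y) (x' - y').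
Proof. by move=> hx /conj_in_ON hy; apply: conj_in_OD. Qed.

Lemma conj_in_O_omega : conj_in_O om om'.
Proof. by exists 0, 1; rewrite !add0r !mul1r. Qed.

(** [om] is a root of a monic integral polynomial, which is what closes Z + Z [om] under products
    and conjugation. If m is 1 modulo 4, the norm (m^2 - m) / 4 is integral because 4 divides m -
    1. *)
Lemma omega_trace_norm : om + om' \is a Num.int /\ om * om' \is a Num.int.
Proof.
have := sqr_rt; rewrite /omegaK_conj /omegaK; case: m_mod4 => [m1|[m1 _]] => r2.
  rewrite m1 /=; split.
    have -> : (m%:R + rt) / 2 + (m%:R - rt) / 2 = m%:R by field.
    by apply: natr_int.
  pose k := (m %/ 4)%N.
  have mE : m = (4 * k + 1)%N by rewrite /k; lia.
  have mR : m%:R = 4 * k%:R + 1 :> R by rewrite mE natrD natrM.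
  have -> : (m%:R + rt) / 2 * ((m%:R - rt) / 2) = (m%:R ^+ 2 - rt ^+ 2) / 4 by field.
  have -> : (m%:R ^+ 2 - rt ^+ 2) / 4 = (m * k)%:R by rewrite r2 natrM mR; field.
  by apply: natr_int.
rewrite (negPf m1); split.
  have -> : (m%:R + rt) + (m%:R - rt) = (2 * m)%:R by rewrite natrM; ring.
  by apply: natr_int.
have -> : (m%:R + rt) * (m%:R - rt) = m%:R ^+ 2 - m%:R by rewrite -r2; ring.
by rewrite rpredB ?rpredX ?natr_int.
Qed.

Lemma conj_in_OM x x' y y' :
  conj_in_O x x' -> conj_in_O y y' -> conj_in_O (x * y) (x' * y').
Proof.
move=> [p [q [-> ->]]] [p' [q' [-> ->]]].
have /intrP[t tE] := (omega_trace_norm).1; have /intrP[n nE] := (omega_trace_norm).2.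
exists (p * p' - q * q' * n), (p * q' + q * p' + q * q' * t).
by rewrite rmorphB !rmorphD !rmorphM /= -tE -nE; split; ring.
Qed.

Lemma conj_in_O_trace x x' : conj_in_O x x' -> x + x' \is a Num.int.
Proof.
move=> [a [b [-> ->]]].
rewrite (_ : _ + _ = 2 * a%:~R + b%:~R * (om + om')); last by ring.
by apply: rpredD; apply: rpredM; rewrite ?intr_int ?natr_int //; case: omega_trace_norm.
Qed.

Lemma conj_in_O_norm x x' : conj_in_O x x' -> x * x' \is a Num.int.
Proof.
move=> [a [b [-> ->]]].
have -> : (a%:~R + b%:~R * om) * (a%:~R + b%:~R * om')
    = a%:~R ^+ 2 + a%:~R * b%:~R * (om + om') + b%:~R ^+ 2 * (om * om') by ring.
case: omega_trace_norm => i1 i2.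
apply: rpredD; last by apply: rpredM i2; rewrite rpredX ?intr_int.
apply: rpredD; first by rewrite rpredX ?intr_int.
by apply: rpredM i1; rewrite rpredM ?intr_int.
Qed.

Lemma omega_sub_gt0 : 0 < om - om'.
Proof.
have := rt_gt0; rewrite /om' /omegaK; case: ifP => _ h.
  by rewrite (_ : _ - _ = rt) //; field.
by rewrite (_ : _ - _ = 2 * rt) ?mulr_gt0 //; ring.
Qed.

Lemma conj_in_O_same x : conj_in_O x x -> x \is a Num.int.
Proof.
move=> [a [b [e1 e2]]].
have : b%:~R * (om - om') = 0 by rewrite mulrBr; lra.
move/eqP; rewrite mulf_eq0 (gt_eqF omega_sub_gt0) orbF => /eqP b0.
by rewrite e1 b0 mul0r addr0 intr_int.
Qed.

Lemma conj_in_O_sym x y : conj_in_O x y -> conj_in_O y x.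
Proof.
move=> [a [b [-> ->]]]; have /intrP[t tE] := (omega_trace_norm).1.
by exists (a + b * t), (- b); rewrite rmorphD rmorphM rmorphN /= -tE; split; ring.
Qed.

(** [om - om'] is sqrt m or 2 sqrt m, a generator of the different; congruences modulo the different
    enter through this lemma. *)
Lemma conj_in_O_sub x x' :
  conj_in_O x x' -> exists z : int, x - x' = z%:~R * (om - om').
Proof. by move=> [a [b [-> ->]]]; exists b; ring. Qed.

Lemma OK_conj x : OK m x -> conj_in_O x (conjK m x).
Proof.
move=> [a [b xE]]; have h : conj_in_O x (a%:~R + b%:~R * om') by exists a, b.
by rewrite (conjKE (conj_in_O_K h)).
Qed.

Lemma conj_OK x y : conj_in_O x y -> OK m x.
Proof. by move=> [a [b [-> _]]]; exists a, b. Qed.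

Lemma conj_in_O_conjK x y : conj_in_O x y -> conjK m x = y.
Proof. by move=> /conj_in_O_K /conjKE. Qed.

(** Z + Z [om] is the maximal order. Twice x is t + f sqrt m, and f is an integer since f^2 m = t^2
    - 4 n with m squarefree. Reducing t^2 - m f^2 = 4 n modulo 4 shows that t and f have the same
    parity if m is 1 modulo 4, and that both are even otherwise. *)
Lemma trace_norm_int x y :
  conj_in_K x y -> x + y \is a Num.int -> x * y \is a Num.int -> conj_in_O x y.
Proof.
move=> [p [q [xE yE]]] /intrP[t tE] /intrP[n nE].
have pE : 2 * ratr p = t%:~R :> R by rewrite -tE xE yE; ring.
have /intrP[f fE] : 2 * ratr q \is a (@Num.int R).
  apply: (squarefree_rat_int m_sqfree).
    by apply: is_ratM; [apply/is_rat_int | exists q].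
  rewrite (_ : _ * _ = (t ^+ 2 - 4 * n)%:~R) ?intr_int //.
  rewrite rmorphB /= rmorphXn rmorphM /= -pE -nE xE yE -sqr_rt; ring.
have key : t ^+ 2 - m%:Z * f ^+ 2 = 4 * n.
  apply: (@intr_inj R).
  rewrite rmorphB (rmorphM _ m%:Z) (rmorphM _ 4) /= !rmorphXn /= -pE -fE -nE xE yE.
  by rewrite -[m%:~R]sqr_rt; ring.
have [k [e [tk eE]]] : exists k e : int, t = 2 * k + e /\ (e = 0 \/ e = 1).
  by exists (t %/ 2)%Z, (t %% 2)%Z; split; lia.
have [l [g [fl gE]]] : exists k e : int, f = 2 * k + e /\ (e = 0 \/ e = 1).
  by exists (f %/ 2)%Z, (f %% 2)%Z; split; lia.
have xf : 2 * x = t%:~R + f%:~R * rt by rewrite xE -pE -fE; ring.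
have yf : 2 * y = t%:~R - f%:~R * rt by rewrite yE -pE -fE; ring.
case: m_mod4 => [m1|[m1 m0]].
  pose j := (m %/ 4)%N.
  have mE : m = (4 * j + 1)%N by rewrite /j; lia.
  have eg : e = g.
    have mZ : m%:Z = 4 * j%:Z + 1 by lia.
    by case: eE tk => -> tk; case: gE fl => -> fl //; move: key; rewrite tk fl mZ !expr2; lia.
  (* x = (t - f m) / 2 + f [om], and (t - f m) / 2 = k - l - 2 j f because m = 4 j + 1 and e = g. *)
  exists (k - l - (2 * j)%:Z * f), f.
  rewrite /omegaK /om' m1 !(rmorphB, rmorphM) /= -[_%:Z%:~R]/((2 * j)%:R) natrM.
  have -> : m%:R = 4 * j%:R + 1 :> R by rewrite {1}mE natrD natrM.
  have -> : (k%:~R : R) = (t%:~R - e%:~R) / 2.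
    by rewrite tk rmorphD rmorphM /=; field.
  have -> : (l%:~R : R) = (f%:~R - g%:~R) / 2.
    by rewrite fl rmorphD rmorphM /=; field.
  by rewrite eg; split; apply: (@mulfI _ 2) => //; rewrite ?xf ?yf; field.
have [j [r [mE rE]]] : exists j r : nat, m = (4 * j + r)%N /\ (r = 2%N \/ r = 3%N).
  by exists (m %/ 4)%N, (m %% 4)%N; split; lia.
have [e0 g0] : e = 0 /\ g = 0.
  have mZ : m%:Z = 4 * j%:Z + r%:Z by lia.
  by case: rE mZ => -> mZ; case: eE tk => -> tk; case: gE fl => -> fl //;
    move: key; rewrite tk fl mZ !expr2; lia.
exists (k - l * m%:Z), l.
rewrite /omegaK /om' (negPf m1) rmorphB rmorphM /= -[_%:Z%:~R]/(m%:R).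
move: xf yf; rewrite tk fl e0 g0 !addr0 !rmorphM /= => xf yf.
by split; apply: (@mulfI _ 2) => //; rewrite ?xf ?yf; ring.
Qed.

(** The norm is rational with integral square, and the square of the trace is the trace of x^2 plus
    twice the norm; hence both are integers. *)
Lemma integrally_closed x y : conj_in_K x y -> conj_in_O (x ^+ 2) (y ^+ 2) -> conj_in_O x y.
Proof.
move=> h h2; have nI : x * y \is a Num.int.
  apply: (rat_sqr_int (conj_in_K_norm h)).
  by rewrite exprMn; apply: conj_in_O_norm.
apply: trace_norm_int => //; apply: (rat_sqr_int (conj_in_K_trace h)).
rewrite (_ : _ ^+ 2 = (x ^+ 2 + y ^+ 2) + 2 * (x * y)); last by ring.
by apply: rpredD; [apply: conj_in_O_trace | rewrite rpredM ?natr_int].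
Qed.

(** The free factor [k] lets the entries of a matrix be brought over one common denominator. *)
Lemma clear_denominator x y : conj_in_K x y ->
  exists2 n : nat, (0 < n)%N & forall k : nat, conj_in_O ((n * k)%:R * x) ((n * k)%:R * y).
Proof.
move=> [p [q [xE yE]]]; exists (`|(denq p * denq q)%R|%N).
  by rewrite absz_gt0 mulf_neq0 ?denq_neq0.
set d := (`|_|%N).
move=> k; suff h : conj_in_O (d%:R * x) (d%:R * y).
  by rewrite natrM ![_ * k%:R]mulrC -!mulrA; apply: conj_in_OM h; apply: conj_in_O_int.
have dE : d%:R = (denq p)%:~R * (denq q)%:~R :> R.
  by rewrite -[LHS]/(d%:Z%:~R) gez0_abs ?mulr_ge0 ?denq_ge0 // rmorphM.
have rE (r : rat) : (denq r)%:~R * ratr r = (numq r)%:~R :> R.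
  by rewrite -[ratr r]/((numq r)%:~R / (denq r)%:~R) mulrC mulfVK // intr_eq0 denq_neq0.

have hr : conj_in_O rt (- rt).
  apply: trace_norm_int; first by exists 0, 1; rewrite rmorph0 rmorph1; split; ring.
    by rewrite addrN.
  by rewrite mulrN -expr2 sqr_rt rpredN natr_int.
rewrite dE.
have [-> ->] : (denq p)%:~R * (denq q)%:~R * x
    = (denq q)%:~R * (numq p)%:~R + (denq p)%:~R * (numq q)%:~R * rt /\
  (denq p)%:~R * (denq q)%:~R * y
    = (denq q)%:~R * (numq p)%:~R + (denq p)%:~R * (numq q)%:~R * - rt.
  by rewrite -!rE xE yE; split; ring.
by apply: conj_in_OD; [|apply: conj_in_OM hr]; apply: conj_in_O_int;
  rewrite rpredM ?intr_int.
Qed.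

End QuadraticField.

(** * Isometries of the determinant form on 2 x 2 matrices *)

Section Indices.
Variable R : realType.

Definition k0 : 'I_(1 + (2 + 1)) := @Ordinal 4 0 isT.
Definition k1 : 'I_(1 + (2 + 1)) := @Ordinal 4 1 isT.
Definition k2 : 'I_(1 + (2 + 1)) := @Ordinal 4 2 isT.
Definition k3 : 'I_(1 + (2 + 1)) := @Ordinal 4 3 isT.

Lemma ind4 (P : 'I_(1 + (2 + 1)) -> Prop) : P k0 -> P k1 -> P k2 -> P k3 -> forall i, P i.
Proof.
move=> p0 p1 p2 p3 [[|[|[|[|//]]]] h].
- by rewrite (_ : Ordinal h = k0) //; apply: val_inj.
- by rewrite (_ : Ordinal h = k1) //; apply: val_inj.
- by rewrite (_ : Ordinal h = k2) //; apply: val_inj.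
- by rewrite (_ : Ordinal h = k3) //; apply: val_inj.
Qed.

Lemma ind2 (P : 'I_2 -> Prop) : P 0 -> P 1 -> forall i, P i.
Proof.
move=> p0 p1 [[|[|//]] h].
- by rewrite (_ : Ordinal h = 0) //; apply: val_inj.
- by rewrite (_ : Ordinal h = 1) //; apply: val_inj.
Qed.

Lemma k0E : k0 = lshift (2 + 1) 0. Proof. exact: val_inj. Qed.
Lemma k1E : k1 = rshift 1 (lshift 1 0). Proof. exact: val_inj. Qed.
Lemma k2E : k2 = rshift 1 (lshift 1 1). Proof. exact: val_inj. Qed.
Lemma k3E : k3 = rshift 1 (rshift 2 0). Proof. exact: val_inj. Qed.
Definition kE := (k0E, k1E, k2E, k3E).

Lemma sum2 (V : nmodType) (F : 'I_2 -> V) : \sum_i F i = F 0 + F 1.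
Proof.
rewrite !big_ord_recl big_ord0 addr0; congr (F _ + F _); exact: val_inj.
Qed.

Lemma sum4 (V : nmodType) (F : 'I_(1 + (2 + 1)) -> V) :
  \sum_i F i = F k0 + F k1 + F k2 + F k3.
Proof.
rewrite !big_ord_recl big_ord0 addr0 !addrA.
by congr (F _ + F _ + F _ + F _); apply: val_inj.
Qed.

Lemma det2 (A : 'M[R]_2) : \det A = A 0 0 * A 1 1 - A 0 1 * A 1 0.
Proof.
rewrite (expand_det_row _ 0) sum2 /cofactor !det_mx11 !mxE /= expr0 expr1 mul1r.
rewrite (_ : lift 0 0 = 1 :> 'I_2); last exact: val_inj.
rewrite (_ : lift 1 0 = 0 :> 'I_2); last exact: val_inj.
ring.
Qed.

Lemma mulmx2 (A B : 'M[R]_2) i j : (A *m B) i j = A i 0 * B 0 j + A i 1 * B 1 j.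
Proof. by rewrite mxE sum2. Qed.

End Indices.

Definition blockE := (block_mxEul, block_mxEur, block_mxEdl, block_mxEdr,
  row_mxEl, row_mxEr, col_mxEu, col_mxEd).

Lemma border_mxE (R : realType) (a : 'M[R]_1) (r : 'rV[R]_2) (b : 'M[R]_1) (c : 'cV[R]_2)
    (e : 'M[R]_1) (K : 'M[R]_2) (d : 'cV[R]_2) (s : 'rV[R]_2) (f : 'M[R]_1) :
  let M := block_mx a (row_mx r b) (col_mx c e) (block_mx K d s f) in
  ((M k0 k0 = a 0 0) * (M k0 k1 = r 0 0) * (M k0 k2 = r 0 1) * (M k0 k3 = b 0 0) *
   (M k1 k0 = c 0 0) * (M k1 k1 = K 0 0) * (M k1 k2 = K 0 1) * (M k1 k3 = d 0 0) *
   (M k2 k0 = c 1 0) * (M k2 k1 = K 1 0) * (M k2 k2 = K 1 1) * (M k2 k3 = d 1 0) *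
   (M k3 k0 = e 0 0) * (M k3 k1 = s 0 0) * (M k3 k2 = s 0 1) * (M k3 k3 = f 0 0))%type.
Proof. by do !split; rewrite /= !kE !blockE. Qed.

Lemma row_mx2E (R : realType) (a b : 'cV[R]_2) i :
  (((row_mx a b : 'M[R]_2) i 0 = a i 0) * ((row_mx a b : 'M[R]_2) i 1 = b i 0))%type.
Proof.
by split; [rewrite -(row_mxEl a b) | rewrite -(row_mxEr a b)]; congr (row_mx a b _ _);
  apply: val_inj.
Qed.

(** * Kronecker products of 2 x 2 matrices as isometries *)

Section TensorSquare.
Variable R : realType.
Implicit Types A B C D : 'M[R]_2.
Local Notation M4 := 'M[R]_(1 + (2 + 1)).

(* The coordinates (x0, x1, x2, x3) of R^4 stand for the matrix
   [[x0, - x1], [- x2, - x3]], on which (A, B) acts by X |-> A X B^T; minus its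
   determinant is x0 x3 + x1 x2, half the quadratic form of [antidiag]. *)
Definition sgn4 (i : nat) : R := if i is 0%N then 1 else -1.
Definition hi4 (i : nat) : 'I_2 := match i with 0%N | 1%N => 0 | _ => 1 end.
Definition lo4 (i : nat) : 'I_2 := match i with 0%N | 2%N => 0 | _ => 1 end.

Definition tens A B : M4 :=
  \matrix_(i, j) (sgn4 i * sgn4 j * A (hi4 i) (hi4 j) * B (lo4 i) (lo4 j)).

Lemma tensE A B i j :
  tens A B i j = sgn4 i * sgn4 j * A (hi4 i) (hi4 j) * B (lo4 i) (lo4 j).
Proof. by rewrite mxE. Qed.

Definition antidiag : M4 :=
  \matrix_(i, j) match (i : nat), (j : nat) with
                 | 0%N, 3%N | 1%N, 2%N | 2%N, 1%N | 3%N, 0%N => 1 | _, _ => 0 end.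

Lemma tensM A B C D : tens A B *m tens C D = tens (A *m C) (B *m D).
Proof.
apply/matrixP => i j; rewrite !mxE sum4 !mxE /= !sum2; ring.
Qed.

Definition pair4 (a c : 'I_2) : 'I_(1 + (2 + 1)) :=
  if a == 0 then if c == 0 then k0 else k1 else if c == 0 then k2 else k3.

Lemma tens_pair A B a b c d :
  tens A B (pair4 a c) (pair4 b d) = sgn4 (pair4 a c) * sgn4 (pair4 b d) * (A a b * B c d).
Proof.
by move: a b c d; elim/ind2; elim/ind2; elim/ind2; elim/ind2; rewrite mxE /= -!mulrA.
Qed.

Lemma sgn4_pairC a c : sgn4 (pair4 a c) = sgn4 (pair4 c a).
Proof. by move: a c; elim/ind2; elim/ind2. Qed.

Lemma sgn4_neq0 i : sgn4 i != 0.
Proof. by case: i => [|i]; rewrite /= ?oppr_eq0 oner_eq0. Qed.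

Lemma sgn4K i x : sgn4 i * (sgn4 i * x) = x.
Proof. by case: i => [|i] /=; ring. Qed.

Lemma tens1 : tens 1%:M 1%:M = 1%:M.
Proof.
apply/matrixP; elim/ind4; elim/ind4; rewrite !mxE /=; ring.
Qed.

Lemma tens_antidiag A B :
  (tens A B)^T *m antidiag *m tens A B = (\det A * \det B) *: antidiag.
Proof.
apply/matrixP; elim/ind4; elim/ind4; rewrite mxE sum4 !mxE !sum4 !mxE /= !det2; ring.
Qed.

Lemma tensZl (t : R) A A' B : tens (A + t *: A') B = tens A B + t *: tens A' B.
Proof. apply/matrixP => i j; rewrite !mxE; ring. Qed.

Lemma tensZr (t : R) A B B' : tens A (B + t *: B') = tens A B + t *: tens A B'.
Proof. apply/matrixP => i j; rewrite !mxE; ring. Qed.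

Lemma tensNl A B : tens (- A) B = - tens A B.
Proof. apply/matrixP => i j; rewrite !mxE; ring. Qed.

Lemma tensNr A B : tens A (- B) = - tens A B.
Proof. apply/matrixP => i j; rewrite !mxE; ring. Qed.

Lemma antidiag2 : antidiag *m antidiag = 1%:M.
Proof.
apply/matrixP; elim/ind4; elim/ind4; rewrite mxE sum4 !mxE /=; ring.
Qed.

(** The steps add a multiple [t] of a fixed matrix instead of multiplying by a transvection, so that
    each step is an affine line in [t]. The principle serves both for determinants and for
    connectedness. *)
Lemma SL2_ind (P : 'M[R]_2 -> Prop) :
  P 1%:M ->
  (forall A t, \det A = 1 -> P A -> P (A + t *: (A *m delta_mx 0 1))) ->
  (forall A t, \det A = 1 -> P A -> P (A + t *: (A *m delta_mx 1 0))) ->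
  forall A, \det A = 1 -> P A.
Proof.
move=> P1 Pu Pl.
pose U t : 'M[R]_2 := 1%:M + t *: delta_mx 0 1.
pose L t : 'M[R]_2 := 1%:M + t *: delta_mx 1 0.
have dU t : \det (U t) = 1 by rewrite det2 !mxE /=; ring.
have dL t : \det (L t) = 1 by rewrite det2 !mxE /=; ring.
have {}Pu A t : \det A = 1 -> P A -> P (A *m U t).
  by rewrite /U mulmxDr mulmx1 -scalemxAr; apply: Pu.
have {}Pl A t : \det A = 1 -> P A -> P (A *m L t).
  by rewrite /L mulmxDr mulmx1 -scalemxAr; apply: Pl.
have main A : \det A = 1 -> A 1 0 != 0 -> P A.
  move=> dA c0; have := dA; rewrite det2 => dA'.
  (* With c the lower left entry, U((a - 1) / c) L(c) has first column (a, c) and lower right entry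
     1; the last factor keeps this column and turns that entry into d. *)
  have -> : A = 1%:M *m U ((A 0 0 - 1) / A 1 0) *m L (A 1 0) *m U ((A 1 1 - 1) / A 1 0).
    have bE : A 0 1 = (A 0 0 * A 1 1 - 1) / A 1 0.
      by rewrite -dA'; field.
    apply/matrixP; elim/ind2; elim/ind2; rewrite !mul1mx !mulmx2 !mxE /= ?bE; by field.
  by apply: (Pu); [|apply: (Pl); [|apply: (Pu)]] => //;
    rewrite ?det_mulmx ?dU ?dL ?det1 ?mulr1.
move=> A dA; have [c0|c0] := eqVneq (A 1 0) 0; last exact: main.
have := dA; rewrite det2 c0 mulr0 subr0 => ad.
(* Multiplication by [L 1] adds the second column to the first; the lower left entry becomes
   [A 1 1], which is nonzero since [A 0 0 * A 1 1] is 1. *)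
have -> : A = A *m L 1 *m L (-1).
  apply/matrixP; elim/ind2; elim/ind2; rewrite !mulmx2 !mxE /=; ring.
apply: (Pl); first by rewrite det_mulmx dA dL mulr1.
apply: main; first by rewrite det_mulmx dA dL mulr1.
rewrite mulmx2 !mxE /= c0; apply/eqP => d0; move: ad.
have -> : A 1 1 = 0 by rewrite -d0; ring.
by rewrite mulr0 => /eqP; rewrite eq_sym oner_eq0.
Qed.

Lemma det_antidiag : \det antidiag != 0.
Proof.
apply/eqP => d0; have := congr1 determinant antidiag2.
by rewrite det_mulmx d0 mul0r det1 => /eqP; rewrite eq_sym oner_eq0.
Qed.

Lemma orth_det_sqr (U : M4) : U^T *m antidiag *m U = antidiag -> \det U ^+ 2 = 1.
Proof.
move=> /(congr1 determinant); rewrite !det_mulmx det_tr => h.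
apply: (mulfI det_antidiag); rewrite mulr1 -{2}h; ring.
Qed.

(** Orthogonality leaves only the determinants 1 and -1. A transvection is the square of another
    one, as [delta_mx i j] squares to 0 for distinct i and j, so its tensor has a square as
    determinant. *)
Lemma det_tens A B : \det A = 1 -> \det B = 1 -> \det (tens A B) = 1.
Proof.
have orth C D : \det C = 1 -> \det D = 1 -> \det (tens C D) ^+ 2 = 1.
  by move=> dC dD; apply: orth_det_sqr; rewrite tens_antidiag dC dD mulr1 scale1r.
have half (t : R) (E : 'M[R]_2) : E *m E = 0 ->
    1%:M + t *: E = (1%:M + (t / 2) *: E) *m (1%:M + (t / 2) *: E).
  move=> E0; rewrite mulmxDl mul1mx mulmxDr mulmx1 -scalemxAr -scalemxAl E0 !scaler0.
  by rewrite addr0 -addrA -scalerDl; congr (_ + _ *: _); field.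
have dd (i j : 'I_2) t : i != j -> \det (1%:M + t *: delta_mx i j : 'M[R]_2) = 1.
  by move: i j; elim/ind2; elim/ind2 => // _; rewrite det2 !mxE /=; ring.
have d0 (i j : 'I_2) : i != j -> delta_mx i j *m delta_mx i j = 0 :> 'M[R]_2.
  by move=> ij; rewrite mul_delta_mx_0 // eq_sym.
have stepl (i j : 'I_2) C t : i != j -> \det (tens C 1%:M) = 1 ->
    \det (tens (C + t *: (C *m delta_mx i j)) 1%:M) = 1.
  move=> ij dC; rewrite scalemxAr -[X in tens (X + _)]mulmx1 -mulmxDr half ?d0 //.
  rewrite -[X in tens _ X]mulmx1 -tensM det_mulmx dC mul1r.
  by rewrite -[X in tens _ X]mulmx1 -tensM det_mulmx -expr2 orth ?det1 ?dd.
have stepr (i j : 'I_2) C D t : i != j -> \det (tens C D) = 1 ->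
    \det (tens C (D + t *: (D *m delta_mx i j))) = 1.
  move=> ij dC; rewrite scalemxAr -[X in tens _ (X + _)]mulmx1 -mulmxDr half ?d0 //.
  rewrite -[X in tens X _]mulmx1 -tensM det_mulmx dC mul1r.
  by rewrite -[X in tens X _]mulmx1 -tensM det_mulmx -expr2 orth ?det1 ?dd.
move=> dA; have hA : \det (tens A 1%:M) = 1.
  move: A dA; apply: SL2_ind => [|C t _|C t _]; first by rewrite tens1 det1.
    exact: stepl.
  exact: stepl.
by move: B; apply: SL2_ind => [|C t _|C t _] //; apply: stepr.
Qed.

(** An isotropic vector is a 2 x 2 matrix of determinant 0, hence a product x y^T; the signs are
    those of the coordinates. *)
Lemma rank_one_coords (a0 a1 a2 a3 : R) :
  a0 * a3 + a1 * a2 = 0 -> [|| a0 != 0, a1 != 0, a2 != 0 | a3 != 0] ->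
  exists x0 x1 y0 y1 : R,
    [/\ (x0 != 0) || (x1 != 0), (y0 != 0) || (y1 != 0)
      & [/\ a0 = x0 * y0, a1 = - (x0 * y1), a2 = - (x1 * y0) & a3 = - (x1 * y1)]].
Proof.
move=> iso nz; have [/andP[/eqP z0 /eqP z1]|nz01] := boolP ((a0 == 0) && (a1 == 0)).
  exists 0, 1, (- a2), (- a3); move: nz; rewrite z0 z1 eqxx /= => nz.
  by rewrite !oppr_eq0 oner_eq0 /= nz; split => //; split; ring.
have n0 : a0 ^+ 2 + a1 ^+ 2 != 0 by rewrite paddr_eq0 ?sqr_ge0 // !sqrf_eq0.
have h2 : a1 ^+ 2 * a2 = - (a0 * a1 * a3).
  have -> : a1 ^+ 2 * a2 = a1 * (a1 * a2) by ring.
  by rewrite (_ : a1 * a2 = - (a0 * a3)); [ring|lra].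
have h3 : a0 ^+ 2 * a3 = - (a0 * a1 * a2).
  have -> : a0 ^+ 2 * a3 = a0 * (a0 * a3) by ring.
  by rewrite (_ : a0 * a3 = - (a1 * a2)); [ring|lra].
(* y is the first row of the matrix. The second row is a multiple of y, with factor their inner
   product divided by the squared length of y. *)
exists 1, ((a1 * a3 - a0 * a2) / (a0 ^+ 2 + a1 ^+ 2)), a0, (- a1).
split; rewrite ?oner_eq0 ?oppr_eq0 -?negb_and //.
split; try ring.
  apply: (mulfI n0); rewrite mulrN mulrA mulrCA mulfV // mulr1 mulrDl h2; ring.
apply: (mulfI n0); rewrite mulrN mulrA mulrCA mulfV // mulr1 mulrDl h3; ring.
Qed.

Lemma complete_column (x0 x1 : R) : (x0 != 0) || (x1 != 0) ->
  exists A : 'M[R]_2, [/\ \det A = 1, A 0 0 = x0 & A 1 0 = x1].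
Proof.
move=> nz; have n0 : x0 ^+ 2 + x1 ^+ 2 != 0.
  by rewrite paddr_eq0 ?sqr_ge0 // !sqrf_eq0 negb_and.
exists (\matrix_(i, j) if j == 0 then if i == 0 then x0 else x1
   else if i == 0 then - x1 / (x0 ^+ 2 + x1 ^+ 2) else x0 / (x0 ^+ 2 + x1 ^+ 2)).
by rewrite det2 !mxE /=; split => //; field.
Qed.

Definition orth (U : M4) := U^T *m antidiag *m U = antidiag.

Lemma orthE (U : M4) i j : orth U ->
  U k0 i * U k3 j + U k1 i * U k2 j + U k2 i * U k1 j + U k3 i * U k0 j = antidiag i j.
Proof.
move=> <-; rewrite mxE sum4 !mxE !sum4 !mxE /=; ring.
Qed.

Lemma orthM (U V : M4) : orth U -> orth V -> orth (U *m V).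
Proof.
rewrite /orth => hU hV.
by rewrite trmx_mul -{2}hV -{2}hU !mulmxA.
Qed.

Lemma orth_tens A B : \det A * \det B = 1 -> orth (tens A B).
Proof. by move=> h; rewrite /orth tens_antidiag h scale1r. Qed.

Lemma tens_inv A B : \det A = 1 -> \det B = 1 ->
  tens (invmx A) (invmx B) *m tens A B = 1%:M.
Proof. by move=> dA dB; rewrite tensM !mulVmx ?tens1 // unitmxE ?dA ?dB unitr1. Qed.

Definition e_col (k : 'I_(1 + (2 + 1))) (U : M4) := forall i, U i k = (i == k)%:R.

Lemma e_colM k U V : e_col k U -> e_col k V -> e_col k (U *m V).
Proof.
move=> hU hV i; rewrite mxE -hU (bigD1 k) //= hV eqxx mulr1 big1 ?addr0 //.
by move=> j /negPf jk; rewrite hV jk mulr0.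
Qed.

(** The first column of [U] is isotropic, and nonzero because it pairs to 1 with the last one; so it
    is x y^T. If x and y are the first columns of two matrices in SL_2, their tensor has the same
    first column as [U], and its inverse moves that column to the basis vector. *)
Lemma reduce_col0 U : orth U ->
  exists A B, [/\ \det A = 1, \det B = 1 & e_col k0 (tens A B *m U)].
Proof.
move=> oU; have := orthE k0 k0 oU; rewrite mxE /= => iso.
have [||x0 [x1 [y0 [y1 [nx ny [e0 e1 e2 e3]]]]]] :=
    @rank_one_coords (U k0 k0) (U k1 k0) (U k2 k0) (U k3 k0).
- by lra.
- apply/negPn/negP; rewrite !negb_or !negbK => /and4P[/eqP z0 /eqP z1 /eqP z2 /eqP z3].
  have := orthE k0 k3 oU; rewrite z0 z1 z2 z3 mxE /= !mul0r !addr0 => /eqP.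
  by rewrite eq_sym oner_eq0.
have [A [dA A0 A1]] := complete_column nx; have [B [dB B0 B1]] := complete_column ny.
exists (invmx A), (invmx B); rewrite !det_inv dA dB invr1; split => //.
have col : forall i, U i k0 = tens A B i k0.
  by elim/ind4; rewrite !mxE /= ?A0 ?B0 ?A1 ?B1 ?e0 ?e1 ?e2 ?e3; ring.
move=> i; transitivity ((tens (invmx A) (invmx B) *m tens A B) i k0).
  by rewrite !mxE; apply: eq_bigr => j _; rewrite col.
by rewrite tens_inv // mxE.
Qed.

Definition upper (b : R) : 'M[R]_2 := 1%:M + b *: delta_mx 0 1.

Lemma det_upper b : \det (upper b) = 1.
Proof. by rewrite det2 !mxE /=; ring. Qed.

Lemma upperM b c : upper b *m upper c = upper (b + c).
Proof. apply/matrixP; elim/ind2; elim/ind2; rewrite mulmx2 !mxE /=; ring. Qed.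

Lemma upper0 : upper 0 = 1%:M.
Proof. by rewrite /upper scale0r addr0. Qed.

Lemma e_col_upper b c : e_col k0 (tens (upper b) (upper c)).
Proof. by elim/ind4; rewrite !mxE /=; ring. Qed.

(** Pairing with the first column gives [U k3 k3] the value 1, and isotropy expresses [U k0 k3] by
    the two middle entries. Such a column is the last one of a tensor of unipotent upper triangular
    matrices, and these tensors fix the first basis vector. *)
Lemma reduce_col3 U : orth U -> e_col k0 U ->
  exists A B, [/\ \det A = 1, \det B = 1, e_col k0 (tens A B *m U)
    & e_col k3 (tens A B *m U)].
Proof.
move=> oU c0; have := orthE k0 k3 oU; have := orthE k3 k3 oU.
rewrite !c0 !mxE /= => iso u3.
have {}u3 : U k3 k3 = 1 by lra.
have {}iso : U k0 k3 = - (U k1 k3 * U k2 k3) by move: iso; rewrite u3; lra.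
exists (upper (- U k1 k3)), (upper (- U k2 k3)); rewrite !det_upper; split => //.
  by apply: e_colM => //; apply: e_col_upper.
have col : forall i, U i k3 = tens (upper (U k1 k3)) (upper (U k2 k3)) i k3.
  by elim/ind4; rewrite [RHS]mxE /= !mxE /= ?u3 ?iso; ring.
move=> i; transitivity ((tens (upper (- U k1 k3)) (upper (- U k2 k3))
    *m tens (upper (U k1 k3)) (upper (U k2 k3))) i k3).
  by rewrite mxE [RHS]mxE; apply: eq_bigr => j _; rewrite (col j).
by rewrite tensM !upperM !addNr !upper0 tens1 mxE.
Qed.

Definition diag2 (a b : R) : 'M[R]_2 :=
  \matrix_(i, j) if i == j then if i == 0 then a else b else 0.

Lemma det_diag2 a b : \det (diag2 a b) = a * b.
Proof. by rewrite det2 !mxE /=; ring. Qed.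

(** What remains is an isometry of the hyperbolic plane of the middle coordinates, diagonal or
    antidiagonal, and determinant 1 excludes the latter. As p may be negative, [orth_is_tens]
    controls only the product of the two determinants. *)
Lemma fix_hyperbolic U : orth U -> e_col k0 U -> e_col k3 U -> \det U = 1 ->
  exists2 p : R, p != 0 & U = tens (diag2 1 p^-1) (diag2 1 p).
Proof.
move=> oU c0 c3.
have z1 : U k3 k1 = 0 by have := orthE k0 k1 oU; rewrite !c0 !mxE /=; lra.
have z2 : U k3 k2 = 0 by have := orthE k0 k2 oU; rewrite !c0 !mxE /=; lra.
have y1 : U k0 k1 = 0 by have := orthE k3 k1 oU; rewrite !c3 !mxE /=; lra.
have y2 : U k0 k2 = 0 by have := orthE k3 k2 oU; rewrite !c3 !mxE /=; lra.
set p := U k1 k1; set q := U k1 k2; set r := U k2 k1; set s := U k2 k2.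
have e11 : p * r = 0 by have := orthE k1 k1 oU; rewrite z1 y1 !mxE /= -/p -/r; lra.
have e12 : p * s + r * q = 1.
  by have := orthE k1 k2 oU; rewrite z1 y1 !mxE /= -/p -/r -/s -/q; lra.
have e22 : q * s = 0 by have := orthE k2 k2 oU; rewrite z2 y2 !mxE /= -/q -/s; lra.
pose K : 'M[R]_2 := \matrix_(i, j)
  if i == 0 then if j == 0 then p else q else if j == 0 then r else s.
have -> : \det U = p * s - q * r.
  have -> : U = block_mx 1%:M 0 0 (block_mx K 0 0 1%:M).
    by apply/matrixP; elim/ind4; elim/ind4; rewrite ?c0 ?c3 ?z1 ?z2 ?y1 ?y2 -/p -/q -/r -/s /=;
      rewrite !kE !blockE !mxE /= ?mulr1n.
  by rewrite !det_ublock !det1 mul1r mulr1 det2 !mxE /=.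
move=> dU; have ps : p * s = 1 by lra.
have p0 : p != 0 by apply/eqP => p0; move: ps; rewrite p0 mul0r; lra.
have s0 : s != 0 by apply/eqP => s0; move: ps; rewrite s0 mulr0; lra.
have r0 : r = 0 by apply: (mulfI p0); rewrite e11 mulr0.
have q0 : q = 0 by apply: (mulIf s0); rewrite e22 mul0r.
have sE : s = p^-1 by apply: (mulfI p0); rewrite ps mulfV.
exists p => //; apply/matrixP.
by elim/ind4; elim/ind4; rewrite ?c0 ?c3 ?z1 ?z2 ?y1 ?y2 -/p -/q -/r -/s ?r0 ?q0 ?sE !mxE /=;
   try ring; field.
Qed.

Lemma orth_is_tens U : orth U -> \det U = 1 ->
  exists A B, \det A * \det B = 1 /\ U = tens A B.
Proof.
move=> oU dU.
have [A [B [dA dB c0]]] := reduce_col0 oU.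
have oAB : orth (tens A B *m U) by apply: orthM => //; apply: orth_tens; rewrite dA dB mulr1.
have [C [D [dC dD c0' c3]]] := reduce_col3 oAB c0.
have oCD : orth (tens C D *m (tens A B *m U)).
  by apply: orthM => //; apply: orth_tens; rewrite dC dD mulr1.
have dCD : \det (tens C D *m (tens A B *m U)) = 1 by rewrite !det_mulmx !det_tens // dU !mulr1.
have [p p0 VE] := fix_hyperbolic oCD c0' c3 dCD.
exists (invmx A *m invmx C *m diag2 1 p^-1), (invmx B *m invmx D *m diag2 1 p).
rewrite !det_mulmx !det_inv !det_diag2 dA dB dC dD invr1 !mul1r mulVf //; split => //.
by rewrite -!tensM -VE -mulmxA (mulmxA (tens _ _) (tens C D)) tens_inv // mul1mx mulmxA
           tens_inv // mul1mx.
Qed.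

(** For fixed c and d, the entries of [tens A B] in the rows (a, c) and columns (b, d) form, up to
    signs, the matrix B_cd A, of determinant B_cd^2 [\det A]. The signed sum of these four minors is
    a polynomial that detects the sign of [\det A] without a choice of A and B. *)
Definition tens_sign (V : M4) : R :=
  V k0 k0 * V k2 k2 - V k0 k2 * V k2 k0 - (V k0 k1 * V k2 k3 - V k0 k3 * V k2 k1)
  - (V k1 k0 * V k3 k2 - V k1 k2 * V k3 k0) + V k1 k1 * V k3 k3 - V k1 k3 * V k3 k1.

Lemma tens_signE A B : tens_sign (tens A B) =
  \det A * (B 0 0 ^+ 2 + B 0 1 ^+ 2 + B 1 0 ^+ 2 + B 1 1 ^+ 2).
Proof. rewrite /tens_sign !mxE /= det2; ring. Qed.

Lemma tens_inj A B C D : \det A = 1 -> \det B = 1 -> \det C = 1 -> \det D = 1 ->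
  tens A B = tens C D -> (A = C /\ B = D) \/ (A = - C /\ B = - D).
Proof.
move=> dA dB dC dD e.
have AB i j k l : A i j * B k l = C i j * D k l.
  have := congr1 (fun M : M4 => M (pair4 i k) (pair4 j l)) e; rewrite /= !tens_pair.
  by apply/mulfI; rewrite mulf_neq0 // sgn4_neq0.
(* If A = lam C, this mixed determinant is lam times [\det C], that is, lam. *)
pose lam := C 0 0 * A 1 1 - C 0 1 * A 1 0.
have h (i j k l : 'I_2) : A i j * C k l = C i j * A k l.
  suff : A i j * C k l * \det D = C i j * A k l * \det D by rewrite dD !mulr1.
  rewrite det2.
  have -> : A i j * C k l * (D 0 0 * D 1 1 - D 0 1 * D 1 0) =
    A i j * ((C k l * D 0 0) * D 1 1 - (C k l * D 0 1) * D 1 0) by ring.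
  have -> : C i j * A k l * (D 0 0 * D 1 1 - D 0 1 * D 1 0) =
    A k l * ((C i j * D 0 0) * D 1 1 - (C i j * D 0 1) * D 1 0) by ring.
  rewrite -!AB; ring.
have AC i j : A i j = lam * C i j.
  rewrite -[LHS]mulr1 -dC det2 /lam.
  have -> : A i j * (C 0 0 * C 1 1 - C 0 1 * C 1 0) =
    (A i j * C 0 0) * C 1 1 - (A i j * C 1 0) * C 0 1 by ring.
  have -> : (C 0 0 * A 1 1 - C 0 1 * A 1 0) * C i j =
    (C i j * A 1 1) * C 0 0 - (C i j * A 1 0) * C 0 1 by ring.
  rewrite -!h; ring.
have lam2 : lam ^+ 2 = 1.
  have := dA; rewrite det2 !AC -[RHS]mulr1 -dC det2 => dd.
  have {}dd : lam ^+ 2 * (C 0 0 * C 1 1 - C 0 1 * C 1 0) = 1.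
    by rewrite -[RHS]mul1r -dC det2 -[RHS]dd; ring.
  by move: dd; rewrite -det2 dC mulr1.
have BD i j : B i j = lam * D i j.
  suff : lam * \det C * B i j = \det C * D i j.
    rewrite dC mulr1 mul1r => <-; by rewrite mulrA -expr2 lam2 mul1r.
  rewrite det2.
  have -> : lam * (C 0 0 * C 1 1 - C 0 1 * C 1 0) * B i j =
    (lam * C 0 0 * B i j) * C 1 1 - (lam * C 0 1 * B i j) * C 1 0 by ring.
  rewrite -!AC !AB; ring.
have /orP[/eqP l1|/eqP l1] : (lam == 1) || (lam == -1) by rewrite -eqf_sqr lam2 expr1n.
  by left; split; apply/matrixP => i j; rewrite ?AC ?BD l1 mul1r.
by right; split; apply/matrixP => i j; rewrite mxE ?AC ?BD l1 mulN1r.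
Qed.

End TensorSquare.

(** * The identity component *)

Section IdentityComponent.
Variable R : realType.

Lemma line_component n (T U N : 'M[R]_n) :
  SO0 T U -> (forall t : R, SO T (U + t *: N)) -> forall t : R, SO0 T (U + t *: N).
Proof.
move=> SU line t; apply: connected_component_trans SU _.
pose f (s : R) := U + s *: N.
apply: (@connected_component_max _ _ (f @` setT)).
- by exists 0 => //; rewrite /f scale0r addr0.
- by move=> _ [s _ <-]; apply: line.
- apply: connected_continuous_connected.
    by apply/connected_intervalP.
  apply: continuous_subspaceT => s.
  apply: cvgD; first exact: cvg_cst.
  exact: scalel_continuous.
- by exists t.
Qed.

Lemma sign_component n (T : 'M[R]_n) (f : 'M[R]_n -> R) :
  continuous f -> (forall U, SO T U -> f U != 0) -> 0 < f 1%:M ->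
  forall U, SO0 T U -> 0 < f U.
Proof.
move=> cf nz f1 U [B [B1 BS cB] BU].
have /connected_intervalP itv : connected (f @` B).
  by apply: connected_continuous_connected => //; apply: continuous_subspaceT.
rewrite ltNge; apply/negP => fU.
have [V BV /eqP] : (f @` B) 0.
  by apply: (itv (f U) (f 1%:M)); [exists U | exists 1%:M | rewrite fU ltW].
by apply/negP/nz/BS.
Qed.

End IdentityComponent.

(** * The form [S_1] in lattice coordinates and its identity component *)

Section LatticeCoordinates.
Variables (R : realType) (u v u' v' : R).
Hypothesis disc : u * v' - v * u' != 0.
Local Notation M4 := 'M[R]_(1 + (2 + 1)).
Implicit Types A B : 'M[R]_2.

(* Columns: the images of the basis (1, u, v, 1) of Q + K + Q in the coordinates
   (x0, w, w', x3). *)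
Definition chg : M4 :=
  \matrix_(i, j) match (i : nat), (j : nat) with
    | 0%N, 0%N | 3%N, 3%N => 1
    | 1%N, 1%N => u | 1%N, 2%N => v | 2%N, 1%N => u' | 2%N, 2%N => v'
    | _, _ => 0 end.

Lemma chgE i j : chg i j = match (i : nat), (j : nat) with
    | 0%N, 0%N | 3%N, 3%N => 1
    | 1%N, 1%N => u | 1%N, 2%N => v | 2%N, 1%N => u' | 2%N, 2%N => v'
    | _, _ => 0 end.
Proof. by rewrite mxE. Qed.

Definition chgV : M4 :=
  \matrix_(i, j) match (i : nat), (j : nat) with
    | 0%N, 0%N | 3%N, 3%N => 1
    | 1%N, 1%N => v' / (u * v' - v * u') | 1%N, 2%N => - v / (u * v' - v * u')
    | 2%N, 1%N => - u' / (u * v' - v * u') | 2%N, 2%N => u / (u * v' - v * u')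
    | _, _ => 0 end.

Lemma chgK : chg *m chgV = 1%:M.
Proof.
by apply/matrixP; elim/ind4; elim/ind4; rewrite mxE sum4 !mxE /=; try ring; field.
Qed.

Lemma chgVK : chgV *m chg = 1%:M.
Proof. exact: mulmx1C chgK. Qed.

Definition lattice_form : M4 := chg^T *m antidiag R *m chg.

Lemma lattice_formE i j : lattice_form i j = match (i : nat), (j : nat) with
    | 0%N, 3%N | 3%N, 0%N => 1
    | 1%N, 1%N => 2 * (u * u') | 1%N, 2%N | 2%N, 1%N => u * v' + u' * v
    | 2%N, 2%N => 2 * (v * v') | _, _ => 0 end.
Proof.
by move: i j; elim/ind4; elim/ind4; rewrite mxE sum4 !mxE !sum4 !mxE /=; ring.
Qed.

(** [tens A B] in the basis (1, u, v, 1). For the pair (M, M') this is tilde M, but it makes sense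
    for independent real matrices, as the description of the whole identity component requires. *)
Definition tau_mx A B : M4 := chgV *m tens A B *m chg.

Lemma chg_tau A B : chg *m tau_mx A B = tens A B *m chg.
Proof. by rewrite /tau_mx !mulmxA chgK mul1mx. Qed.

Lemma tauK A B : chg *m tau_mx A B *m chgV = tens A B.
Proof. by rewrite chg_tau -mulmxA chgK mulmx1. Qed.

Lemma tauM A B C D : tau_mx A B *m tau_mx C D = tau_mx (A *m C) (B *m D).
Proof.
by rewrite /tau_mx -tensM !mulmxA -(mulmxA _ chg) chgK mulmx1.
Qed.

Lemma tau1 : tau_mx 1%:M 1%:M = 1%:M.
Proof. by rewrite /tau_mx tens1 mulmx1 chgVK. Qed.

Lemma tauNl A B : tau_mx (- A) B = - tau_mx A B.
Proof. by rewrite /tau_mx tensNl mulmxN mulNmx. Qed.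

Lemma tauNr A B : tau_mx A (- B) = - tau_mx A B.
Proof. by rewrite /tau_mx tensNr mulmxN mulNmx. Qed.

Lemma tau_inj A B C D : \det A = 1 -> \det B = 1 -> \det C = 1 -> \det D = 1 ->
  tau_mx A B = tau_mx C D -> (A = C /\ B = D) \/ (A = - C /\ B = - D).
Proof.
by move=> dA dB dC dD e; apply: tens_inj => //; rewrite -!tauK e.
Qed.

Lemma SO_form U : SO lattice_form U -> orth (chg *m U *m chgV) /\ \det (chg *m U *m chgV) = 1.
Proof.
move=> [dU oU]; split.
  rewrite /orth; have -> : antidiag R = chgV^T *m lattice_form *m chgV.
    by rewrite /lattice_form !mulmxA -trmx_mul chgK trmx1 mul1mx -mulmxA chgK mulmx1.
  rewrite -[in RHS]oU !trmx_mul.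
  rewrite -!mulmxA; congr (_ *m _); congr (_ *m _).
  rewrite !mulmxA -trmx_mul chgVK trmx1 mul1mx; congr (_ *m _); congr (_ *m _).
  by rewrite -[LHS]mulmxA chgVK mulmx1.
by rewrite !det_mulmx dU mulr1 -det_mulmx chgK det1.
Qed.

Lemma tau_SO A B : \det A = 1 -> \det B = 1 -> SO lattice_form (tau_mx A B).
Proof.
move=> dA dB; split.
  by rewrite /tau_mx !det_mulmx det_tens // mulr1 -det_mulmx chgVK det1.
have h : chg *m tau_mx A B = tens A B *m chg := chg_tau A B.
rewrite /lattice_form -!mulmxA h !mulmxA -trmx_mul h trmx_mul.
rewrite -(mulmxA _ (tens A B)^T) -(mulmxA _ _ (tens A B)).
by rewrite tens_antidiag dA dB mulr1 scale1r.
Qed.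

Lemma det_elem A (i j : 'I_2) t : i != j -> \det A = 1 ->
  \det (A + t *: (A *m delta_mx i j)) = 1.
Proof.
move=> ij dA; rewrite scalemxAr -[X in X + _]mulmx1 -mulmxDr det_mulmx dA mul1r.
by move: i j ij; elim/ind2; elim/ind2 => // _; rewrite det2 !mxE /=; ring.
Qed.

Lemma tau_SO0 A B : \det A = 1 -> \det B = 1 -> SO0 lattice_form (tau_mx A B).
Proof.
move=> dA.
have Dl t C C' D : tau_mx (C + t *: C') D = tau_mx C D + t *: tau_mx C' D.
  by rewrite /tau_mx tensZl mulmxDr mulmxDl -scalemxAr -scalemxAl.
have Dr t C D D' : tau_mx C (D + t *: D') = tau_mx C D + t *: tau_mx C D'.
  by rewrite /tau_mx tensZr mulmxDr mulmxDl -scalemxAr -scalemxAl.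
have hA : SO0 lattice_form (tau_mx A 1%:M).
  move: A dA; apply: SL2_ind => [|C t dC|C t dC].
  - rewrite tau1; apply: connected_component_refl; rewrite -tau1.
    by apply: tau_SO; rewrite det1.
  - move=> h; rewrite Dl; apply: line_component => // s; rewrite -Dl.
    by apply: tau_SO; rewrite ?det_elem ?det1.
  - move=> h; rewrite Dl; apply: line_component => // s; rewrite -Dl.
    by apply: tau_SO; rewrite ?det_elem ?det1.
move: B; apply: SL2_ind => // C t dC h.
  by rewrite Dr; apply: line_component => // s; rewrite -Dr; apply: tau_SO; rewrite ?det_elem.
by rewrite Dr; apply: line_component => // s; rewrite -Dr; apply: tau_SO; rewrite ?det_elem.
Qed.

Lemma continuous_tens_sign (P Q : M4) : continuous (fun U : M4 => tens_sign (P *m U *m Q)).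
Proof.
have cD (f g : M4 -> R) : continuous f -> continuous g -> continuous (fun U => f U + g U).
  by move=> cf cg U; apply: (cvgD (cf U) (cg U)).
have cB (f g : M4 -> R) : continuous f -> continuous g -> continuous (fun U => f U - g U).
  by move=> cf cg U; apply: (cvgB (cf U) (cg U)).
have cM (f g : M4 -> R) : continuous f -> continuous g -> continuous (fun U => f U * g U).
  by move=> cf cg U; apply: (cvgM (cf U) (cg U)).
have cC (a : R) : continuous (fun _ : M4 => a) := @cst_continuous _ _ a.
have cU k l : continuous (fun U : M4 => U k l) by apply: coord_continuous.
have cS (f : 'I_(1 + (2 + 1)) -> M4 -> R) : (forall k, continuous (f k)) ->
    continuous (fun U => f k0 U + f k1 U + f k2 U + f k3 U).
  by move=> cf; apply: (cD _ _ (cD _ _ (cD _ _ (cf k0) (cf k1)) (cf k2)) (cf k3)).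
have cPU i l : continuous (fun U : M4 => (P *m U) i l).
  rewrite (_ : (fun _ => _) = fun U : M4 =>
    P i k0 * U k0 l + P i k1 * U k1 l + P i k2 * U k2 l + P i k3 * U k3 l).
    exact: (cS (fun k U => P i k * U k l) (fun k => cM _ _ (cC (P i k)) (cU k l))).
  by apply/funext => U; rewrite mxE sum4.
have cE i j : continuous (fun U : M4 => (P *m U *m Q) i j).
  rewrite (_ : (fun _ => _) = fun U : M4 =>
    (P *m U) i k0 * Q k0 j + (P *m U) i k1 * Q k1 j + (P *m U) i k2 * Q k2 j
    + (P *m U) i k3 * Q k3 j).
    exact: (cS (fun k U => (P *m U) i k * Q k j) (fun k => cM _ _ (cPU i k) (cC (Q k j)))).
  by apply/funext => U; rewrite mxE sum4.
have c2 i j k l := cM _ _ (cE i j) (cE k l).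
exact: (cB _ _ (cD _ _ (cB _ _ (cB _ _ (cB _ _ (c2 k0 k0 k2 k2) (c2 k0 k2 k2 k0))
    (cB _ _ (c2 k0 k1 k2 k3) (c2 k0 k3 k2 k1))) (cB _ _ (c2 k1 k0 k3 k2) (c2 k1 k2 k3 k0)))
    (c2 k1 k1 k3 k3)) (c2 k1 k3 k3 k1)).
Qed.

Lemma SO0_tau U : SO0 lattice_form U -> exists A B, [/\ \det A = 1, \det B = 1 & U = tau_mx A B].
Proof.
move=> hU; have SU := connected_component_sub hU.
pose f (V : M4) := tens_sign (chg *m V *m chgV).
have fE V : SO lattice_form V -> exists A B, [/\ \det A * \det B = 1, chg *m V *m chgV = tens A B
    & exists2 s, 0 < s & f V = \det A * s].
  move=> /SO_form[oV dV]; have [A [B [dAB VE]]] := orth_is_tens oV dV.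
  exists A, B; split => //; rewrite /f VE tens_signE; eexists; last by [].
  rewrite lt_neqAle !addr_ge0 ?sqr_ge0 // andbT eq_sym.
  rewrite !paddr_eq0 ?addr_ge0 ?sqr_ge0 // !sqrf_eq0 -!andbA.
  apply/negP => /and4P[/eqP b0 /eqP b1 /eqP b2 /eqP b3].
  by move: dAB; rewrite (det2 B) b0 b1 !mul0r subr0 mulr0 => /eqP; rewrite eq_sym oner_eq0.
have f0 V : SO lattice_form V -> f V != 0.
  move=> /fE[A [B [dAB _ [s s0 ->]]]]; rewrite mulf_neq0 ?(gt_eqF s0) //.
  by apply/eqP => dA; move: dAB; rewrite dA mul0r => /eqP; rewrite eq_sym oner_eq0.
have f1 : 0 < f 1%:M by rewrite /f mulmx1 chgK -tens1 tens_signE det1 !mxE /=; lra.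
have fU := sign_component (@continuous_tens_sign chg chgV) f0 f1 hU.
have [A [B [dAB UE [s s0 sE]]]] := fE U SU.
have dA : 0 < \det A by move: fU; rewrite -/(f U) sE pmulr_lgt0.
have dB : 0 < \det B by rewrite -(pmulr_rgt0 _ dA) dAB.
(* [r *: A] has determinant [\det B * \det A], which is 1, and the scalars cancel in the tensor
   product. *)
pose r := Num.sqrt (\det B); have r0 : r != 0 by rewrite gt_eqF // sqrtr_gt0.
have r2 : r ^+ 2 = \det B by rewrite sqr_sqrtr // ltW.
exists (r *: A), (r^-1 *: B); rewrite !detZ r2 exprVn r2 mulrC dAB mulVf ?gt_eqF //.
split => //; have -> : U = chgV *m (chg *m U *m chgV) *m chg.
  by rewrite !mulmxA chgVK mul1mx -mulmxA chgVK mulmx1.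
rewrite UE /tau_mx; congr (_ *m _ *m _); apply/matrixP => i j; rewrite !mxE.
by field.
Qed.

End LatticeCoordinates.

(** * Groups modulo sign *)

Section SignQuotient.
Variable R : realType.

Lemma pm_eq n (A B : 'M[R]_n) : pm A = pm B -> B = A \/ B = - A.
Proof.
move=> e; have : pm B B by left.
by rewrite -[pm B B](congr1 (fun S : set 'M[R]_n => S B) e) => -[]; [left | right].
Qed.

Lemma pmN n (A : 'M[R]_n) : pm (- A) = pm A.
Proof.
by apply/seteqP; split=> M [->|->]; rewrite ?opprK; [right | left | right; rewrite opprK | left].
Qed.

Lemma pm_mulE n (A B : 'M[R]_n) : pm_mul (pm A) (pm B) = pm (A *m B).
Proof.
apply/seteqP; split=> [_ [M MA [N NB <-]]|M].
  by case: MA => ->; case: NB => ->; rewrite ?mulmxN ?mulNmx ?opprK;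
    [left | right | right | left].
case=> ->; first by exists A; [left | exists B; [left|]].
by exists A; [left | exists (- B); [right | rewrite mulmxN]].
Qed.

Lemma is_group_mx n (G : set 'M[R]_n) :
  G 1%:M -> (forall A B, G A -> G B -> G (A *m B)) ->
  (forall A, G A -> exists2 B, G B & A *m B = 1%:M) -> is_group mulmx 1%:M G.
Proof.
move=> G1 GM GV; split => //.
- by move=> *; apply: mulmxA.
- by move=> *; rewrite mul1mx mulmx1.
- by move=> A /GV[B GB AB]; exists B; split => //; apply: mulmx1C.
Qed.

Lemma is_group_mod_pm n (G : set 'M[R]_n) : is_group mulmx 1%:M G ->
  is_group pm_mul (pm 1%:M) (mod_pm G).
Proof.
move=> [G1 GM _ _ GV]; split.
- by exists 1%:M.
- by move=> _ _ [A GA <-] [B GB <-]; rewrite pm_mulE; exists (A *m B) => //; apply: GM.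
- by move=> _ _ _ [A _ <-] [B _ <-] [C _ <-]; rewrite !pm_mulE mulmxA.
- by move=> _ [A _ <-]; rewrite !pm_mulE mul1mx mulmx1.
- move=> _ [A GA <-]; have [B [GB AB BA]] := GV _ GA.
  by exists (pm B); rewrite !pm_mulE AB BA; split => //; exists B.
Qed.

(** Transports the group axioms from [GammaK] modulo sign to [disc_kernel], instead of checking the
    defining congruence on products and inverses. *)
Lemma is_group_image (T U : Type) (opT : T -> T -> T) eT (G : set T)
    (opU : U -> U -> U) (H : set U) (f : T -> U) :
  is_group opT eT G -> (forall x y, G x -> G y -> f (opT x y) = opU (f x) (f y)) ->
  (forall x, G x -> H (f x)) -> (forall y, H y -> exists2 x, G x & f x = y) ->
  is_group opU (f eT) H.
Proof.
move=> [G1 GM GA Ge GV] fM fH fS; split.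
- exact: fH.
- by move=> _ _ /fS[x Gx <-] /fS[y Gy <-]; rewrite -fM //; apply/fH/GM.
- move=> _ _ _ /fS[x Gx <-] /fS[y Gy <-] /fS[z Gz <-].
  by rewrite -!fM ?GA //; apply: GM.
- by move=> _ /fS[x Gx <-]; rewrite -!fM //; have [-> ->] := Ge x Gx.
- move=> _ /fS[x Gx <-]; have [y [Gy xy yx]] := GV x Gx.
  by exists (f y); rewrite -!fM // xy yx; split => //; apply: fH.
Qed.

(* An isomorphism G / {1, -1} -> H / {1, -1} from a correspondence that is a
   function up to sign. *)
Lemma pm_iso n p (G : set 'M[R]_n) (H : set 'M[R]_p) (rl : 'M[R]_n -> 'M[R]_p -> Prop) :
  is_group_with_pm G -> is_group_with_pm H ->
  (forall A, G A -> exists2 U, rl A U & H U) ->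
  (forall A B U V, G A -> G B -> rl A U -> rl B V -> pm A = pm B -> pm U = pm V) ->
  (forall A B U V, G A -> G B -> rl A U -> rl B V -> pm U = pm V -> pm A = pm B) ->
  (forall A B U V, G A -> G B -> rl A U -> rl B V -> rl (A *m B) (U *m V)) ->
  (forall U, H U -> exists A V, [/\ G A, rl A V & pm V = pm U]) ->
  exists phi : set 'M[R]_n -> set 'M[R]_p,
    (forall A, G A -> (exists U, rl A U) /\ forall U, rl A U -> phi (pm A) = pm U) /\
    group_iso pm_mul (pm 1%:M) (mod_pm G) pm_mul (pm 1%:M) (mod_pm H) phi.
Proof.
move=> [gG _] [gH _] ex fn inj mul surj.
(* The union over all representatives and all related [U]; by [fn] these give a single coset, so
   nothing is chosen. *)
pose phi (X : set 'M[R]_n) : set 'M[R]_p :=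
  [set W | exists A U, [/\ G A, X = pm A, rl A U & pm U W]].
have phiE A U : G A -> rl A U -> phi (pm A) = pm U.
  move=> GA AU; apply/seteqP; split=> W; last by move=> hW; exists A, U.
  move=> [B [V [GB e BV hW]]]; by rewrite (fn A B U V GA GB AU BV e).
exists phi; split.
  move=> A GA; split; first by have [U AU _] := ex A GA; exists U.
  by move=> U; apply: phiE.
split; [exact: is_group_mod_pm | exact: is_group_mod_pm | split |].
- move=> _ [A GA <-]; have [U AU HU] := ex A GA.
  by rewrite (phiE A U) //; exists U.
- move=> X Y /set_mem[A GA <-] /set_mem[B GB <-].
  have [U AU _] := ex A GA; have [V BV _] := ex B GB.
  rewrite (phiE A U GA AU) (phiE B V GB BV); exact: inj.
- move=> _ [U HU <-]; have [A [V [GA AV e]]] := surj U HU.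
  by exists (pm A); [exists A | rewrite (phiE A V) // e].
- move=> _ _ [A GA <-] [B GB <-]; have [U AU _] := ex A GA; have [V BV _] := ex B GB.
  rewrite pm_mulE (phiE A U GA AU) (phiE B V GB BV) pm_mulE.
  apply: phiE; [by case: gG => _ GM _ _ _; apply: GM | exact: mul].
Qed.

End SignQuotient.

(** * Arithmetic of the pairs (M, M') *)

Section Pairs.
Variables (R : realType) (m : nat) (u v : R).
Hypotheses (m_gt1 : (1 < m)%N) (m_sqfree : squarefree m).
Hypothesis uv_basis : OK_basis m u v.
Implicit Types x y z : R.
Implicit Types A B C D L : 'M[R]_2.

Local Notation u' := (conjK m u).
Local Notation v' := (conjK m v).
Local Notation om := (omegaK R m).
Local Notation om' := (omegaK_conj R m).
Local Notation dlt := (om - om').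
Local Notation conj_in_K := (conj_in_K m).
Local Notation conj_in_O := (conj_in_O m).
Local Notation dsc := (u * v' - v * u').
Local Notation M4 := 'M[R]_(1 + (2 + 1)).

Let OM x x' y y' := @conj_in_OM R m m_gt1 m_sqfree x x' y y'.
Let Osym x y := @conj_in_O_sym R m m_gt1 m_sqfree x y.
Let Otrace x y := @conj_in_O_trace R m m_gt1 m_sqfree x y.
Let Onorm x y := @conj_in_O_norm R m m_gt1 m_sqfree x y.
Let Kfun x y z := @conj_in_K_fun R m m_gt1 m_sqfree x y z.
Let KV x y := @conj_in_KV R m m_gt1 m_sqfree x y.
Let OKc x := @OK_conj R m m_gt1 m_sqfree x.

Lemma conj_u : conj_in_O u u'.
Proof. by case: uv_basis => h _ _; apply: OKc. Qed.

Lemma conj_v : conj_in_O v v'.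
Proof. by case: uv_basis => _ h _; apply: OKc. Qed.

Lemma basis_coords x x' : conj_in_O x x' ->
  exists a b : R, [/\ a \is a Num.int, b \is a Num.int, x = a * u + b * v & x' = a * u' + b * v'].
Proof.
move=> h; have [_ _ /(_ x (conj_OK h))[[a b] [/= xE _]]] := uv_basis.
exists a%:~R, b%:~R; rewrite !intr_int; split => //.
apply: (Kfun (conj_in_O_K h)); rewrite xE; apply: conj_in_O_K.
by apply: conj_in_OD; apply: (OM);
  try (apply: conj_u || apply: conj_v); apply: conj_in_O_int; rewrite intr_int.
Qed.

Lemma basis_coordsK x x' : conj_in_K x x' ->
  exists a b : R, [/\ is_rat a, is_rat b, x = a * u + b * v & x' = a * u' + b * v'].
Proof.
move=> /(clear_denominator m_gt1 m_sqfree)[n n0 /(_ 1%N)]; rewrite muln1.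
move=> /basis_coords[a [b [ai bi xE xE']]].
have nR : n%:R != 0 :> R by rewrite pnatr_eq0 -lt0n.
have rn : is_rat (n%:R^-1 : R) by apply/is_ratV/is_rat_int; rewrite natr_int.
exists (n%:R^-1 * a), (n%:R^-1 * b).
split; [by apply: is_ratM => //; apply: is_rat_int
  | by apply: is_ratM => //; apply: is_rat_int | |].
  by apply: (mulfI nR); rewrite xE; field.
by apply: (mulfI nR); rewrite xE'; field.
Qed.

(** [k] is the determinant of the coordinates of [om] and 1 in the basis. The relation makes [dsc]
    nonzero and lets a factor [dlt] absorb a division by [dsc]. *)
Lemma disc_dlt : exists2 k : R, k \is a Num.int & dlt = k * dsc.
Proof.
have [a [b [ai bi e1 e2]]] := basis_coords (conj_in_O_int m (rpred1 _ : 1 \is a Num.int)).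
have [c [d [ci di f1 f2]]] := basis_coords (conj_in_O_omega R m).
exists (c * b - a * d); first by rewrite rpredB ?rpredM.
have -> : dlt = (c * u + d * v) * (a * u' + b * v') - (c * u' + d * v') * (a * u + b * v).
  by rewrite -e1 -e2 -f1 -f2 !mulr1.
by ring.
Qed.

Lemma disc_neq0 : dsc != 0.
Proof.
have [k _ kE] := disc_dlt; apply/eqP => d0.
by have := omega_sub_gt0 R m_gt1; rewrite kE d0 mulr0 ltxx.
Qed.

Local Notation tau := (tau_mx u v u' v').

Lemma gram_form : T_N (gram m u v) 1 = lattice_form u v u' v'.
Proof.
apply/matrixP; elim/ind4; elim/ind4; rewrite lattice_formE /T_N border_mxE !mxE /= ?mulr1n //.
Qed.

Lemma phiBRE x x' : conj_in_K x x' ->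
  x = phiBR u v x 0 0 * u + phiBR u v x 1 0 * v /\
  x' = phiBR u v x 0 0 * u' + phiBR u v x 1 0 * v'.
Proof.
move=> h; have [a [b [[p pE] [q qE] xE xE']]] := basis_coordsK h.
rewrite /phiBR /phiB.
(* The default value of [xget] is excluded, since rational coordinates exist. *)
case: xgetP => [c _ /= cE|/(_ (\col_i if i == 0 then p else q))]; last first.
  by case; rewrite /= !mxE /= -pE -qE.
rewrite !mxE; split => //; apply: (Kfun h); rewrite {1}cE.
by apply: conj_in_KD; apply: conj_in_KM;
  try (apply: conj_in_O_K; by (apply: conj_u || apply: conj_v));
  apply: conj_in_K_rat; eexists.
Qed.

(* B is the conjugate of A up to scalars: each A i j * B k l satisfies C together with
   its conjugate A k l * B i j. *)
Definition conj_prod (C : R -> R -> Prop) A B :=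
  forall i j k l, C (A i j * B k l) (A k l * B i j).

(** Multiplication by [chg] turns each coordinate vector inside [tilde_mx] into an element together
    with its conjugate, after which both sides agree entry by entry. *)
Lemma tilde_tau A B : conj_prod conj_in_K A B -> tilde_mx m u v A B = tau A B.
Proof.
move=> h; have : chg u v u' v' *m tilde_mx m u v A B = tens A B *m chg u v u' v'.
{ have [a1 a2] : _ /\ _ := phiBRE (conj_in_KN (h 0 1 0 0)).
  have [b1 b2] := phiBRE (conj_in_KN (h 0 0 1 0)).
  have [c1 c2] := phiBRE (h 0 1 1 1).
  have [d1 d2] := phiBRE (h 1 1 1 0).
  have cu := conj_in_O_K conj_u; have cv := conj_in_O_K conj_v.
  have [e1 e2] := phiBRE (conj_in_KD (conj_in_KM (h 0 0 1 1) cu)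
                    (conj_in_KM (h 0 1 1 0) (conj_in_K_sym cu))).
  have [f1 f2] := phiBRE (conj_in_KD (conj_in_KM (h 0 0 1 1) cv)
                    (conj_in_KM (h 0 1 1 0) (conj_in_K_sym cv))).
  (* Proves an equation as a linear combination of two known ones. The coefficients below are
     conjugates of basis elements where a row a^T S occurs, because its entries are traces of an
     element times u' or v'. *)
  have lc (x y s t L r p q : R) : x = y -> s = t -> L - r = p * (y - x) + q * (t - s) -> L = r.
    by move=> -> ->; rewrite !subrr !mulr0 addr0 => /subr0_eq.
  rewrite /tilde_mx /endo_mx.
  move: a1 a2 b1 b2 c1 c2 d1 d2 e1 e2 f1 f2.
  rewrite (mulrC (A 0 1) (B 0 0)) (mulrC (A 1 1) (B 1 0)).
  move: (phiBR u v _) => a; move: (phiBR u v _) => b; move: (phiBR u v _) => c.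
  move: (phiBR u v _) => d; move: (phiBR u v _) => e; move: (phiBR u v _) => f.
  move=> a1 a2 b1 b2 c1 c2 d1 d2 e1 e2 f1 f2.
  apply/matrixP; elim/ind4; elim/ind4;
    rewrite mxE [RHS]mxE !sum4 !chgE !tensE !border_mxE ?row_mx2E /=.
  all: rewrite ?mxE ?sum2 ?mxE /= ?mulr1n.
  all: first [ring | apply: (lc _ _ _ _ _ _ 1 0 b1 b1); ring
    | apply: (lc _ _ _ _ _ _ 1 0 b2 b2); ring
    | apply: (lc _ _ _ _ _ _ 1 0 c1 c1); ring
    | apply: (lc _ _ _ _ _ _ 1 0 c2 c2); ring
    | apply: (lc _ _ _ _ _ _ 1 0 e1 e1); ring
    | apply: (lc _ _ _ _ _ _ 1 0 e2 e2); ring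
    | apply: (lc _ _ _ _ _ _ 1 0 f1 f1); ring
    | apply: (lc _ _ _ _ _ _ 1 0 f2 f2); ring
    | apply: (lc _ _ _ _ _ _ u' u a1 a2); ring
    | apply: (lc _ _ _ _ _ _ v' v a1 a2); ring
    | apply: (lc _ _ _ _ _ _ u' u d1 d2); ring
    | apply: (lc _ _ _ _ _ _ v' v d1 d2); ring].
}
have K := chgVK disc_neq0.
move=> e; rewrite /tau_mx -mulmxA -e mulmxA K mul1mx //.

Qed.
(* The pairs (M, M') of the informal statement: by the sign ambiguity of M' this
   is a relation, not a function. *)
Definition sig_pair A B : Prop := exists (l : nat) L,
  [/\ (0 < l)%N, OK_mx m L, A = scale_sqrt l%:R L
    & B = scale_sqrt l%:R (map_mx (conjK m) L)].

Lemma scale_sqrtE (d : R) L i j : scale_sqrt d L i j = (Num.sqrt d)^-1 * L i j.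
Proof. by rewrite mxE. Qed.

Lemma sqrtV_sqr (d : R) : 0 <= d -> (Num.sqrt d)^-1 * (Num.sqrt d)^-1 = d^-1.
Proof. by move=> d0; rewrite -invfM -expr2 sqr_sqrtr. Qed.

Lemma det_scale_sqrt (d : R) L : 0 <= d -> \det (scale_sqrt d L) = d^-1 * \det L.
Proof. by move=> d0; rewrite detZ expr2 sqrtV_sqr. Qed.

Lemma conj_in_K_nat (n : nat) : conj_in_K (n%:R : R) n%:R.
Proof. by apply/conj_in_K_rat/is_rat_int/natr_int. Qed.

Lemma conj_in_K_natV (n : nat) : conj_in_K (n%:R^-1 : R) n%:R^-1.
Proof. by apply: KV; apply: conj_in_K_nat. Qed.

Lemma conj_det (C : R -> R -> Prop) L L' :
  (forall x x' y y', C x x' -> C y y' -> C (x - y) (x' - y')) ->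
  (forall x x' y y', C x x' -> C y y' -> C (x * y) (x' * y')) ->
  (forall i j, C (L i j) (L' i j)) -> C (\det L) (\det L').
Proof. by move=> CB CM h; rewrite !det2; apply: CB; apply: CM. Qed.

Lemma conj_detO L L' : (forall i j, conj_in_O (L i j) (L' i j)) -> conj_in_O (\det L) (\det L').
Proof. by apply: conj_det => *; [apply: conj_in_OB | apply: OM]. Qed.

Lemma conj_detK L L' : (forall i j, conj_in_K (L i j) (L' i j)) -> conj_in_K (\det L) (\det L').
Proof. by apply: conj_det => *; [apply: conj_in_KB | apply: conj_in_KM]. Qed.

Lemma sig_pair_exists A : SigmaK R m A -> exists B, sig_pair A B.
Proof. by move=> [[l [L [l0 LO ->]]] _]; eexists; exists l, L; split. Qed.

(** sqrt l occurs twice in a product of two entries and leaves the rational factor 1 / l; on such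
    products conjugation is that of K, without sign ambiguity. *)
Lemma sig_pair_prod A B : sig_pair A B -> conj_prod conj_in_K A B.
Proof.
move=> [l [L [l0 LO -> ->]]] i j p q; rewrite !scale_sqrtE !mxE.
set c := _^-1; have cE : c * c = l%:R^-1 by rewrite sqrtV_sqr ?ler0n.
have sw x y : c * x * (c * y) = l%:R^-1 * (x * y) by rewrite -cE; ring.
rewrite !sw [L p q * _]mulrC; apply: conj_in_KM; first exact: conj_in_K_natV.
apply: conj_in_KM; first by apply/conj_in_O_K/OKc.
by apply/conj_in_O_K/Osym/OKc.
Qed.

Lemma sig_pair_prod2 A B i j p q : sig_pair A B ->
  conj_in_K (A i j * A p q) (B i j * B p q).
Proof.
move=> [l [L [l0 LO -> ->]]]; rewrite !scale_sqrtE !mxE.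
set c := _^-1; have cE : c * c = l%:R^-1 by rewrite sqrtV_sqr ?ler0n.
have sw x y : c * x * (c * y) = l%:R^-1 * (x * y) by rewrite -cE; ring.
rewrite !sw; apply: conj_in_KM; first exact: conj_in_K_natV.
by apply: conj_in_KM; apply/conj_in_O_K/OKc.
Qed.

Lemma sig_pair_det A B : sig_pair A B -> \det A = 1 -> \det B = 1.
Proof.
move=> [l [L [l0 LO -> ->]]]; rewrite !det_scale_sqrt ?ler0n // => dL.
have lR : l%:R != 0 :> R by rewrite pnatr_eq0 -lt0n.
have {}dL : \det L = l%:R by apply: (mulfI (invr_neq0 lR)); rewrite dL mulVf.
have : conj_in_K (\det L) (\det (map_mx (conjK m) L)).
  by apply: conj_detK => i j; rewrite mxE; apply/conj_in_O_K/OKc.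
by rewrite dL => h; rewrite -(Kfun (conj_in_K_nat l) h) mulVf.
Qed.

Lemma conj_mx_entry L i j : OK_mx m L -> conj_in_O (L i j) (map_mx (conjK m) L i j).
Proof. by move=> LO; rewrite mxE; apply: OKc. Qed.

Lemma conj_mxM L L' : OK_mx m L -> OK_mx m L' ->
  OK_mx m (L *m L') /\
  map_mx (conjK m) (L *m L') = map_mx (conjK m) L *m map_mx (conjK m) L'.
Proof.
move=> LO LO'; have h i j : conj_in_O ((L *m L') i j)
    ((map_mx (conjK m) L *m map_mx (conjK m) L') i j).
  by rewrite !mulmx2; apply: conj_in_OD; apply: OM; apply: conj_mx_entry.
split; first by move=> i j; apply: conj_OK (h i j).
by apply/matrixP => i j; rewrite [LHS]mxE; apply: conj_in_O_conjK (h i j).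
Qed.

Lemma sig_pairM A B C D : sig_pair A B -> sig_pair C D -> sig_pair (A *m C) (B *m D).
Proof.
move=> [l [L [l0 LO -> ->]]] [p [P [p0 PO -> ->]]]; exists (l * p)%N, (L *m P).
have [LPO ->] := conj_mxM LO PO.
split; rewrite ?muln_gt0 ?l0 // /scale_sqrt natrM sqrtrM ?ler0n // invfM;
  by rewrite -scalemxAl -scalemxAr scalerA.
Qed.

Lemma conj_in_O_opp x x' : conj_in_O x x' -> conjK m (- x) = - x'.
Proof. by move=> /conj_in_ON h; apply: conj_in_O_conjK h. Qed.

Lemma sig_pairN A B : sig_pair A B -> sig_pair (- A) (- B).
Proof.
move=> [l [L [l0 LO -> ->]]]; exists l, (- L); rewrite /scale_sqrt -!scalerN; split => //.
  by move=> i j; rewrite mxE; apply: conj_OK (conj_in_ON (OKc (LO i j))).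
congr (_ *: _); apply/matrixP => i j; rewrite !mxE.
by rewrite (conj_in_O_opp (OKc (LO i j))).
Qed.

Definition adj2 A : 'M[R]_2 :=
  \matrix_(i, j) if i == j then (if i == 0 then A 1 1 else A 0 0) else - A i j.

Lemma mul_adj2 A : \det A = 1 -> A *m adj2 A = 1%:M.
Proof.
by rewrite det2 => h; apply/matrixP; elim/ind2; elim/ind2; rewrite mulmx2 !mxE /= -?h; ring.
Qed.

Lemma mul_adj2l A : \det A = 1 -> adj2 A *m A = 1%:M.
Proof. by move=> h; apply/mulmx1C/mul_adj2. Qed.

Lemma det_adj2 A : \det (adj2 A) = \det A.
Proof. by rewrite !det2 !mxE /=; ring. Qed.

Lemma sig_pair_adj A B : sig_pair A B -> sig_pair (adj2 A) (adj2 B).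
Proof.
move=> [l [L [l0 LO -> ->]]]; exists l, (adj2 L); split => //.
- by elim/ind2; elim/ind2; rewrite mxE //=; apply: conj_OK (conj_in_ON (OKc _)).
- by apply/matrixP; elim/ind2; elim/ind2; rewrite !mxE //=; ring.
- apply/matrixP; elim/ind2; elim/ind2; rewrite !mxE //= (conj_in_O_opp (OKc _)) //; ring.
Qed.

Lemma nonzero_entry A : \det A = 1 -> exists i j, A i j != 0.
Proof.
rewrite det2 => dA; have [a0|a0] := eqVneq (A 0 0) 0; last by exists 0, 0.
exists 0, 1; apply/eqP => b0; move: dA; rewrite a0 b0 !mul0r subr0 => /eqP.
by rewrite eq_sym oner_eq0.
Qed.

(** Two representations of [A] differ by the factor k = sqrt p / sqrt l. As a quotient of entries k
    lies in K, and its square is rational, so its conjugate is k or -k. *)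
Lemma sig_pair_uniq A B C : \det A = 1 -> sig_pair A B -> sig_pair A C -> C = B \/ C = - B.
Proof.
move=> /nonzero_entry[i [j Aij]] [l [L [l0 LO AE ->]]] [p [P [p0 PO AE' ->]]].
have sl : Num.sqrt l%:R != 0 :> R by rewrite gt_eqF // sqrtr_gt0 ltr0n.
have sp : Num.sqrt p%:R != 0 :> R by rewrite gt_eqF // sqrtr_gt0 ltr0n.
pose k : R := Num.sqrt p%:R / Num.sqrt l%:R.
have PE a b : P a b = k * L a b.
  have : scale_sqrt p%:R P a b = scale_sqrt l%:R L a b by rewrite -AE AE'.
  rewrite !scale_sqrtE /k => h; apply: (@mulfI _ (Num.sqrt p%:R)^-1); first by rewrite invr_eq0.
  by rewrite h; field; rewrite sl.
have Lij : L i j != 0 by apply: contraNneq Aij => h; rewrite AE scale_sqrtE h mulr0.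
have kK : conj_in_K k (conjK m (P i j) / conjK m (L i j)).
  have -> : k = P i j / L i j by rewrite PE mulfK.
  by apply: conj_in_KM; [|apply: KV]; apply/conj_in_O_K/OKc.
move: kK; set k' := _ / _ => kK.
have PE' a b : conjK m (P a b) = k' * conjK m (L a b).
  apply: (Kfun (conj_in_O_K (OKc (PO a b)))); rewrite PE.
  by apply: conj_in_KM => //; apply/conj_in_O_K/OKc.
have k2 : k' ^+ 2 = k ^+ 2.
  apply/esym/(Kfun (x := k ^+ 2)); last exact: (conj_in_KM kK kK).
  apply: conj_in_K_rat; rewrite /k expr_div_n !sqr_sqrtr ?ler0n //.
  by apply: is_ratM; [|apply: is_ratV]; apply/is_rat_int/natr_int.
have /orP[/eqP ke|/eqP ke] : (k' == k) || (k' == - k) by rewrite -eqf_sqr k2.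
  left; apply/matrixP => a b; rewrite !mxE PE' ke /k; field; by rewrite sl.
right; apply/matrixP => a b; rewrite !mxE PE' ke /k; field; by rewrite sl.
Qed.

Lemma is_tildeP A U : is_tilde m u v A U <-> exists2 B, sig_pair A B & U = tau A B.
Proof.
split.
  move=> [l [L [l0 LO AE ->]]]; have h : sig_pair A (scale_sqrt l%:R (map_mx (conjK m) L)).
    by exists l, L.
  by eexists; [exact: h | apply/tilde_tau/sig_pair_prod].
move=> [B h ->]; have [l [L [l0 LO AE BE]]] := h; exists l, L; split => //.
by rewrite -BE; apply/esym/tilde_tau/sig_pair_prod.
Qed.

Lemma common_denominator L L' : (forall i j, conj_in_K (L i j) (L' i j)) ->
  exists2 n : nat, (0 < n)%N &
    forall (k : nat) i j, conj_in_O ((n * k)%:R * L i j) ((n * k)%:R * L' i j).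
Proof.
move=> h; have cd i j := clear_denominator m_gt1 m_sqfree (h i j).
have [a a0 ha] := cd 0 0; have [b b0 hb] := cd 0 1.
have [c c0 hc] := cd 1 0; have [d d0 hd] := cd 1 1.
exists (a * b * c * d)%N; first by rewrite !muln_gt0 a0 b0 c0.
move=> k; elim/ind2; elim/ind2.
- by rewrite (_ : (_ * k)%N = (a * (b * c * d * k))%N); [apply: ha | lia].
- by rewrite (_ : (_ * k)%N = (b * (a * c * d * k))%N); [apply: hb | lia].
- by rewrite (_ : (_ * k)%N = (c * (a * b * d * k))%N); [apply: hc | lia].
- by rewrite (_ : (_ * k)%N = (d * (a * b * c * k))%N); [apply: hd | lia].
Qed.

Lemma rat_pos_frac x : is_rat x -> 0 < x ->
  exists p q : nat, [/\ (0 < p)%N, (0 < q)%N & x = p%:R / q%:R].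
Proof.
move=> [r ->]; rewrite ltr0q => r0; exists `|numq r|%N, `|denq r|%N.
rewrite !absz_gt0 denq_neq0 numq_eq0 gt_eqF //; split => //.
have e (z : int) : 0 <= z -> `|z|%N%:R = z%:~R :> R by move=> z0; rewrite -[in RHS](gez0_abs z0).
by rewrite !e ?denq_ge0 // numq_ge0 ltW.
Qed.

(* Hilbert 90 made explicit: if d d' = t^2 then d (d + d' + 2 t) = (t + d)^2, so
   sqrt d lies in K times the square root of a rational number. *)
Lemma sig_pair_of_norm L L' (t : R) : (forall i j, conj_in_K (L i j) (L' i j)) ->
  0 < \det L -> 0 < \det L' -> is_rat t -> 0 < t -> \det L * \det L' = t ^+ 2 ->
  sig_pair (scale_sqrt (\det L) L) (scale_sqrt (\det L') L').
Proof.
move=> h; have hd := conj_detK h; move: (\det L) (\det L') hd => d d' hd d0 d0' tr t0 ddt.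
have tK := conj_in_K_rat m tr.
(* [l0] is (sqrt d + sqrt d')^2, so sqrt d times sqrt l0 is t + d. *)
pose l0 := d + d' + 2 * t; have l0_gt0 : 0 < l0 by rewrite /l0; lra.
have rl0 : is_rat l0.
  apply: is_ratD; first exact: conj_in_K_trace hd.
  by apply: is_ratM => //; apply/is_rat_int/natr_int.
have [p [q [p0 q0 rE]]] : exists p q : nat, [/\ (0 < p)%N, (0 < q)%N & t ^+ 2 * l0 = p%:R / q%:R].
  by apply: rat_pos_frac; [do ?apply: is_ratM | rewrite mulr_gt0 ?exprn_gt0].
(* 1 / sqrt d equals (t + d') / (t sqrt l0), so L / sqrt d is this matrix over K divided by the
   square root of t^2 l0 = p / q. Clearing denominators by n and q leads to l = n^2 q p. *)
have hL i j : conj_in_K (((t + d') *: L) i j) (((t + d) *: L') i j).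
  by rewrite !mxE; apply: conj_in_KM => //; apply: conj_in_KD => //; apply: conj_in_K_sym.
have [n n0 hn] := common_denominator hL.
have qR : q%:R != 0 :> R by rewrite pnatr_eq0 -lt0n.
pose N := (n * q)%N; have N0 : (0 < N)%N by rewrite muln_gt0 n0.
have NR : (0 : R) < N%:R by rewrite ltr0n.
pose l := (n ^ 2 * q * p)%N.
have lE : l%:R = (N%:R * t) ^+ 2 * l0.
  by rewrite exprMn -mulrA rE /l /N !natrM; field.
have sqrt_l : Num.sqrt l%:R = N%:R * t * Num.sqrt l0.
  by rewrite lE sqrtrM ?sqr_ge0 // sqrtr_sqr gtr0_norm // mulr_gt0.
have key (x x' : R) : 0 < x -> 0 < x' -> x * x' = t ^+ 2 -> l0 = x + x' + 2 * t ->
    (Num.sqrt x)^-1 = (Num.sqrt l%:R)^-1 * (N%:R * (t + x')).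
  move=> x0 x0' xx lx.
  have s0 : Num.sqrt x != 0 by rewrite gt_eqF // sqrtr_gt0.
  have w0 : Num.sqrt l0 != 0 by rewrite gt_eqF // sqrtr_gt0.
  have sw : Num.sqrt x * Num.sqrt l0 = t + x.
    rewrite -sqrtrM ?ltW // (_ : x * l0 = (t + x) ^+ 2) ?sqrtr_sqr ?gtr0_norm ?addr_gt0 //.
    by rewrite lx !mulrDr xx; ring.
  have sx : Num.sqrt x * Num.sqrt x = x by rewrite -expr2 sqr_sqrtr ?ltW.
  have e : t * Num.sqrt l0 = (t + x') * Num.sqrt x.
    apply: (mulfI s0); rewrite mulrCA sw mulrCA sx !mulrDr mulrDl (mulrC x') xx; ring.
  have tR : t != 0 by rewrite gt_eqF.
  rewrite sqrt_l -mulrA e; apply: (mulfI s0); rewrite mulfV //.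
  field; rewrite s0 gt_eqF ?addr_gt0 //= gt_eqF //.
exists l, (N%:R *: ((t + d') *: L)); split.
- by rewrite /l !muln_gt0 n0 q0 p0.
- by move=> i j; rewrite mxE; apply: conj_OK (hn q i j).
- by rewrite /scale_sqrt !scalerA mulrA; congr (_ *: _); rewrite (key d d') // mulrA.
- rewrite (_ : map_mx _ _ = N%:R *: ((t + d) *: L')); last first.
    apply/matrixP => i j; rewrite !mxE.
    by have := conj_in_O_conjK m_gt1 m_sqfree (hn q i j); rewrite !mxE.
  rewrite /scale_sqrt !scalerA mulrA; congr (_ *: _); rewrite (key d' d) ?mulrA //.
    by rewrite mulrC.
  by rewrite /l0; ring.
Qed.

(** Scaling by one entry moves the pair into K: B_ij A has the conjugate A_ij B, and the product
    B_ij^2 A_ij^2 of their determinants is the square of a rational number. Dividing by the square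
    roots recovers A and B up to sign. *)
Lemma sig_pair_of_prod A B : \det A = 1 -> \det B = 1 -> conj_prod conj_in_K A B ->
  sig_pair A B \/ sig_pair A (- B).
Proof.
move=> dA dB h.
have [i [j [Aij Bij]]] : exists i j, A i j != 0 /\ B i j != 0.
  have [i [j Aij]] := nonzero_entry dA; have [p [q Bpq]] := nonzero_entry dB.
  (* A_ij B_pq is nonzero, hence so is its conjugate A_pq B_ij. *)
  exists i, j; split => //; have := conj_in_K_eq0 m_gt1 m_sqfree (h i j p q).
  rewrite mulf_eq0 (negPf Aij) (negPf Bpq) /= => /esym/negbT.
  by rewrite mulf_eq0 negb_or => /andP[].
have hL p q : conj_in_K ((B i j *: A) p q) ((A i j *: B) p q).
  by rewrite !mxE [B i j * _]mulrC; apply: h.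
have dL : \det (B i j *: A) = B i j ^+ 2 by rewrite detZ dA mulr1.
have dL' : \det (A i j *: B) = A i j ^+ 2 by rewrite detZ dB mulr1.
have sgE x C : x != 0 -> scale_sqrt (x ^+ 2) (x *: C) = C \/ scale_sqrt (x ^+ 2) (x *: C) = - C.
  move=> x0; rewrite /scale_sqrt sqrtr_sqr scalerA; case: (ltrgt0P x) (x0) => // sx _.
    by left; rewrite mulVf // scale1r.
  by right; rewrite invrN mulNr mulVf // scaleN1r.
have tr : is_rat `|A i j * B i j|.
  have r0 : is_rat (A i j * B i j) by apply: is_rat_conj (h i j i j).
  by case: ger0P => // _; apply: is_ratN.
have : sig_pair (scale_sqrt (B i j ^+ 2) (B i j *: A)) (scale_sqrt (A i j ^+ 2) (A i j *: B)).
  rewrite -dL -dL'; apply: (sig_pair_of_norm hL _ _ tr); rewrite ?dL ?dL' ?exprn_even_gt0 //.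
    by rewrite normr_gt0 mulf_neq0.
  by rewrite -normrX ger0_norm ?sqr_ge0 // exprMn mulrC.
case: (sgE _ A Bij) => ->; case: (sgE _ B Aij) => -> hs; [by left | by right | |].
  by right; have := sig_pairN hs; rewrite opprK.
by left; have := sig_pairN hs; rewrite !opprK.
Qed.

(** * Integrality of the tensor product *)

(** Exchanges the two tensor factors. In the coordinates (x0, w, w', x3) it swaps w and w', so it is
    the trace of conjugation on indices. *)
Definition sw4 (i : 'I_(1 + (2 + 1))) : 'I_(1 + (2 + 1)) :=
  match (i : nat) with 1%N => k2 | 2%N => k1 | _ => i end.

Lemma sw4_pair a c : sw4 (pair4 a c) = pair4 c a.
Proof. by move: a c; elim/ind2; elim/ind2. Qed.

Lemma pair4_surj (i : 'I_(1 + (2 + 1))) : i = pair4 (hi4 i) (lo4 i).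
Proof. by move: i; elim/ind4. Qed.

Lemma sw40 : sw4 k0 = k0. Proof. exact: val_inj. Qed.
Lemma sw41 : sw4 k1 = k2. Proof. exact: val_inj. Qed.
Lemma sw42 : sw4 k2 = k1. Proof. exact: val_inj. Qed.
Lemma sw43 : sw4 k3 = k3. Proof. exact: val_inj. Qed.

(** Satisfied by both [conj_in_O] and [conj_in_K], so that the integral and the rational case share
    their proofs. *)
Definition conj_ring (C : R -> R -> Prop) : Prop :=
  [/\ C 0 0, C 1 1, (forall x x' y y', C x x' -> C y y' -> C (x + y) (x' + y')),
      (forall x x' y y', C x x' -> C y y' -> C (x * y) (x' * y'))
    & (forall x x', C x x' -> C (- x) (- x')) /\ (forall x x', C x x' -> C x' x)].

Lemma conj_ringO : conj_ring conj_in_O.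
Proof.
split; [exact/conj_in_O_int/rpred0 | exact/conj_in_O_int/rpred1 | | |].
- by move=> *; apply: conj_in_OD.
- by move=> *; apply: OM.
- by split=> *; [apply: conj_in_ON | apply: Osym].
Qed.

Lemma conj_ringK : conj_ring conj_in_K.
Proof.
split; [exact: conj_in_K0 | exact/conj_in_K_rat/is_rat_int/rpred1 | | |].
- by move=> *; apply: conj_in_KD.
- by move=> *; apply: conj_in_KM.
- by split=> *; [apply: conj_in_KN | apply: conj_in_K_sym].
Qed.

Section ConjRing.
Variable C : R -> R -> Prop.
Hypothesis CR : conj_ring C.

Let C0 : C 0 0. Proof. by case: CR. Qed.
Let C1 : C 1 1. Proof. by case: CR. Qed.
Let CD x x' y y' : C x x' -> C y y' -> C (x + y) (x' + y').
Proof. by case: CR => _ _ h _ _; apply: h. Qed.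
Let CM x x' y y' : C x x' -> C y y' -> C (x * y) (x' * y').
Proof. by case: CR => _ _ _ h _; apply: h. Qed.
Let CN x x' : C x x' -> C (- x) (- x').
Proof. by case: CR => _ _ _ _ [h _]; apply: h. Qed.
Let CS x x' : C x x' -> C x' x.
Proof. by case: CR => _ _ _ _ [_ h]; apply: h. Qed.

Lemma conj_sgn4 i x x' : C x x' -> C (sgn4 R i * x) (sgn4 R i * x').
Proof. by case: i => [|i] h; rewrite /= ?mul1r ?mulN1r //; apply: CN. Qed.

Lemma conj_prod_tens A B : conj_prod C A B <->
  forall i j, C (tens A B i j) (tens A B (sw4 i) (sw4 j)).
Proof.
split=> h.
  move=> i j; rewrite (pair4_surj i) (pair4_surj j) !sw4_pair !tens_pair.
  rewrite -!(sgn4_pairC _ (hi4 _)) -!mulrA; do 2!apply: conj_sgn4; exact: h.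
move=> a b c d; have := h (pair4 a c) (pair4 b d); rewrite !sw4_pair !tens_pair.
rewrite (sgn4_pairC _ c) (sgn4_pairC _ d) -!mulrA => /(conj_sgn4 (pair4 a c)).
by rewrite !sgn4K => /(conj_sgn4 (pair4 b d)); rewrite !sgn4K.
Qed.

Lemma conj_prod_adj A B : conj_prod C A B -> conj_prod C (adj2 A) (adj2 B).
Proof.
move=> h.
elim/ind2; elim/ind2; elim/ind2; elim/ind2; rewrite !mxE /= ?mulrNN ?mulrN ?mulNr;
  do ?apply: CN; exact: h.
Qed.

Lemma conj_sum4 (x y z t x' y' z' t' : R) : C x x' -> C y y' -> C z z' -> C t t' ->
  C (x + y + z + t) (x' + z' + y' + t').
Proof. by move=> *; rewrite [x' + _ + _]addrAC; do !apply: CD. Qed.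

Hypotheses (Cu : C u u') (Cv : C v v').

Lemma conj_chg i j : C (chg u v u' v' i j) (chg u v u' v' (sw4 i) j).
Proof. by move: i j; elim/ind4; elim/ind4; rewrite !chgE //=; apply: CS. Qed.

Lemma conj_mul_chg (Y : M4) : (forall i j, C (Y i j) (Y (sw4 i) (sw4 j))) ->
  forall i j, C ((Y *m chg u v u' v') i j) ((Y *m chg u v u' v') (sw4 i) j).
Proof.
move=> h i j; rewrite [X in C X]mxE [X in C _ X]mxE !sum4.
have t l := CM (h i l) (conj_chg l j).
apply: conj_sum4; [exact: t k0 | exact: t k1 | exact: t k2 | exact: t k3].
Qed.

(** The two middle rows of [Z] are conjugate and thus have common coordinates over (u, v) and (u',
    v'), for which [chgV] solves; the outer rows are their own conjugates. *)
Lemma chg_coords (E : R -> Prop) (Z : M4) :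
  (forall x x', C x x' -> exists a b, [/\ E a, E b, x = a * u + b * v & x' = a * u' + b * v']) ->
  (forall x, C x x -> E x) ->
  (forall i j, C (Z i j) (Z (sw4 i) j)) -> forall i j, E ((chgV u v u' v' *m Z) i j).
Proof.
move=> CE CEr h i j; have [a [b [Ea Eb e1 e2]]] := CE _ _ (h k1 j).
rewrite sw41 in e2; have D0 := disc_neq0; rewrite mxE sum4 !mxE.
move: i; elim/ind4 => /=.
- by rewrite !mul0r !addr0 mul1r; apply: CEr; have := h k0 j; rewrite sw40.
- have -> : 0 * Z k0 j + v' / dsc * Z k1 j + - v / dsc * Z k2 j + 0 * Z k3 j = a.
    by rewrite e1 e2; field.
  by [].
- have -> : 0 * Z k0 j + - u' / dsc * Z k1 j + u / dsc * Z k2 j + 0 * Z k3 j = b.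
    by rewrite e1 e2; field.
  by [].
- by rewrite !mul0r !add0r mul1r; apply: CEr; have := h k3 j; rewrite sw43.
Qed.

Lemma conj_mul_const (U : M4) : (forall i j, C (U i j) (U i j)) ->
  forall i j, C ((chg u v u' v' *m U) i j) ((chg u v u' v' *m U) (sw4 i) j).
Proof.
move=> h i j; rewrite [X in C X]mxE [X in C _ X]mxE !sum4.
by do !apply: CD; apply: CM (h _ _); apply: conj_chg.
Qed.

End ConjRing.

Let Ku : conj_in_K u u' := conj_in_O_K conj_u.
Let Kv : conj_in_K v v' := conj_in_O_K conj_v.

Lemma tau_rat A B : conj_prod conj_in_K A B -> forall i j, is_rat (tau A B i j).
Proof.
move=> /(conj_prod_tens conj_ringK) h; rewrite /tau_mx -mulmxA.
apply: (@chg_coords conj_in_K (@is_rat R)); first exact: basis_coordsK.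
  by move=> x; apply: is_rat_conj.
exact: (conj_mul_chg conj_ringK Ku Kv).
Qed.

Lemma tau_int A B : conj_prod conj_in_O A B -> forall i j, tau A B i j \is a Num.int.
Proof.
move=> /(conj_prod_tens conj_ringO) h; rewrite /tau_mx -mulmxA.
apply: (@chg_coords conj_in_O (fun x => x \is a Num.int)); first exact: basis_coords.
  by move=> x; apply: conj_in_O_same.
exact: (conj_mul_chg conj_ringO conj_u conj_v).
Qed.

Lemma rat_tau A B : (forall i j, is_rat (tau A B i j)) -> conj_prod conj_in_K A B.
Proof.
move=> h; apply/(conj_prod_tens conj_ringK) => i j.
rewrite -(tauK disc_neq0 A B).
have hZ := conj_mul_const conj_ringK Ku Kv (fun k l => conj_in_K_rat m (h k l)).
move: (chg _ _ _ _ *m _) hZ => Z hZ.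
(* Conjugation exchanges the two terms of [dsc], hence changes its sign. *)
have KD : conj_in_K dsc^-1 (- dsc)^-1.
  apply: KV; rewrite opprB; apply: conj_in_KB.
    by rewrite [v * _]mulrC; apply: conj_in_KM => //; apply: conj_in_K_sym.
  by rewrite [u * _]mulrC; apply: conj_in_KM => //; apply: conj_in_K_sym.
have hV k l : conj_in_K (chgV u v u' v' k l) (chgV u v u' v' k (sw4 l)).
  have [z0 z1] : conj_in_K (0 : R) 0 /\ conj_in_K (1 : R) 1 by case: conj_ringK.
  have hD x x' : conj_in_K x x' -> conj_in_K (x / dsc) (- x' / dsc).
    by move=> hx; have := conj_in_KM hx KD; rewrite invrN mulrN mulNr.
  move: k l; elim/ind4; elim/ind4; rewrite !mxE //=.
  - by apply: hD; apply: conj_in_K_sym.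
  - by have := hD _ _ (conj_in_KN Kv); rewrite opprK.
  - by have := hD _ _ (conj_in_KN (conj_in_K_sym Ku)); rewrite opprK.
  - by apply: hD.
rewrite [X in conj_in_K X]mxE [X in conj_in_K _ X]mxE !sum4.
by do !apply: conj_in_KD; apply: conj_in_KM.
Qed.

(** [x] is a rational root of a monic integral quadratic polynomial; the discriminant is the square
    of an integer, of the same parity as x + y. *)
Lemma rat_sum_prod_int x y :
  is_rat x -> x + y \is a Num.int -> x * y \is a Num.int -> x \is a Num.int.
Proof.
move=> rx /intrP[s sE] /intrP[t tE].
have /intrP[z zE] : 2 * x - s%:~R \is a Num.int.
  apply: rat_sqr_int.
    apply: is_ratD; last by apply/is_ratN/is_rat_int/intr_int.
    by apply: is_ratM => //; apply/is_rat_int/natr_int.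
  have -> : (2 * x - s%:~R) ^+ 2 = (s ^+ 2 - 4 * t)%:~R.
    by rewrite rmorphB /= rmorphXn rmorphM /= -tE -sE; ring.
  exact: intr_int.
have e : z ^+ 2 = s ^+ 2 - 4 * t.
  apply: (@intr_inj R); rewrite [RHS]rmorphB !rmorphXn (rmorphM _ 4) /= -zE -tE -sE; ring.
have [k kE] : exists k : int, z + s = 2 * k.
  exists ((z + s) %/ 2)%Z; move: e; rewrite !expr2.
  have [a [b [-> bE]]] : exists a b : int, z = 2 * a + b /\ (b = 0 \/ b = 1).
    by exists (z %/ 2)%Z, (z %% 2)%Z; split; lia.
  have [c [d [-> dE]]] : exists a b : int, s = 2 * a + b /\ (b = 0 \/ b = 1).
    by exists (s %/ 2)%Z, (s %% 2)%Z; split; lia.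
  by case: bE dE => -> [] -> e; lia.
suff -> : x = k%:~R by apply: intr_int.
have : (z + s)%:~R = (2 * k)%:~R :> R by rewrite kE.
by rewrite rmorphD rmorphM /= -zE => e2; lra.
Qed.

Lemma floor_mxK (U : M4) : (forall i j, U i j \is a Num.int) ->
  map_mx intr (map_mx Num.floor U) = U.
Proof. by move=> h; apply/matrixP => i j; rewrite !mxE; apply/eqP; rewrite -intrEfloor. Qed.

Lemma int_inv (U V : M4) : (forall i j, U i j \is a Num.int) -> \det U = 1 -> V *m U = 1%:M ->
  forall i j, V i j \is a Num.int.
Proof.
move=> hU dU VU; have UX := esym (floor_mxK hU).
move: (map_mx Num.floor U) UX => X UX.
have -> : V = map_mx intr (\adj X).
  rewrite map_mx_adj -UX -[LHS]mulmx1 -dU -[RHS]mul1mx -VU -mulmxA mul_mx_adj.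
  by rewrite dU !mulmx1.
by move=> i j; rewrite mxE intr_int.
Qed.

(* The entries of U = tau A B and of its inverse only yield the products A_ij B_kl
   with i = k or j = l; for x = A_00 B_11 and y = A_01 B_10 one gets x + y in O, and
   the traces of x and y have integral sum and product. *)
Lemma int_tau A B : \det A = 1 -> \det B = 1 ->
  (forall i j, tau A B i j \is a Num.int) -> conj_prod conj_in_O A B.
Proof.
move=> dA dB h.
have hK : conj_prod conj_in_K A B by apply: rat_tau => i j; apply: is_rat_int.
have dU : \det (tau A B) = 1 by case: (tau_SO disc_neq0 dA dB).
have hV i j : tau (adj2 A) (adj2 B) i j \is a Num.int.
  apply: (int_inv h dU); rewrite tauM ?disc_neq0 // !mul_adj2l // tau1 //.
  exact: disc_neq0.
have cols C D : (forall i j, tau C D i j \is a Num.int) ->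
    forall i j, conj_in_O ((tens C D *m chg u v u' v') i j)
                          ((tens C D *m chg u v u' v') (sw4 i) j).
  move=> hU; rewrite -(chg_tau disc_neq0).
  exact: (conj_mul_const conj_ringO conj_u conj_v (fun k l => conj_in_O_int m (hU k l))).
have unsgn C D a b c : conj_in_O (tens C D (pair4 a c) (pair4 b b))
    (tens C D (pair4 c a) (pair4 b b)) -> conj_in_O (C a b * D c b) (C c b * D a b).
  rewrite !tens_pair (sgn4_pairC _ c) -!mulrA => /(conj_sgn4 conj_ringO (pair4 a c)).
  by rewrite !sgn4K => /(conj_sgn4 conj_ringO (pair4 b b)); rewrite !sgn4K.
have col0 C D (hU : forall i j, tau C D i j \is a Num.int) a c :
    conj_in_O (C a 0 * D c 0) (C c 0 * D a 0).
  apply: unsgn; have := cols C D hU (pair4 a c) k0; rewrite sw4_pair.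
  rewrite [X in conj_in_O X]mxE [X in conj_in_O _ X]mxE !sum4 !chgE /=.
  by rewrite !mulr0 !addr0 !mulr1.
have col3 C D (hU : forall i j, tau C D i j \is a Num.int) a c :
    conj_in_O (C a 1 * D c 1) (C c 1 * D a 1).
  apply: unsgn; have := cols C D hU (pair4 a c) k3; rewrite sw4_pair.
  rewrite [X in conj_in_O X]mxE [X in conj_in_O _ X]mxE !sum4 !chgE /=.
  by rewrite !mulr0 !add0r !mulr1.
have p0 := col0 A B h; have p3 := col3 A B h.
have q0 : conj_in_O (A 1 1 * B 1 0) (A 1 0 * B 1 1).
  have := col0 _ _ hV 0 1; rewrite !mxE /= mulrN mulNr => /conj_in_ON.
  by rewrite !opprK.
have q3 : conj_in_O (A 0 1 * B 0 0) (A 0 0 * B 0 1).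
  have := col3 _ _ hV 0 1; rewrite !mxE /= mulrN mulNr => /conj_in_ON.
  by rewrite !opprK.
(* As 1 = a u + b v, the combination of the middle columns with coefficients a and b is the image of
   the vector w = w' = 1, x0 = x3 = 0; its middle entries are the two sums. *)
have sxy : conj_in_O (A 0 0 * B 1 1 + A 0 1 * B 1 0) (A 1 1 * B 0 0 + A 1 0 * B 0 1).
  have [a [b [ai bi e1 e2]]] := basis_coords (conj_in_O_int m (rpred1 _ : (1 : R) \is a Num.int)).
  have ha := conj_in_O_int m ai; have hb := conj_in_O_int m bi.
  have hk1 := cols A B h k1 k1; have hk2 := cols A B h k1 k2.
  rewrite sw41 [X in conj_in_O X]mxE [X in conj_in_O _ X]mxE !sum4 !chgE !tensE /= in hk1.
  rewrite sw41 [X in conj_in_O X]mxE [X in conj_in_O _ X]mxE !sum4 !chgE !tensE /= in hk2.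
  have := conj_in_OD (OM ha hk1) (OM hb hk2).
  set X := (X in conj_in_O X _ -> _); set Y := (X in conj_in_O _ X -> _).
  suff -> : X = A 0 0 * B 1 1 + A 0 1 * B 1 0.
    suff -> : Y = A 1 1 * B 0 0 + A 1 0 * B 0 1 by [].
    rewrite -[RHS]mulr1 mulrDl {1}e2 e1 /Y; ring.
  rewrite -[RHS]mulr1 mulrDl {1}e1 e2 /X; ring.
have hx := hK 0 0 1 1; have hy := hK 0 1 1 0.
have nx : (A 0 0 * B 1 1) * (A 1 1 * B 0 0) \is a Num.int.
  rewrite (_ : _ * _ = (A 0 0 * B 0 0) * (A 1 1 * B 1 1)); last by ring.
  by apply: rpredM; apply: (conj_in_O_same m_gt1).
have ny : (A 0 1 * B 1 0) * (A 1 0 * B 0 1) \is a Num.int.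
  rewrite (_ : _ * _ = (A 0 1 * B 0 1) * (A 1 0 * B 1 0)); last by ring.
  by apply: rpredM; apply: (conj_in_O_same m_gt1).
(* The product of the traces of x and y regroups into the traces of x y and x' y, and these are
   products of elements already known to lie in O. *)
have tp : (A 0 0 * B 1 1 + A 1 1 * B 0 0) * (A 0 1 * B 1 0 + A 1 0 * B 0 1) \is a Num.int.
  have t1 := Otrace (OM (p0 0 1) (p3 0 1)).
  have t2 := Otrace (OM q3 q0).
  rewrite (_ : _ * _ = (A 0 0 * B 1 0 * (A 0 1 * B 1 1) + A 1 0 * B 0 0 * (A 1 1 * B 0 1)) +
    (A 0 1 * B 0 0 * (A 1 1 * B 1 0) + A 0 0 * B 0 1 * (A 1 0 * B 1 1))); last by ring.
  by apply: rpredD.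
have ts : (A 0 0 * B 1 1 + A 1 1 * B 0 0) + (A 0 1 * B 1 0 + A 1 0 * B 0 1) \is a Num.int.
  by have := Otrace sxy; rewrite addrACA.
have tx : A 0 0 * B 1 1 + A 1 1 * B 0 0 \is a Num.int.
  by apply: rat_sum_prod_int ts tp; apply: conj_in_K_trace hx.
have ty : A 0 1 * B 1 0 + A 1 0 * B 0 1 \is a Num.int.
  apply: (@rat_sum_prod_int _ (A 0 0 * B 1 1 + A 1 1 * B 0 0)); first exact: conj_in_K_trace hy.
    by rewrite addrC.
  by rewrite mulrC.
have ox := trace_norm_int m_gt1 m_sqfree hx tx nx.
have oy := trace_norm_int m_gt1 m_sqfree hy ty ny.
have p0' := Osym (p0 0 1); have p3' := Osym (p3 0 1); have q0' := Osym q0.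
have q3' := Osym q3; have ox' := Osym ox; have oy' := Osym oy.
by elim/ind2; elim/ind2; elim/ind2; elim/ind2.
Qed.

(** Multiplication by 1 = [\det B] regroups A_ij A_pq into mixed products; on the conjugate side the
    factor is 1 = [\det A]. *)
Lemma conj_prod_entries A B : conj_prod conj_in_O A B -> \det B = 1 -> \det A = 1 ->
  forall i j p q, conj_in_O (A i j * A p q) (B i j * B p q).
Proof.
move=> h dB dA i j p q; rewrite -[X in conj_in_O X]mulr1 -[X in conj_in_O _ X]mulr1.
rewrite -{1}dB -dA !det2.
have -> : A i j * A p q * (B 0 0 * B 1 1 - B 0 1 * B 1 0) =
  (A i j * B 0 0) * (A p q * B 1 1) - (A i j * B 0 1) * (A p q * B 1 0) by ring.
have -> : B i j * B p q * (A 0 0 * A 1 1 - A 0 1 * A 1 0) =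
  (A 0 0 * B i j) * (A 1 1 * B p q) - (A 0 1 * B i j) * (A 1 0 * B p q) by ring.
by apply: conj_in_OB; apply: OM; apply: h.
Qed.

(** The square of A_ij B_pq is A_ij^2 B_pq^2, which lies in O, and O is integrally closed. *)
Lemma conj_prod_of_entries A B : sig_pair A B ->
  (forall i j p q, OK m (A i j * A p q)) -> conj_prod conj_in_O A B.
Proof.
move=> hs h.
have h2 i j p q : conj_in_O (A i j * A p q) (B i j * B p q).
  have := OKc (h i j p q); rewrite (_ : conjK m _ = B i j * B p q) //.
  exact: (conjKE m_gt1 m_sqfree (sig_pair_prod2 i j p q hs)).
move=> i j p q; apply: (integrally_closed m_gt1 m_sqfree).
  exact: (sig_pair_prod hs).
have -> : (A i j * B p q) ^+ 2 = (A i j * A i j) * (B p q * B p q) by ring.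
have -> : (A p q * B i j) ^+ 2 = (B i j * B i j) * (A p q * A p q) by ring.
by apply: OM => //; apply: Osym.
Qed.
(** * The extended group *)

Lemma OKD x y : OK m x -> OK m y -> OK m (x + y).
Proof. by move=> /OKc hx /OKc hy; apply: conj_OK (conj_in_OD hx hy). Qed.

Lemma OKM x y : OK m x -> OK m y -> OK m (x * y).
Proof. by move=> /OKc hx /OKc hy; apply: conj_OK (OM hx hy). Qed.

Lemma OK_int x : x \is a Num.int -> OK m x.
Proof. by move=> /(conj_in_O_int m)/conj_OK. Qed.

Lemma OKN x : OK m x -> OK m (- x).
Proof. by move=> /OKc hx; apply: conj_OK (conj_in_ON hx). Qed.

Lemma OK_sum n (F : 'I_n -> R) : (forall i, OK m (F i)) -> OK m (\sum_(i < n) F i).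
Proof.
move=> h; apply: (big_ind (OK m)) => // [|x y]; [exact/OK_int/rpred0 | exact: OKD].
Qed.

Lemma ideal_genS (S : set R) x : S x -> ideal_gen m S x.
Proof.
move=> Sx; exists 1%N, (fun=> 1), (fun=> x); split => //.
  by move=> _; apply/OK_int/rpred1.
by rewrite big_ord1 mul1r.
Qed.

Lemma ideal_gen_div (d : R) (S : set R) : (forall x, S x -> OK m (x / d)) ->
  forall x, ideal_gen m S x -> OK m (x / d).
Proof.
move=> h x [n [c [a [cO aS ->]]]]; rewrite mulr_suml; apply: OK_sum => i.
by rewrite -mulrA; apply: OKM => //; apply: h.
Qed.

Lemma ideal_gen1 (d x : R) : d != 0 -> OK m (x / d) -> ideal_gen m [set d] x.
Proof.
move=> d0 h; exists 1%N, (fun=> x / d), (fun=> d); split => //.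
by rewrite big_ord1 mulfVK.
Qed.

(** I(L)^2 always contains [\det L], a combination of products of entries, so the equation of ideals
    says that [\det L] divides all these products. *)
Lemma ideal_mx_sqr (L : 'M[R]_2) : \det L != 0 ->
  (ideal_mul m (ideal_mx m L) (ideal_mx m L) = ideal_gen m [set \det L]) <->
  (forall i j p q, OK m (L i j * L p q / \det L)).
Proof.
move=> d0; split=> [e i j p q|h].
  apply: (@ideal_gen_div _ [set \det L]).
    by move=> _ ->; rewrite divff //; apply/OK_int/rpred1.
  rewrite -e; apply: ideal_genS; exists (L i j); first by apply: ideal_genS; exists i, j.
  by exists (L p q) => //; apply: ideal_genS; exists p, q.
apply/seteqP; split=> x hx.
  apply: ideal_gen1 => //; apply: ideal_gen_div hx => _ [y hy [z hz <-]].
  have hz' i j : OK m (L i j * z / \det L).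
    (* The two factors are treated one at a time, with [\det L / L i j] as divisor. If [L i j] is 0,
       this divisor and the quotient by it are 0 by convention. *)
    have : OK m (z / (\det L / L i j)).
      have [l0|l0] := eqVneq (L i j) 0.
        by rewrite l0 invr0 mulr0 invr0 mulr0; apply/OK_int/rpred0.
      apply: ideal_gen_div hz => _ [p [q ->]].
      by have := h i j p q; rewrite invf_div mulrA [L p q * _]mulrC.
    by rewrite invf_div mulrA [z * _]mulrC.
  have [z0|z0] := eqVneq z 0; first by rewrite z0 mulr0 mul0r; apply/OK_int/rpred0.
  have : OK m (y / (\det L / z)).
    apply: ideal_gen_div hy => _ [p [q ->]].
    by rewrite invf_div mulrA; apply: hz'.
  by rewrite invf_div mulrA.
have {}hx : OK m (x / \det L).
  by apply: ideal_gen_div hx => _ ->; rewrite divff //; apply/OK_int/rpred1.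
have entry i j : ideal_mx m L (L i j) by apply: ideal_genS; exists i, j.
exists 2%N, (fun i : 'I_2 => if i == 0 then x / \det L else - (x / \det L)),
  (fun i : 'I_2 => if i == 0 then L 0 0 * L 1 1 else L 0 1 * L 1 0); split.
- by move=> i; case: ifP => _ //; apply: OKN.
- by move=> i; case: ifP => _; [exists (L 0 0) => //; exists (L 1 1)
    | exists (L 0 1) => //; exists (L 1 0)].
- rewrite sum2 /= mulNr -mulrBr -det2 mulfVK //.
Qed.

(** y / 2 and z / 2 have integral trace and norm, so they lie in O and y z / 4 has integral trace;
    here this is verified by parities over 1 and sqrt m. It excludes the squarefree part 2 in
    [norm_square]. *)
Lemma even_trace_prod y y' z z' (t w n k : int) :
  conj_in_K y y' -> y + y' = 2 * t%:~R -> y * y' = 4 * n%:~R ->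
  conj_in_K z z' -> z + z' = 2 * w%:~R -> z * z' = 4 * k%:~R ->
  exists j : int, y * z + y' * z' = 4 * j%:~R.
Proof.
have coord x x' (a b : int) : conj_in_K x x' -> x + x' = 2 * a%:~R -> x * x' = 4 * b%:~R ->
    exists2 q : int, x = a%:~R + q%:~R * sqrtm R m /\ x' = a%:~R - q%:~R * sqrtm R m
      & a ^+ 2 - m%:Z * q ^+ 2 = 4 * b.
  move=> [p [q [-> ->]]] e1 e2.
  have pE : ratr p = a%:~R :> R by lra.
  have r2 := sqr_rt R m.
  have key : ratr q ^+ 2 * m%:R = (a ^+ 2 - 4 * b)%:~R :> R.
    by rewrite rmorphB /= rmorphXn rmorphM /= -e2 -pE -r2; ring.
  have /intrP[c cE] : (ratr q : R) \is a Num.int.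
    apply: (squarefree_rat_int m_sqfree); first by exists q.
    by rewrite key intr_int.
  exists c; first by rewrite pE cE.
  have : (m%:Z * c ^+ 2)%:~R = (a ^+ 2 - 4 * b)%:~R :> R.
    by rewrite -key cE rmorphM rmorphXn /= mulrC.
  by move/intr_inj => ->; ring.
move=> hy y1 y2 hz z1 z2.
have [q [-> ->] qE] := coord _ _ _ _ hy y1 y2; have [r [-> ->] rE] := coord _ _ _ _ hz z1 z2.
suff [j jE] : exists j : int, t * w + m%:Z * q * r = 2 * j.
  exists j; have := congr1 (fun x : int => x%:~R : R) jE.
  rewrite rmorphD !rmorphM /= -[m%:~R]/(m%:R) -(sqr_rt R m) => e.
  rewrite (_ : 4 * _ = 2 * (2 * j%:~R)); last by ring.
  by rewrite -e; ring.
exists ((t * w + m%:Z * q * r) %/ 2)%Z.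
have half (x : int) : exists a b : int, x = 2 * a + b /\ (b = 0 \/ b = 1).
  by exists (x %/ 2)%Z, (x %% 2)%Z; split; lia.
have [a [b [tE bE]]] := half t; have [a' [b' [wE bE']]] := half w.
have [c [e [qE' eE]]] := half q; have [c' [e' [rE' eE']]] := half r.
have [f [g [mE gE]]] := half m%:Z.
move: qE rE; rewrite mE tE wE qE' rE' !expr2.
by case: bE => ->; case: bE' => ->; case: eE => ->; case: eE' => ->; case: gE => ->; lia.
Qed.

(** Let N(det L) = s n^2 with s squarefree. All L_ij L'_ij / n and all traces of L_ij L'_pq / n are
    multiples of s. Expanding s = N(det L) / n^2 in them shows that s divides 2, and s = 2
    contradicts a congruence modulo 4. *)
Lemma norm_square L : OK_mx m L -> totally_positive m (\det L) ->
  (forall i j p q, OK m (L i j * L p q / \det L)) ->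
  exists t : R, [/\ is_rat t, 0 < t & \det L * \det (map_mx (conjK m) L) = t ^+ 2].
Proof.
move=> LO [d0 d0'] hL; pose L' := map_mx (conjK m) L; rewrite -/L'.
have hE i j : conj_in_O (L i j) (L' i j) := conj_mx_entry i j LO.
have hd : conj_in_O (\det L) (\det L') := conj_detO hE.
rewrite (conj_in_O_conjK m_gt1 m_sqfree hd) in d0'.
have dd0 : 0 < \det L * \det L' by rewrite mulr_gt0.
have [N N0 NE] : exists2 N : nat, (0 < N)%N & \det L * \det L' = N%:R.
  have /intrP[z zE] := Onorm hd; rewrite zE ltr0z in dd0.
  exists `|z|%N; first by rewrite absz_gt0 gt_eqF.
  by rewrite zE -[LHS]/(z%:~R) -{1}[z]gez0_abs // ltW.
have [s [n [s0 n0 sqf nE]]] := squarefree_decomposition N0.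
have nR : n%:R != 0 :> R by rewrite pnatr_eq0 -lt0n.
have sR : s%:R != 0 :> R by rewrite pnatr_eq0 -lt0n.
have ddE : \det L * \det L' = s%:R * n%:R ^+ 2 by rewrite NE nE natrM natrX.
have dn : \det L != 0 by rewrite gt_eqF.
have dn' : \det L' != 0 by rewrite gt_eqF.
have g i j p q : conj_in_O (L i j * L p q / \det L) (L' i j * L' p q / \det L').
  have := OKc (hL i j p q); rewrite (_ : conjK m _ = L' i j * L' p q / \det L') //.
  apply: (conjKE m_gt1 m_sqfree); apply: conj_in_KM; last by apply/KV/conj_in_O_K.
  by apply/conj_in_O_K/OM.
have tK i j p q : conj_in_K (L i j * L' p q / n%:R) (L' i j * L p q / n%:R).
  apply: conj_in_KM; last exact: conj_in_K_natV.
  by apply/conj_in_O_K/OM => //; apply: Osym.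
have T i j p q : exists t : int,
    L i j * L' p q / n%:R + L' i j * L p q / n%:R = s%:R * t%:~R.
  suff /intrP[t tE] : (L i j * L' p q / n%:R + L' i j * L p q / n%:R) / s%:R \is a Num.int.
    by exists t; rewrite -tE [RHS]mulrC mulfVK.
  apply: (squarefree_rat_int sqf).
    apply: is_ratM; first exact: conj_in_K_trace (tK _ _ _ _).
    by apply/is_ratV/is_rat_int/natr_int.
  (* Substituting s = N(det L) / n^2 turns the left side into a trace and twice a norm of elements
     built from the integral L_ij L_pq / [\det L]. *)
  have -> : ((L i j * L' p q / n%:R + L' i j * L p q / n%:R) / s%:R) ^+ 2 * s%:R
     = ((L i j * L i j / \det L) * (L' p q * L' p q / \det L')
       + (L' i j * L' i j / \det L') * (L p q * L p q / \det L))
     + 2 * ((L i j * L p q / \det L) * (L' i j * L' p q / \det L')).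
    have -> : s%:R = \det L * \det L' / n%:R ^+ 2 by rewrite ddE mulfK ?expf_neq0.
    by field; rewrite nR dn dn'.
  apply: rpredD; first by apply: Otrace; apply: OM => //; apply: Osym.
  by apply: rpredM; [apply: natr_int | apply: Onorm].
have Nn i j : exists t : int, L i j * L' i j / n%:R = s%:R * t%:~R.
  suff /intrP[t tE] : L i j * L' i j / n%:R / s%:R \is a Num.int.
    by exists t; rewrite -tE [RHS]mulrC mulfVK.
  apply: (squarefree_rat_int sqf).
    apply: is_ratM; last by apply/is_ratV/is_rat_int/natr_int.
    apply: is_ratM; last by apply/is_ratV/is_rat_int/natr_int.
    exact: conj_in_K_norm (conj_in_O_K (hE _ _)).
  have -> : (L i j * L' i j / n%:R / s%:R) ^+ 2 * s%:R
     = (L i j * L i j / \det L) * (L' i j * L' i j / \det L').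
    have -> : s%:R = \det L * \det L' / n%:R ^+ 2 by rewrite ddE mulfK ?expf_neq0.
    by field; rewrite nR dn dn'.
  exact: Onorm.
have [na naE] := Nn 0 0; have [nb nbE] := Nn 0 1.
have [nc ncE] := Nn 1 0; have [ne neE] := Nn 1 1.
have [tab tabE] := T 0 0 0 1; have [tce tceE] := T 1 1 1 0.
have [tac tacE] := T 0 0 1 0; have [tbe tbeE] := T 0 1 1 1.
have [tae taeE] := T 0 0 1 1; have [tbc tbcE] := T 0 1 1 0.
pose P := (L 0 0 * L' 0 1 / n%:R) * (L 1 1 * L' 1 0 / n%:R)
        + (L' 0 0 * L 0 1 / n%:R) * (L' 1 1 * L 1 0 / n%:R).
have sE : s%:R = (s%:R * na%:~R) * (s%:R * ne%:~R) + (s%:R * nb%:~R) * (s%:R * nc%:~R) - P :> R.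
  have -> : s%:R = \det L * \det L' / n%:R ^+ 2 by rewrite ddE mulfK ?expf_neq0.
  have e4 : \det L * \det L' / n%:R ^+ 2 =
    (L 0 0 * L' 0 0 / n%:R) * (L 1 1 * L' 1 1 / n%:R)
    + (L 0 1 * L' 0 1 / n%:R) * (L 1 0 * L' 1 0 / n%:R) - P.
    by rewrite !det2 /P; field.
  rewrite {1}e4 naE nbE ncE neE ddE mulfK ?expf_neq0 //.
(* For L with rows (a, b) and (c, e), 2 n^2 P equals tr(ab') tr(ec') + tr(ac') tr(be') - tr(ae')
   tr(bc'). *)
have PE : 2 * P = s%:R ^+ 2 * (tab * tce + tac * tbe - tae * tbc)%:~R.
  rewrite rmorphB rmorphD !rmorphM /=.
  transitivity ((s%:R * tab%:~R) * (s%:R * tce%:~R) + (s%:R * tac%:~R) * (s%:R * tbe%:~R)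
    - (s%:R * tae%:~R) * (s%:R * tbc%:~R) : R); last by ring.
  by rewrite -tabE -tceE -tacE -tbeE -taeE -tbcE /P; field.
have s2 : s%:Z * (2 * (na * ne + nb * nc) - (tab * tce + tac * tbe - tae * tbc)) = 2.
  move: PE; set X := (tab * tce + tac * tbe - tae * tbc) => PE.
  apply: (@intr_inj R); rewrite rmorphM rmorphB (rmorphM _ 2) (rmorphD _ (na * ne)) !rmorphM /=.
  apply: (mulfI sR); rewrite -[s%:~R]/(s%:R).
  transitivity (2 * ((s%:R * na%:~R) * (s%:R * ne%:~R) + (s%:R * nb%:~R) * (s%:R * nc%:~R))
    - s%:R ^+ 2 * X%:~R : R); first by ring.
  by rewrite -PE -mulrBr -sE; ring.
have [s1|s1] : s = 1%N \/ s = 2%N.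
  have : (s %| 2)%N.
    move: s2; set w := (2 * (na * ne + nb * nc) - _) => /(congr1 absz).
    by rewrite abszM absz_nat => e; apply/dvdnP; exists `|w|%N; rewrite mulnC e.
  by move=> h; have := dvdn_leq (isT : (0 < 2)%N) h; lia.
  by exists n%:R; split; [apply/is_rat_int/natr_int | rewrite ltr0n | rewrite ddE s1 mul1r].
have [j jE] : exists j : int, P = 4 * j%:~R.
  apply: (@even_trace_prod _ _ _ _ tab tce (na * nb) (ne * nc)) => //.
  - by rewrite tabE s1.
  - rewrite (_ : _ * _ = (L 0 0 * L' 0 0 / n%:R) * (L 0 1 * L' 0 1 / n%:R)); last by field.
    by rewrite naE nbE s1 rmorphM /=; ring.
  - by rewrite tceE s1.
  - rewrite (_ : _ * _ = (L 1 1 * L' 1 1 / n%:R) * (L 1 0 * L' 1 0 / n%:R)); last by field.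
    by rewrite neE ncE s1 rmorphM /=; ring.
have : (2 : int) = 4 * (na * ne + nb * nc - j).
  apply: (@intr_inj R); rewrite rmorphM rmorphB (rmorphD _ (na * ne)) !rmorphM /=.
  by move: sE; rewrite s1 jE => e; apply: (etrans (y := 2%:R)) => //; rewrite [LHS]e; ring.
by lia.
Qed.

(** The condition on entries is visibly stable under products. In the converse direction, L / sqrt l
    of determinant 1 has [\det L] equal to l, which is rational and therefore totally positive. *)
Lemma GammaK_starP A : GammaK_star R m A <->
  SigmaK R m A /\ forall i j p q, OK m (A i j * A p q).
Proof.
split.
  move=> [L [LO [d0 d0'] e AE]]; have dn : \det L != 0 by rewrite gt_eqF.
  have h := (ideal_mx_sqr dn).1 e.
  have [t [tr t0 dt]] := norm_square LO (conj d0 d0') h.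
  have hE i j := conj_in_O_K (conj_mx_entry i j LO).
  have d0'' : 0 < \det (map_mx (conjK m) L).
    by rewrite -(conjKE m_gt1 m_sqfree (conj_detK hE)).
  have [l [P [l0 PO PE _]]] := sig_pair_of_norm hE d0 d0'' tr t0 dt.
  split; first split.
  - by exists l, P; split => //; rewrite AE.
  - by rewrite AE det_scale_sqrt ?mulVf // ltW.
  move=> i j p q; rewrite AE !scale_sqrtE.
  by rewrite mulrACA sqrtV_sqr ?ltW // mulrC.
move=> [[[l [L [l0 LO AE]]] dA] h]; exists L.
have lR : (0 : R) < l%:R by rewrite ltr0n.
have dL : \det L = l%:R.
  have lR0 : l%:R != 0 :> R by rewrite gt_eqF.
  move: dA; rewrite AE det_scale_sqrt ?ltW // => dA.
  by apply: (mulfI (invr_neq0 lR0)); rewrite dA mulVf.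
rewrite dL; split => //.
- split; rewrite ?(conjKE m_gt1 m_sqfree (conj_in_K_nat l)) //.
- rewrite -dL; apply/ideal_mx_sqr; first by rewrite dL gt_eqF.
  move=> i j p q; have := h i j p q; rewrite AE !scale_sqrtE dL.
  by rewrite mulrACA sqrtV_sqr ?ltW // mulrC.
Qed.
(** * The discriminant kernel *)

Lemma conj_dlt : conj_in_O dlt (- dlt).
Proof.
have h := conj_in_O_omega R m.
by have := conj_in_OB h (Osym h); rewrite opprB.
Qed.

Lemma dlt_neq0 : dlt != 0.
Proof. by rewrite gt_eqF // omega_sub_gt0. Qed.

(** The numerator is -(g (w - w') + (h - g) w), and both differences are multiples of [dlt], which
    is an integral multiple of [dsc]. *)
Lemma disc_div (g g' h h' o o' w w' : R) :
  conj_in_O g g' -> conj_in_O h h' -> conj_in_O o o' -> conj_in_O w w' ->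
  h - g = o * dlt -> conj_in_O ((g * w' - h * w) / dsc) ((h' * w' - g' * w) / dsc).
Proof.
move=> hg hh ho hw e; have [k ki kE] := disc_dlt; have D0 := disc_neq0.
have [z zE] := conj_in_O_sub hw.
have e' : h' - g' = o' * - dlt.
  have hk := conj_in_O_K (conj_in_OB hh hg); rewrite e in hk.
  exact: (Kfun hk (conj_in_O_K (OM ho conj_dlt))).
have -> : (g * w' - h * w) / dsc = k * - (g * z%:~R + o * w).
  have -> : g * w' - h * w = - (g * (w - w') + (h - g) * w) by ring.
  by rewrite zE e kE; field.
have -> : (h' * w' - g' * w) / dsc = k * - (g' * z%:~R + o' * w').
  have -> : h' * w' - g' * w = - (g' * (w - w') - (h' - g') * w') by ring.
  by rewrite zE e' kE; field.
apply: OM; first exact: conj_in_O_int.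
apply: conj_in_ON; apply: conj_in_OD; apply: OM => //.
by apply: conj_in_O_int; apply: intr_int.
Qed.

Lemma mul_antidiag (Z : M4) i : ((Z *m antidiag R) i k0 = Z i k3) *
  ((Z *m antidiag R) i k1 = Z i k2) * ((Z *m antidiag R) i k2 = Z i k1) *
  ((Z *m antidiag R) i k3 = Z i k0).
Proof. by do !split; rewrite mxE sum4 !mxE /=; ring. Qed.

Lemma tau_disc A B : (forall i j, conj_in_O (A i j) (B i j)) -> \det A = 1 ->
  exists X : 'M[int]_(1 + (2 + 1)),
    tau A B = 1%:M + map_mx intr X *m lattice_form u v u' v'.
Proof.
move=> h dA; have D0 := disc_neq0.
pose Z : M4 := tens A B - 1%:M.
have hZ i j : conj_in_O (Z i j) (Z (sw4 i) (sw4 j)).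
  have hAB : conj_prod conj_in_O A B.
    by move=> a b c d; rewrite [A c d * _]mulrC; apply: OM => //; apply: Osym.
  rewrite ![Z _ _]mxE; apply: conj_in_OD; first exact: ((conj_prod_tens conj_ringO A B).1 hAB).
  rewrite !mxE; move: i j; elim/ind4; elim/ind4; apply: conj_in_ON; apply: conj_in_O_int;
    by rewrite ?rpred0 ?rpred1.
have dAE := dA; rewrite det2 in dAE.
(* Modulo [dlt] the matrices agree, so each difference reduces to a commutator of two entries or, up
   to sign, to [\det A - 1]; both vanish. *)
have Zo i : exists2 t : R, OK m t & Z i k1 - Z i k2 = t * dlt.
  have [z01 e01] := conj_in_O_sub (OM (h 0 0) (Osym (h 0 1))).
  have [z11 e11] := conj_in_O_sub (OM (h 1 0) (Osym (h 1 1))).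
  have [a ea] := conj_in_O_sub (h 0 0); have [b eb] := conj_in_O_sub (h 0 1).
  have [c ec] := conj_in_O_sub (h 1 0); have [d ed] := conj_in_O_sub (h 1 1).
  have OKz (z : int) : OK m (z%:~R : R) by apply: OK_int; rewrite intr_int.
  have OKA i' j' : OK m (A i' j') := conj_OK (h i' j').
  move: i; elim/ind4; rewrite !mxE /=.
  - exists (- z01%:~R); first exact: OKN.
    by rewrite mulNr -e01; ring.
  - exists (- (d%:~R * A 0 0) + c%:~R * A 0 1).
      by apply: OKD; [apply: OKN|]; apply: OKM.
    have -> : (- (d%:~R * A 0 0) + c%:~R * A 0 1) * dlt
      = - (d%:~R * dlt * A 0 0) + c%:~R * dlt * A 0 1 by ring.
    by rewrite -ed -ec; lra.
  - exists (a%:~R * A 1 1 - b%:~R * A 1 0).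
      by apply: OKD; [|apply: OKN]; apply: OKM.
    have -> : (a%:~R * A 1 1 - b%:~R * A 1 0) * dlt
      = a%:~R * dlt * A 1 1 - b%:~R * dlt * A 1 0 by ring.
    by rewrite -ea -eb; lra.
  - exists z11%:~R => //.
    by rewrite -e11; ring.
(* The inverse of [lattice_form] is chgV antidiag chgV^T, so the required matrix, [tau A B - 1%:M]
   times this inverse, is [chgV *m V]. *)
pose V : M4 := Z *m antidiag R *m (chgV u v u' v')^T.
have hV i j : conj_in_O (V i j) (V (sw4 i) j).
  have [t tO tE] := Zo i; have ho := OKc tO.
  have V0 l : V l k0 = Z l k3 by rewrite [LHS]mxE sum4 !mul_antidiag !mxE /=; ring.
  have V3 l : V l k3 = Z l k0 by rewrite [LHS]mxE sum4 !mul_antidiag !mxE /=; ring.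
  have V1 l : V l k1 = (Z l k2 * v' - Z l k1 * v) / dsc.
    by rewrite [LHS]mxE sum4 !mul_antidiag ![(chgV _ _ _ _)^T _ _]mxE !mxE /=; field.
  have V2 l : V l k2 = - ((Z l k2 * u' - Z l k1 * u) / dsc).
    by rewrite [LHS]mxE sum4 !mul_antidiag ![(chgV _ _ _ _)^T _ _]mxE !mxE /=; field.
  have hg := hZ i k2; have hh := hZ i k1; rewrite sw42 in hg; rewrite sw41 in hh.
  move: j; elim/ind4; rewrite ?V0 ?V1 ?V2 ?V3.
  - by have := hZ i k3; rewrite sw43.
  - exact: (disc_div hg hh ho conj_v tE).
  - by apply: conj_in_ON; exact: (disc_div hg hh ho conj_u tE).
  - by have := hZ i k0; rewrite sw40.
have Xi i j : (chgV u v u' v' *m V) i j \is a Num.int.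
  move: i j; apply: (@chg_coords conj_in_O (fun x => x \is a Num.int)) => //.
    exact: basis_coords.
  by move=> x; apply: conj_in_O_same.
exists (map_mx Num.floor (chgV u v u' v' *m V)); rewrite (floor_mxK Xi).
rewrite /V /lattice_form !mulmxA.
rewrite -(mulmxA (_ *m _ *m antidiag R)) -trmx_mul (chgK D0) trmx1 mulmx1.
rewrite -(mulmxA (_ *m Z)) antidiag2 mulmx1 /Z mulmxBr mulmx1 mulmxBl (chgVK D0).
by rewrite addrC subrK.
Qed.

(* N = A^-1 B is congruent to 1 modulo the different, so that Q = (A - B) / dlt and
   P = A + om' Q have all their products in Z; if s is the squarefree part of the
   squares of their entries, s divides det B = 1. *)
Lemma disc_tau A B (X : 'M[int]_(1 + (2 + 1))) : \det A = 1 -> \det B = 1 ->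
  conj_prod conj_in_O A B ->
  tau A B = 1%:M + map_mx intr X *m lattice_form u v u' v' ->
  forall i j, conj_in_O (A i j) (B i j).
Proof.
move=> dA dB hAB UE; have D0 := disc_neq0; have dl0 := dlt_neq0.
pose G : M4 := chg u v u' v' *m map_mx intr X.
have GO j : OK m (G k1 j).
  rewrite mxE sum4 !mxE /= !mul0r addr0 add0r.
  by apply: OKD; apply: OKM; rewrite ?(conj_OK conj_u) ?(conj_OK conj_v) //;
    try (by apply: conj_OK conj_u); try (by apply: conj_OK conj_v);
    apply: OK_int; rewrite intr_int.
have ZE : tens A B - 1%:M = G *m (chg u v u' v')^T *m antidiag R.
  rewrite -(tauK D0 A B) UE mulmxDr mulmx1 mulmxDl (chgK D0) addrC addKr.
  by rewrite /lattice_form /G -!mulmxA (chgK D0) mulmx1.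
(* By [ZE] the two middle entries of this row are one combination of u', v' and the same combination
   of u, v; their difference involves only u - u' and v - v', which are multiples of [dlt]. *)
have [t tO tE] : exists2 t : R, OK m t & A 0 0 * B 1 1 - A 0 1 * B 1 0 - 1 = t * dlt.
  have [a ea] := conj_in_O_sub conj_u; have [b eb] := conj_in_O_sub conj_v.
  exists (- (G k1 k1 * a%:~R + G k1 k2 * b%:~R)).
    by apply: OKN; apply: OKD; apply: OKM => //; apply: OK_int; rewrite intr_int.
  have chgT l j : (chg u v u' v')^T l j = chg u v u' v' j l by rewrite mxE.
  have sub1 i j : (tens A B - 1%:M) i j = tens A B i j - (i == j)%:R by rewrite !mxE.
  have e11 : tens A B k1 k1 - 1 = G k1 k1 * u' + G k1 k2 * v'.
    have := congr1 (fun M : M4 => M k1 k1) ZE.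
    by rewrite /= mul_antidiag sub1 [RHS]mxE sum4 !chgT !chgE /= !mulr0 addr0 add0r.
  have e12 : tens A B k1 k2 = G k1 k1 * u + G k1 k2 * v.
    have := congr1 (fun M : M4 => M k1 k2) ZE.
    by rewrite /= mul_antidiag sub1 [RHS]mxE sum4 !chgT !chgE /= !mulr0 addr0 add0r subr0.
  have -> : A 0 0 * B 1 1 - A 0 1 * B 1 0 - 1 = (tens A B k1 k1 - 1) - tens A B k1 k2.
    by rewrite !tensE /=; ring.
  by rewrite e11 e12 mulNr mulrDl -!mulrA -ea -eb; ring.
have OKz (z : int) : OK m (z%:~R : R) by apply: OK_int; rewrite intr_int.
have [w wE] := conj_in_O_sub (hAB 0 1 1 0).
have [x xE] := conj_in_O_sub (hAB 0 1 1 1).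
have [y yE] := conj_in_O_sub (hAB 0 0 1 0).
pose n00 := - conjK m t - w%:~R; pose n01 := - (x%:~R : R).
pose n10 := (y%:~R : R); pose n11 := t + w%:~R.
have tE' : A 1 1 * B 0 0 - A 1 0 * B 0 1 - 1 = conjK m t * - dlt.
  have hk : conj_in_K (A 0 0 * B 1 1 - A 0 1 * B 1 0 - 1) (A 1 1 * B 0 0 - A 1 0 * B 0 1 - 1).
    apply: conj_in_KB; last exact/conj_in_K_rat/is_rat_int/rpred1.
    by apply: conj_in_KB; apply: conj_in_O_K; apply: hAB.
  rewrite tE in hk; exact: (Kfun hk (conj_in_O_K (OM (OKc tO) conj_dlt))).
pose n : 'M[R]_2 := \matrix_(i, j)
  if i == 0 then if j == 0 then n00 else n01 else if j == 0 then n10 else n11.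
have nE : adj2 A *m B = 1%:M + dlt *: n.
  apply/matrixP; elim/ind2; elim/ind2; rewrite mulmx2 !mxE /=.
  - rewrite /n00 mulrDr mulrN [dlt * conjK m t]mulrC -[- (_ * dlt)]mulrN -tE' mulrN.
    by rewrite [dlt * _]mulrC -wE; ring.
  - rewrite /n01 mulrN [dlt * _]mulrC -xE; ring.
  - rewrite /n10 [dlt * _]mulrC -yE; ring.
  - rewrite /n11 mulrDr [dlt * t]mulrC -tE [dlt * _]mulrC -wE; ring.
have nO i j : OK m (n i j).
  have tO' : OK m (conjK m t) by apply: conj_OK (Osym (OKc tO)).
  move: i j; elim/ind2; elim/ind2; rewrite mxE /=.
  - by apply: OKD; [apply: OKN | apply: OKN; apply: OKz].
  - by apply: OKN; apply: OKz.
  - exact: OKz.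
  - by apply: OKD; last exact: OKz.
have BE : B = A + dlt *: (A *m n).
  by rewrite scalemxAr -[X in X + _]mulmx1 -mulmxDr -nE mulmxA mul_adj2 // mul1mx.
(* Solved from A = P - om' Q and B = P - om Q; the aim is to show that P and Q are integral. *)
pose Q : 'M[R]_2 := - (A *m n); pose P : 'M[R]_2 := A + om' *: Q.
have AE i j : A i j = P i j - om' * Q i j by rewrite /P !mxE; ring.
have BE' i j : B i j = P i j - om * Q i j.
  by rewrite {1}BE /P /Q !mxE; ring.
have om'O : OK m om' by apply: conj_OK (Osym (conj_in_O_omega R m)).
have QE i j : Q i j = dlt^-1 * A i j - dlt^-1 * B i j.
  by apply: (mulfI dl0); rewrite mulrBr !mulrA !mulfV // !mul1r AE BE'; ring.
have PE i j : P i j = (om / dlt) * A i j - (om' / dlt) * B i j.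
  have -> : P i j = A i j + om' * Q i j by rewrite AE; ring.
  by rewrite QE; field.
have Qn i j : Q i j = - (A i 0 * n 0 j + A i 1 * n 1 j) by rewrite /Q mxE mulmx2.
have PQ i j : P i j = A i j + om' * Q i j by rewrite AE; ring.
pose fam (z : R) := exists i j, z = P i j \/ z = Q i j.
have famO z : fam z -> exists i c d, [/\ OK m c, OK m d & z = A i 0 * c + A i 1 * d].
  move=> [i [j [->|->]]]; exists i.
    exists ((j == 0)%:R - om' * n 0 j), ((j == 1)%:R - om' * n 1 j).
    split.
    - by apply: OKD; [apply: OK_int; rewrite natr_int | apply: OKN; apply: OKM].
    - by apply: OKD; [apply: OK_int; rewrite natr_int | apply: OKN; apply: OKM].
    - rewrite PQ Qn; move: (n 0 j) (n 1 j) => n0 n1.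
      by move: j; elim/ind2; rewrite ?eqxx /=; ring.
  exists (- n 0 j), (- n 1 j); split; [exact: OKN | exact: OKN |].
  by rewrite Qn; ring.
(* In this form c' is conjugate to c, so a product of two members is a sum of traces and hence its
   own conjugate. *)
have famK z : fam z -> exists i j c c', conj_in_K c c' /\ z = c * A i j + c' * B i j.
  have hdl : conj_in_K dlt^-1 (- dlt^-1).
    by rewrite -invrN; apply: KV; apply: conj_in_O_K; apply: conj_dlt.
  move=> [i [j [->|->]]]; exists i, j.
    exists (om / dlt), (om' * - dlt^-1); split; last by rewrite PE; ring.
    by apply: conj_in_KM => //; apply: conj_in_O_K; apply: conj_in_O_omega.
  by exists dlt^-1, (- dlt^-1); split => //; rewrite QE; ring.
have hAA := conj_prod_entries hAB dB dA.
have fam_int s z : fam s -> fam z -> s * z \is a Num.int.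
  move=> fs ft.
  have yzO : OK m (s * z).
    have [i [c [d [cO dO ->]]]] := famO s fs; have [j [e [f [eO fO ->]]]] := famO z ft.
    have -> : (A i 0 * c + A i 1 * d) * (A j 0 * e + A j 1 * f) =
      (A i 0 * A j 0) * (c * e) + (A i 0 * A j 1) * (c * f) +
      ((A i 1 * A j 0) * (d * e) + (A i 1 * A j 1) * (d * f)) by ring.
    by do 2!apply: OKD; apply: OKM; try (by apply: OKM); apply: conj_OK (hAA _ _ _ _).
  apply: (conj_in_O_same m_gt1); have := OKc yzO.
  rewrite (_ : conjK m (s * z) = s * z) //; apply: (conjKE m_gt1 m_sqfree).
  have [i [j [c [c' [hc ->]]]]] := famK s fs; have [k [l [d [d' [hd ->]]]]] := famK z ft.
  have -> : (c * A i j + c' * B i j) * (d * A k l + d' * B k l) =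
      (c * d) * (A i j * A k l) + (c' * d') * (B i j * B k l) +
      ((c * d') * (A i j * B k l) + (c' * d) * (A k l * B i j)) by ring.
  apply: conj_in_KD; apply/conj_in_K_rat; apply: conj_in_K_trace.
    exact: (conj_in_KM (conj_in_KM hc hd) (conj_in_O_K (hAA i j k l))).
  exact: (conj_in_KM (conj_in_KM hc (conj_in_K_sym hd)) (conj_in_O_K (hAB i j k l))).
have [i0 [j0 Bij]] := nonzero_entry dB.
have [x0 fx0 x0n] : exists2 z, fam z & z != 0.
  have [P0|P0] := eqVneq (P i0 j0) 0; last by exists (P i0 j0) => //; exists i0, j0; left.
  exists (Q i0 j0); first by exists i0, j0; right.
  by apply: contraNneq Bij => Q0; rewrite BE' P0 Q0 mulr0 subrr.
have [N N0 NE] : exists2 N : nat, (0 < N)%N & x0 ^+ 2 = N%:R.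
  have /intrP[z zE] := fam_int _ _ fx0 fx0.
  have z0 : 0 < (z%:~R : R) by rewrite -zE -expr2 exprn_even_gt0.
  rewrite ltr0z in z0; exists `|z|%N; first by rewrite absz_gt0 gt_eqF.
  by rewrite expr2 zE -[LHS]/(z%:~R) -{1}[z]gez0_abs // ltW.
have [s [k [s0 k0 sqf NsE]]] := squarefree_decomposition N0.
have kR : k%:R != 0 :> R by rewrite pnatr_eq0 -lt0n.
have sR : s%:R != 0 :> R by rewrite pnatr_eq0 -lt0n.
pose r := x0 / k%:R.
have r2 : r ^+ 2 = s%:R by rewrite /r expr_div_n NE NsE natrM natrX mulfK ?expf_neq0.
(* z = c r with c = z x0 / (k s) rational, and c^2 s = z^2 is an integer, so c is an integer as s is
   squarefree. *)
have fam_r z : fam z -> exists2 c : R, c \is a Num.int & z = c * r.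
  move=> ft; exists (z * x0 / (k%:R * s%:R)); last first.
    have -> : z * x0 / (k%:R * s%:R) * r = z * (r ^+ 2) / s%:R.
      by rewrite /r; field; rewrite sR kR.
    by rewrite r2 mulfK.
  apply: (squarefree_rat_int sqf).
    apply: is_ratM; first by apply/is_rat_int/fam_int.
    by apply/is_ratV/is_ratM; apply/is_rat_int/natr_int.
  have -> : (z * x0 / (k%:R * s%:R)) ^+ 2 * s%:R = z * z * r ^+ 2 / s%:R.
    by rewrite /r; field; rewrite sR kR.
  by rewrite r2 mulfK //; apply: fam_int.
have famP i j : fam (P i j) by exists i, j; left.
have famQ i j : fam (Q i j) by exists i, j; right.
have Br i j : exists2 b : R, OK m b & B i j = b * r.
  have [c ci cE] := fam_r _ (famP i j); have [d di dE] := fam_r _ (famQ i j).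
  exists (c - om * d); last by rewrite BE' cE dE; ring.
  apply: OKD; first exact: OK_int.
  apply: OKN; apply: OKM; last exact: OK_int.
  exact: conj_OK (conj_in_O_omega R m).
have [b00 O00 E00] := Br 0 0; have [b01 O01 E01] := Br 0 1.
have [b10 O10 E10] := Br 1 0; have [b11 O11 E11] := Br 1 1.
have sV : s%:R * (b00 * b11 - b01 * b10) = 1 :> R.
  by transitivity (\det B) => //; rewrite -r2 det2 E00 E01 E10 E11; ring.
have bO : OK m (b00 * b11 - b01 * b10) by apply: OKD; [apply: OKM | apply: OKN; apply: OKM].
have bE : b00 * b11 - b01 * b10 = s%:R^-1.
  by apply: (mulfI sR); rewrite sV mulfV.
have /intrP[q qE] : (s%:R^-1 : R) \is a Num.int.
  apply: (conj_in_O_same m_gt1); rewrite bE in bO; have := OKc bO.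
  by rewrite (conjKE m_gt1 m_sqfree (conj_in_K_natV s)).
have s1 : s = 1%N.
  have : s%:Z * q = 1.
    by apply: (@intr_inj R); rewrite rmorphM /= -qE -[s%:~R]/(s%:R) mulfV.
  by move=> /(congr1 absz); rewrite abszM absz_nat => /eqP; rewrite muln_eq1 => /andP[/eqP].
have ri : r \is a Num.int.
  have /orP[/eqP ->|/eqP ->] : (r == 1) || (r == -1) by rewrite -eqf_sqr r2 s1 expr1n.
    exact: rpred1.
  by rewrite rpredN rpred1.
have fam_i z : fam z -> z \is a Num.int.
  by move=> /fam_r[c ci ->]; apply: rpredM.
move=> i j; rewrite AE BE'; apply: conj_in_OB; first exact/conj_in_O_int/fam_i.
apply: OM; last exact/conj_in_O_int/fam_i.
exact: (Osym (conj_in_O_omega R m)).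
Qed.
Local Notation S1 := (T_N (gram m u v) 1).

(** * The isomorphisms *)

Lemma SigmaKP A : SigmaK R m A <-> \det A = 1 /\ exists B, sig_pair A B.
Proof.
split=> [h|[dA [B [l [L [l0 LO AE _]]]]]].
  by split; [case: h | apply: sig_pair_exists].
by split => //; exists l, L.
Qed.

Lemma SigmaK_group : is_group_with_pm (SigmaK R m).
Proof.
have s1 : sig_pair 1%:M (map_mx (conjK m) 1%:M).
  exists 1%N, 1%:M; rewrite /scale_sqrt sqrtr1 invr1 !scale1r; split => //.
  by move=> i j; rewrite mxE; apply/OK_int/natr_int.
split; first apply: is_group_mx.
- by apply/SigmaKP; rewrite det1; split => //; eexists; exact: s1.
- move=> A B /SigmaKP[dA [A' hA]] /SigmaKP[dB [B' hB]]; apply/SigmaKP.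
  by rewrite det_mulmx dA dB mulr1; split => //; exists (A' *m B'); apply: sig_pairM.
- move=> A /SigmaKP[dA [A' hA]]; exists (adj2 A); last exact: mul_adj2.
  by apply/SigmaKP; rewrite det_adj2; split => //; exists (adj2 A'); apply: sig_pair_adj.
apply/SigmaKP; split; first by rewrite det2 !mxE /=; ring.
by eexists; apply: sig_pairN s1.
Qed.

Lemma entries_prod A B : (forall i j p q, OK m (A i j * A p q)) ->
  (forall i j p q, OK m (B i j * B p q)) -> forall i j p q, OK m ((A *m B) i j * (A *m B) p q).
Proof.
move=> hA hB i j p q; rewrite !mulmx2.
have -> : (A i 0 * B 0 j + A i 1 * B 1 j) * (A p 0 * B 0 q + A p 1 * B 1 q) =
  ((A i 0 * A p 0) * (B 0 j * B 0 q) + (A i 0 * A p 1) * (B 0 j * B 1 q)) +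
  ((A i 1 * A p 0) * (B 1 j * B 0 q) + (A i 1 * A p 1) * (B 1 j * B 1 q)) by ring.
by do 2!apply: OKD; apply: OKM.
Qed.

Lemma GammaK_star_group : is_group_with_pm (GammaK_star R m).
Proof.
have [[S1' SM _ _ _] SN] := SigmaK_group.
split; first apply: is_group_mx.
- apply/GammaK_starP; split => // i j p q; rewrite !mxE.
  by apply: OKM; apply/OK_int/natr_int.
- move=> A B /GammaK_starP[sA hA] /GammaK_starP[sB hB]; apply/GammaK_starP.
  by split; [apply: SM | apply: entries_prod].
- move=> A /GammaK_starP[/SigmaKP[dA [A' hA]] eA]; exists (adj2 A); last exact: mul_adj2.
  apply/GammaK_starP; split.
    by apply/SigmaKP; rewrite det_adj2; split => //; exists (adj2 A'); apply: sig_pair_adj.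
  elim/ind2; elim/ind2; elim/ind2; elim/ind2; rewrite !mxE /= ?mulrNN ?mulrN ?mulNr;
    try apply: OKN; exact: eA.
apply/GammaK_starP; split => // i j p q; rewrite !mxE mulrNN.
by apply: OKM; apply/OK_int/natr_int.
Qed.

Lemma GammaKP A : GammaK R m A <->
  \det A = 1 /\ forall i j, conj_in_O (A i j) (map_mx (conjK m) A i j).
Proof.
split=> [[AO dA]|[dA h]]; split => //.
  by move=> i j; apply: conj_mx_entry.
by move=> i j; apply: conj_OK (h i j).
Qed.

Lemma GammaK_group : is_group_with_pm (GammaK R m).
Proof.
have O1 : OK_mx m (1%:M : 'M[R]_2) by move=> i j; rewrite mxE; apply/OK_int/natr_int.
split; first apply: is_group_mx.
- by split => //; rewrite det1.
- move=> A B [AO dA] [BO dB]; split; first by case: (conj_mxM AO BO).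
  by rewrite det_mulmx dA dB mulr1.
- move=> A [AO dA]; exists (adj2 A); last exact: mul_adj2.
  split; last by rewrite det_adj2.
  by elim/ind2; elim/ind2; rewrite mxE //=; apply: OKN.
split; last by rewrite det2 !mxE /=; ring.
by move=> i j; rewrite mxE; apply: OKN.
Qed.

Lemma SO0P U : SO0 S1 U <-> exists A B, [/\ \det A = 1, \det B = 1 & U = tau A B].
Proof.
rewrite gram_form; split; first exact: (SO0_tau disc_neq0).
by move=> [A [B [dA dB ->]]]; apply: (tau_SO0 disc_neq0).
Qed.

Lemma SO0_ratP U : SO0_rat S1 U <-> exists A B,
  [/\ \det A = 1, \det B = 1, conj_prod conj_in_K A B & U = tau A B].
Proof.
split=> [[/SO0P[A [B [dA dB ->]]] h]|[A [B [dA dB h ->]]]].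
  by exists A, B; split => //; apply: rat_tau.
split; first by apply/SO0P; exists A, B.
exact: tau_rat.
Qed.

Lemma SO0_intP U : SO0_int S1 U <-> exists A B,
  [/\ \det A = 1, \det B = 1, conj_prod conj_in_O A B & U = tau A B].
Proof.
split=> [[/SO0P[A [B [dA dB ->]]] h]|[A [B [dA dB h ->]]]].
  exists A, B; split => //; apply: int_tau => // i j.
  by have [z ->] := h i j; apply: intr_int.
split; first by apply/SO0P; exists A, B.
by move=> i j; apply/intrP; apply: tau_int.
Qed.

Lemma detN2 A : \det (- A) = \det A.
Proof. by rewrite !det2 !mxE; ring. Qed.

Lemma tau_mulE A B C D : tau A B *m tau C D = tau (A *m C) (B *m D).
Proof. exact: (tauM disc_neq0). Qed.

Lemma tau_adj A B : \det A = 1 -> \det B = 1 -> tau A B *m tau (adj2 A) (adj2 B) = 1%:M.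
Proof. by move=> dA dB; rewrite tau_mulE !mul_adj2 // (tau1 disc_neq0). Qed.

(** Products are left as a hypothesis because they are immediate for rational or integral matrices;
    inverses are taken on the pair (A, B), where they are adjugates. *)
Lemma SO0_sub_group (C : R -> R -> Prop) (H : set M4) : conj_ring C ->
  (forall U, H U <-> exists A B, [/\ \det A = 1, \det B = 1, conj_prod C A B & U = tau A B]) ->
  (forall U V, H U -> H V -> H (U *m V)) -> is_group_with_pm H.
Proof.
move=> CR HP HM.
have H1 : H 1%:M.
  apply/HP; exists 1%:M, 1%:M; rewrite det1 (tau1 disc_neq0); split => //.
  have [z0 z1 _ CM _] := CR.
  have C1 a b : C ((1%:M : 'M[R]_2) a b) ((1%:M : 'M[R]_2) a b) by rewrite mxE; case: (a == b).
  by move=> i j p q; rewrite [X in C _ X]mulrC; apply: CM.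
split; first apply: is_group_mx => //.
  move=> U /HP[A [B [dA dB h ->]]]; exists (tau (adj2 A) (adj2 B)); last exact: tau_adj.
  apply/HP; exists (adj2 A), (adj2 B); rewrite !det_adj2; split => //.
  exact: conj_prod_adj.
move: H1 => /HP[A [B [dA dB h ->]]]; apply/HP; exists (- A), B.
rewrite detN2; split => //; last by rewrite tauNl.
have [_ _ _ _ [CN _]] := CR.
by move=> i j p q; rewrite !mxE !mulNr; apply: CN.
Qed.

Lemma SO0_rat_group : is_group_with_pm (SO0_rat S1).
Proof.
apply: (SO0_sub_group conj_ringK SO0_ratP) => U V.
move=> [/SO0P[A [B [dA dB UE]]] hU] [/SO0P[C [D [dC dD VE]]] hV]; split.
  apply/SO0P; exists (A *m C), (B *m D); rewrite UE VE tau_mulE !det_mulmx dA dB dC dD mulr1.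
  by split.
move=> i j; rewrite mxE -/(is_rat _); apply: (big_ind (@is_rat R)).
- exact/is_rat_int/rpred0.
- exact: is_ratD.
- by move=> k _; apply: is_ratM.
Qed.

Lemma SO0_int_mul U V : SO0_int S1 U -> SO0_int S1 V -> SO0_int S1 (U *m V).
Proof.
move=> [/SO0P[A [B [dA dB UE]]] hU] [/SO0P[C [D [dC dD VE]]] hV]; split.
  apply/SO0P; exists (A *m C), (B *m D); rewrite UE VE tau_mulE !det_mulmx dA dB dC dD mulr1.
  by split.
move=> i j; apply/intrP; rewrite mxE; apply: rpred_sum => k _.
by apply: rpredM; apply/intrP.
Qed.

Lemma SO0_int_group : is_group_with_pm (SO0_int S1).
Proof. exact: (SO0_sub_group conj_ringO SO0_intP SO0_int_mul). Qed.

Lemma tilde_pm A B U V : SigmaK R m A -> SigmaK R m B ->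
  is_tilde m u v A U -> is_tilde m u v B V -> pm A = pm B -> pm U = pm V.
Proof.
move=> /SigmaKP[dA _] _ /is_tildeP[A' hA ->] /is_tildeP[B' hB ->] /pm_eq[] BE; rewrite BE in hB *.
  by have [->|->] := sig_pair_uniq dA hA hB; rewrite ?tauNr ?pmN.
have := sig_pairN hB; rewrite opprK => hB'.
have [e|e] := sig_pair_uniq dA hA hB'; rewrite tauNl pmN -[B']opprK e ?opprK;
  by rewrite ?tauNr ?pmN.
Qed.

Lemma tilde_pm_inj A B U V : SigmaK R m A -> SigmaK R m B ->
  is_tilde m u v A U -> is_tilde m u v B V -> pm U = pm V -> pm A = pm B.
Proof.
move=> /SigmaKP[dA _] /SigmaKP[dB _] /is_tildeP[A' hA ->] /is_tildeP[B' hB ->].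
have dA' := sig_pair_det hA dA; have dB' := sig_pair_det hB dB.
move=> /pm_eq[e|e].
  by have [[-> _]|[-> _]] := tau_inj disc_neq0 dB dB' dA dA' e; rewrite ?pmN.
rewrite -tauNl in e.
have dA2 : \det (- A) = 1 by rewrite detN2.
by have [[-> _]|[-> _]] := tau_inj disc_neq0 dB dB' dA2 dA' e; rewrite ?opprK ?pmN.
Qed.

Lemma tilde_mul A B U V :
  is_tilde m u v A U -> is_tilde m u v B V -> is_tilde m u v (A *m B) (U *m V).
Proof.
move=> /is_tildeP[A' hA ->] /is_tildeP[B' hB ->]; apply/is_tildeP.
by exists (A' *m B'); [apply: sig_pairM | rewrite tau_mulE].
Qed.

Lemma tilde_rat A : SigmaK R m A -> exists2 U, is_tilde m u v A U & SO0_rat S1 U.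
Proof.
move=> /SigmaKP[dA [B hB]]; exists (tau A B); first by apply/is_tildeP; exists B.
apply/SO0_ratP; exists A, B; split => //; first exact: sig_pair_det hB dA.
exact: sig_pair_prod.
Qed.

(** [B] is the conjugate of [A] only up to sign, and the sign disappears in the coset. *)
Lemma tilde_surj A B : \det A = 1 -> \det B = 1 -> conj_prod conj_in_K A B ->
  exists V, [/\ SigmaK R m A, is_tilde m u v A V & pm V = pm (tau A B)].
Proof.
move=> dA dB h; have [hs|hs] := sig_pair_of_prod dA dB h.
  exists (tau A B); split => //; first by apply/SigmaKP; split => //; exists B.
  by apply/is_tildeP; exists B.
exists (tau A (- B)); split; first by apply/SigmaKP; split => //; exists (- B).
  by apply/is_tildeP; exists (- B).
by rewrite tauNr pmN.
Qed.

Lemma conj_prodOK A B : conj_prod conj_in_O A B -> conj_prod conj_in_K A B.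
Proof. by move=> h i j p q; apply: conj_in_O_K. Qed.

Lemma SigmaK_iso : exists phi : set 'M[R]_2 -> set M4,
  induced_by_tilde m u v (SigmaK R m) phi /\
  group_iso pm_mul (pm 1%:M) (mod_pm (SigmaK R m)) pm_mul (pm 1%:M) (mod_pm (SO0_rat S1)) phi.
Proof.
apply: pm_iso; [exact: SigmaK_group | exact: SO0_rat_group | exact: tilde_rat
  | exact: tilde_pm | exact: tilde_pm_inj | by move=> *; apply: tilde_mul |].
move=> U /SO0_ratP[A [B [dA dB h ->]]]; have [V [sA AV e]] := tilde_surj dA dB h.
by exists A, V.
Qed.

Lemma GammaK_star_iso : exists phi : set 'M[R]_2 -> set M4,
  induced_by_tilde m u v (GammaK_star R m) phi /\
  group_iso pm_mul (pm 1%:M) (mod_pm (GammaK_star R m))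
            pm_mul (pm 1%:M) (mod_pm (SO0_int S1)) phi.
Proof.
apply: pm_iso; [exact: GammaK_star_group | exact: SO0_int_group | | | | |].
- move=> A /GammaK_starP[/SigmaKP[dA [B hB]] hA].
  exists (tau A B); first by apply/is_tildeP; exists B.
  apply/SO0_intP; exists A, B; split => //; first exact: sig_pair_det hB dA.
  exact: conj_prod_of_entries.
- by move=> A B U V /GammaK_starP[sA _] /GammaK_starP[sB _]; apply: tilde_pm.
- by move=> A B U V /GammaK_starP[sA _] /GammaK_starP[sB _]; apply: tilde_pm_inj.
- by move=> *; apply: tilde_mul.
move=> U /SO0_intP[A [B [dA dB h ->]]].
have [V [sA AV e]] := tilde_surj dA dB (conj_prodOK h).
exists A, V; split => //; apply/GammaK_starP; split => // i j p q.
exact: conj_OK (conj_prod_entries h dB dA i j p q).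
Qed.

Lemma GammaK_conj_prod A : GammaK R m A -> conj_prod conj_in_O A (map_mx (conjK m) A).
Proof.
move=> /GammaKP[_ h] i j p q; rewrite [A p q * _]mulrC.
by apply: OM => //; apply: Osym.
Qed.

Lemma GammaK_det_conj A : GammaK R m A -> \det (map_mx (conjK m) A) = 1.
Proof.
move=> /GammaKP[dA h]; have := conj_detO h; rewrite dA => h1.
have k1 := conj_in_O_K (conj_in_O_int m (rpred1 _ : (1 : R) \is a Num.int)).
exact: (Kfun (conj_in_O_K h1) k1).
Qed.

Lemma tildeKE A : GammaK R m A -> tildeK m u v A = tau A (map_mx (conjK m) A).
Proof. by move=> /GammaK_conj_prod/conj_prodOK; apply: tilde_tau. Qed.

Lemma GammaK_conjN A : GammaK R m A -> map_mx (conjK m) (- A) = - map_mx (conjK m) A.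
Proof.
move=> [AO _]; apply/matrixP => i j; rewrite !mxE; exact: conj_in_O_opp (OKc (AO i j)).
Qed.

(** Conjugation in K changes the sign of M' together with that of M, and the two signs cancel; this
    is why the value is a matrix and not a coset. *)
Lemma tildeK_pm A B : GammaK R m A -> GammaK R m B -> pm A = pm B ->
  tildeK m u v A = tildeK m u v B.
Proof.
move=> gA gB /pm_eq[->//|e]; rewrite !tildeKE // e GammaK_conjN //.
by rewrite tauNl tauNr opprK.
Qed.

Lemma tildeK_inj A B : GammaK R m A -> GammaK R m B ->
  tildeK m u v A = tildeK m u v B -> pm A = pm B.
Proof.
move=> gA gB; rewrite !tildeKE // => e.
have [[_ dA] [_ dB]] := (gA, gB).
by have [[-> _]|[-> _]] := tau_inj disc_neq0 dA (GammaK_det_conj gA) dB (GammaK_det_conj gB) e;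
  rewrite ?pmN.
Qed.

Lemma tildeK_mul A B : GammaK R m A -> GammaK R m B ->
  tildeK m u v (A *m B) = tildeK m u v A *m tildeK m u v B.
Proof.
move=> gA gB; have gAB : GammaK R m (A *m B) by case: GammaK_group => [[_ GM _ _ _] _]; apply: GM.
rewrite !tildeKE // tau_mulE; congr (tau _ _).
by case: gA gB => AO _ [BO _]; case: (conj_mxM AO BO).
Qed.

Lemma tildeK_disc A : GammaK R m A -> disc_kernel S1 (tildeK m u v A).
Proof.
move=> gA; rewrite tildeKE //; have /GammaKP[dA h] := gA; split.
  apply/SO0_intP; exists A, (map_mx (conjK m) A); split => //; first exact: GammaK_det_conj.
  exact: GammaK_conj_prod.
by rewrite gram_form; apply: tau_disc.
Qed.

Lemma tildeK_surj U : disc_kernel S1 U -> exists2 A, GammaK R m A & tildeK m u v A = U.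
Proof.
move=> [/SO0_intP[A [B [dA dB hAB ->]]] [X]]; rewrite gram_form => UE.
have h := disc_tau dA dB hAB UE.
have gA : GammaK R m A by split => // i j; apply: conj_OK (h i j).
exists A => //; rewrite tildeKE //; congr (tau _ _).
by apply/matrixP => i j; rewrite mxE; apply: conj_in_O_conjK (h i j).
Qed.

Lemma GammaK_iso : is_group mulmx 1%:M (disc_kernel S1) /\
  exists phi : set 'M[R]_2 -> M4,
    (forall M, GammaK R m M -> phi (pm M) = tildeK m u v M) /\
    group_iso pm_mul (pm 1%:M) (mod_pm (GammaK R m)) mulmx 1%:M (disc_kernel S1) phi.
Proof.
have [gG _] := GammaK_group; have [G1 _ _ _ _] := gG.
pose phi (X : set 'M[R]_2) : M4 :=
  xget 0 [set U | exists2 A, GammaK R m A & X = pm A /\ U = tildeK m u v A].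
have phiE A : GammaK R m A -> phi (pm A) = tildeK m u v A.
  move=> gA; rewrite /phi; case: xgetP => [U _ [B gB [e ->]]|/(_ (tildeK m u v A)) h].
    exact/esym/tildeK_pm.
  by case: h; exists A.
have gM := is_group_mod_pm gG.
have phiM X Y : mod_pm (GammaK R m) X -> mod_pm (GammaK R m) Y ->
    phi (pm_mul X Y) = phi X *m phi Y.
  move=> [A gA <-] [B gB <-]; rewrite pm_mulE !phiE ?tildeK_mul //.
  by case: gG => _ GM _ _ _; apply: GM.
have phiH X : mod_pm (GammaK R m) X -> disc_kernel S1 (phi X).
  by move=> [A gA <-]; rewrite phiE //; apply: tildeK_disc.
have phiS U : disc_kernel S1 U -> exists2 X, mod_pm (GammaK R m) X & phi X = U.
  by move=> /tildeK_surj[A gA <-]; exists (pm A); [exists A | apply: phiE].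
have phi1 : phi (pm 1%:M) = 1%:M.
  rewrite phiE // tildeKE // -[RHS](tau1 disc_neq0); congr (tau _ _).
  apply/matrixP => i j; rewrite !mxE.
  by apply: (conj_in_O_conjK m_gt1 m_sqfree); apply/conj_in_O_int/natr_int.
have gD : is_group mulmx 1%:M (disc_kernel S1).
  by rewrite -phi1; apply: is_group_image gM phiM phiH phiS.
split => //; exists phi; split => //; split => //; split => //.
move=> X Y /set_mem[A gA <-] /set_mem[B gB <-]; rewrite !phiE //; exact: tildeK_inj.
Qed.

End Pairs.

Unset Implicit Arguments.

Theorem theorem2 (R : realType) (m : nat) (u v : R)
  (m_gt1 : (1 < m)%N) (m_sqfree : squarefree m)
  (uv_basis : OK_basis m u v) :
  let S1 := T_N (gram m u v) 1 in
  [/\ [/\ is_group_with_pm (SigmaK R m),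
          is_group_with_pm (SO0_rat S1)
        & exists phi : set 'M[R]_2 -> set 'M[R]_(1 + (2 + 1)),
            induced_by_tilde m u v (SigmaK R m) phi /\
            group_iso pm_mul (pm 1%:M) (mod_pm (SigmaK R m))
                      pm_mul (pm 1%:M) (mod_pm (SO0_rat S1)) phi],
      [/\ is_group_with_pm (GammaK_star R m),
          is_group_with_pm (SO0_int S1)
        & exists phi : set 'M[R]_2 -> set 'M[R]_(1 + (2 + 1)),
            induced_by_tilde m u v (GammaK_star R m) phi /\
            group_iso pm_mul (pm 1%:M) (mod_pm (GammaK_star R m))
                      pm_mul (pm 1%:M) (mod_pm (SO0_int S1)) phi]
    & [/\ is_group_with_pm (GammaK R m),
          is_group mulmx 1%:M (disc_kernel S1)
        & exists phi : set 'M[R]_2 -> 'M[R]_(1 + (2 + 1)),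
            (forall M, GammaK R m M -> phi (pm M) = tildeK m u v M) /\
            group_iso pm_mul (pm 1%:M) (mod_pm (GammaK R m))
                      mulmx 1%:M (disc_kernel S1) phi]].
Proof.
move=> S1; split; split.
- exact: SigmaK_group.
- exact: SO0_rat_group.
- exact: SigmaK_iso.
- exact: GammaK_star_group.
- exact: SO0_int_group.
- exact: GammaK_star_iso.
- exact: GammaK_group.
- by case: (GammaK_iso m_gt1 m_sqfree uv_basis).
- by case: (GammaK_iso m_gt1 m_sqfree uv_basis).
Qed.
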